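(* Let $c_L, c_{L,I}\in\mathbb C$ with $c_{L,I}\neq 0$, put $c_W=-24c_{L,I}^2$, and let $h,h_I\in\mathbb C$. Let $L^{\mathcal H}(h,h_I)$ be the irreducible highest weight module over the twisted Heisenberg--Virasoro algebra $\mathcal H$ of central charge $(c_L,0,c_{L,I})$ and highest weight $(h,h_I)$, regarded as a $W(2,2)$-module with central charge $(c_L,c_W)$ by letting $L(n)$ act as in $\mathcal H$ and $W(n)$ act by $W(n)=-2c_{L,I}(n+1)I(n)+\sum_{i\in\mathbb Z}I(-i)I(n+i)$ for all $n\in\mathbb Z$. (1) $L^{\mathcal H}(h,h_I)$ is irreducible as a $W(2,2)$-module if and only if $(h,h_I)\notin \mathcal{AT}_{\mathcal H}(c_L,c_{L,I})$. (2) If $(h,h_I)\in \mathcal{AT}_{\mathcal H}(c_L,c_{L,I})$, then $L^{\mathcal H}(h,h_I)$ is, as a $W(2,2)$-module, a non-split extension of two irreducible highest weight $W(2,2)$-modules.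
   Context: **Lie algebra $W(2,2)$**: complex Lie algebra with basis $\{L(n),W(n),C_L,C_W : n\in\mathbb Z\}$ and brackets $[L(n),L(m)]=(n-m)L(n+m)+\delta_{n,-m}\frac{n^3-n}{12}C_L$, $[L(n),W(m)]=(n-m)W(n+m)+\delta_{n,-m}\frac{n^3-n}{12}C_W$, $[W(n),W(m)]=0$, with $C_L,C_W$ central. A highest weight module of central charge $(c_L,c_W)$ and highest weight $(h,h_W)$ is generated by a nonzero vector killed by $L(n),W(n)$, $n>0$, on which $L(0),W(0),C_L,C_W$ act by $h,h_W,c_L,c_W$. **Twisted Heisenberg--Virasoro algebra $\mathcal H$**: complex Lie algebra with basis $\{L(n),I(n): n\in\mathbb Z\}\cup\{C_L,C_{LI},C_I\}$ and brackets $[L(n),L(m)]=(n-m)L(n+m)+\delta_{n,-m}\frac{n^3-n}{12}C_L$, $[L(n),I(m)]=-mI(n+m)-\delta_{n,-m}(n^2+n)C_{LI}$, $[I(n),I(m)]=n\delta_{n,-m}C_I$, with $C_L,C_{LI},C_I$ central. A highest weight module of central charge $(c_L,c_I,c_{L,I})$ and highest weight $(h,h_I)$ is generated by a nonzero vector killed by $L(n),I(n)$, $n>0$, on which $L(0),I(0),C_L,C_I,C_{LI}$ act by $h,h_I,c_L,c_I,c_{L,I}$. Here $c_I=0$ (so all $I(n)$ commute, and the infinite sum defining $W(n)$ is finite on each vector of a highest weight module). It is known that the formula for $W(n)$ makes every highest weight $\mathcal H$-module of central charge $(c_L,0,c_{L,I})$ a $W(2,2)$-module of central charge $(c_L,-24c_{L,I}^2)$.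 **Atypical weights**: for positive integers $p,r$ let $h_{p,r}=(1-p^2)\frac{c_L-2}{24}+p(p-1)+p\frac{1-r}{2}$, and let $\mathcal{AT}_{\mathcal H}(c_L,c_{L,I})=\{(h_{p,r},(1+ p)c_{L,I}) : p,r\in\mathbb Z_{>0}\}\cup\{(h_{p,r},(1-p)c_{L,I}) : p,r\in\mathbb Z_{>0}\}$. *)

(* Defs.v *)
From HB Require Import structures.
From mathcomp Require Import all_boot all_order all_algebra ring.
From mathcomp Require Import classical_sets fsbigop reals.
From mathcomp Require Import complex.
From mathcomp.multinomials Require Import freeg.

Set Implicit Arguments.
Unset Strict Implicit.
Unset Printing Implicit Defensive.

Import GRing.Theory Num.Theory.
Local Open Scope classical_set_scope.
Local Open Scope ring_scope.

Record lieAlgebra (K : fieldType) := LieAlgebra {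
  lie_sort :> lmodType K;
  lie_br : lie_sort -> lie_sort -> lie_sort;
  lie_brPl : forall a x x' y,
    lie_br (a *: x + x') y = a *: lie_br x y + lie_br x' y;
  lie_brPr : forall a x y y',
    lie_br x (a *: y + y') = a *: lie_br x y + lie_br x y';
  lie_brxx : forall x, lie_br x x = 0;
  lie_jacobi : forall x y z,
    lie_br x (lie_br y z) + lie_br y (lie_br z x) + lie_br z (lie_br x y) = 0
}.

Section FreeModule.
Context (K : fieldType) (B : choiceType).
Implicit Types (b : B) (x y z : {freeg B / K}).

Lemma freegZ (c : K) b : << c *g b >> = c *: << b >> :> {freeg B / K}.
Proof.
by apply/eqP/freeg_eqP => k; rewrite /= coeffZ !coeffU mul1r.
Qed.

Lemma freeg_ind (P : {freeg B / K} -> Prop) :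
  P 0 -> (forall c b x, P x -> P (c *: << b >> + x)) -> forall x, P x.
Proof.
move=> P0 PS x; rewrite -(freeg_sumE x).
elim: (dom x) => [|b s IH]; first by rewrite big_nil.
by rewrite big_cons freegZ; apply: PS.
Qed.

Lemma fglift0 (M : lmodType K) (f : B -> M) : fglift f 0 = 0.
Proof. by rewrite -[X in fglift f X](subrr 0) lift_is_additive subrr. Qed.

Lemma fglift_linear (M : lmodType K) (f : B -> M) : linear (fglift f).
Proof.
have fB := lift_is_additive f.
have f0 := fglift0 f.
have fD : {morph fglift f : x y / x + y}.
  by move=> x y; rewrite -{1}[y]opprK -[- y]sub0r !fB f0 sub0r opprK.
have fsum c x : fglift f (\sum_(b <- dom x) << c * coeff b x *g b >>)
                = c *: \sum_(b <- dom x) coeff b x *: f b.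
  rewrite scaler_sumr; elim: (dom x) => [|b s IH]; first by rewrite !big_nil.
  by rewrite !big_cons fD liftU IH scalerA.
move=> c x y; rewrite fD; congr (_ + _).
rewrite -[c *: x]/(fgscale c x) /fgscale fsum.
rewrite -[in RHS](freeg_sumE x); congr (_ *: _).
rewrite -[LHS]scale1r -fsum; congr (fglift f _).
by apply: eq_bigr => b _; rewrite mul1r.
Qed.

End FreeModule.

Section StructureConstants.
Context (K : fieldType) (B : choiceType) (t : B -> B -> {freeg B / K}).
Hypothesis t_alt : forall a, t a a = 0.
Hypothesis t_anti : forall a b, t a b = - t b a.

Definition table_br (x y : {freeg B / K}) : {freeg B / K} :=
  fglift (fun a => fglift (t a) y) x.

Hypothesis t_jacobi : forall a b c,
  table_br << a >> (t b c) + table_br << b >> (t c a)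
  + table_br << c >> (t a b) = 0.

Lemma table_brPl a x x' y :
  table_br (a *: x + x') y = a *: table_br x y + table_br x' y.
Proof. exact: fglift_linear. Qed.

Lemma table_brPr a x y y' :
  table_br x (a *: y + y') = a *: table_br x y + table_br x y'.
Proof.
elim/freeg_ind: x => [|c b x IH]; first by rewrite /table_br !fglift0 scaler0 addr0.
rewrite !table_brPl IH /table_br !liftU !scale1r fglift_linear.
rewrite !scalerDr !scalerA mulrC -!addrA; congr (_ + _).
by rewrite addrCA.
Qed.

Lemma table_br0l y : table_br 0 y = 0.
Proof. exact: fglift0. Qed.

Lemma table_br0r x : table_br x 0 = 0.
Proof.
by apply: (addrI (table_br x 0)); rewrite -{1}[table_br x 0]scale1r -table_brPr
  scale1r !addr0.
Qed.

Lemma table_brZr c x y : table_br x (c *: y) = c *: table_br x y.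
Proof. by rewrite -[c *: y]addr0 table_brPr table_br0r addr0. Qed.

Lemma table_brDr x y y' : table_br x (y + y') = table_br x y + table_br x y'.
Proof. by rewrite -{1}[y]scale1r table_brPr scale1r. Qed.

Lemma table_brNr x y : table_br x (- y) = - table_br x y.
Proof. by rewrite -!scaleN1r table_brZr. Qed.

Lemma table_brU a b : table_br << a >> << b >> = t a b.
Proof. by rewrite /table_br !liftU !scale1r. Qed.

Lemma table_brC x y : table_br x y = - table_br y x.
Proof.
elim/freeg_ind: x => [|c b x IHx]; first by rewrite table_br0l table_br0r oppr0.
rewrite table_brPl table_brPr IHx {IHx} opprD -scalerN; congr (_ *: _ + _).
elim/freeg_ind: y => [|d e y IHy]; first by rewrite table_br0l table_br0r oppr0.
by rewrite table_brPl table_brPr IHy opprD -scalerN !table_brU t_anti.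
Qed.

Lemma table_brxx x : table_br x x = 0.
Proof.
elim/freeg_ind: x => [|c b x IHx]; first exact: table_br0l.
rewrite table_brPl !table_brPr IHx table_brU t_alt scaler0 add0r addr0.
by rewrite [table_br x _]table_brC scalerN subrr.
Qed.

Lemma table_jacobi x y z :
  table_br x (table_br y z) + table_br y (table_br z x)
  + table_br z (table_br x y) = 0.
Proof.
have D6 (a b c d e f : {freeg B / K}) :
  (a + b) + (c + d) + (e + f) = (a + c + e) + (b + d + f).
  by rewrite [a + b + (c + d)]addrACA [LHS]addrACA.
elim/freeg_ind: x => [|k a x IHx].
  by rewrite !(table_br0l, table_br0r) !addr0.
rewrite !(table_brPl, table_brPr) D6 -!scalerDr IHx {IHx} addr0.
suff -> : table_br << a >> (table_br y z) + table_br y (table_br z << a >>)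
          + table_br z (table_br << a >> y) = 0 by rewrite scaler0.
elim/freeg_ind: y => [|l b y IHy].
  by rewrite !(table_br0l, table_br0r) !addr0.
rewrite !(table_brPl, table_brPr) D6 -!scalerDr IHy {IHy} addr0.
suff -> : table_br << a >> (table_br << b >> z)
          + table_br << b >> (table_br z << a >>)
          + table_br z (table_br << a >> << b >>) = 0 by rewrite scaler0.
elim/freeg_ind: z => [|m c z IHz].
  by rewrite !(table_br0l, table_br0r) !addr0.
rewrite !(table_brPl, table_brPr) D6 -!scalerDr IHz addr0.
by rewrite !table_brU t_jacobi scaler0.
Qed.

Definition lieAlgebra_of_table : lieAlgebra K :=
  LieAlgebra table_brPl table_brPr table_brxx table_jacobi.

End StructureConstants.

Inductive w22_basis := WL of int | WW of int | WCL | WCW.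
Inductive hvir_basis := HL of int | HI of int | HCL | HCLI | HCI.

Definition w22_code (b : w22_basis) : (int + int) + bool :=
  match b with
  | WL n => inl (inl n) | WW n => inl (inr n)
  | WCL => inr false | WCW => inr true
  end.
Definition w22_decode (c : (int + int) + bool) : w22_basis :=
  match c with
  | inl (inl n) => WL n | inl (inr n) => WW n
  | inr false => WCL | inr true => WCW
  end.
Lemma w22_codeK : cancel w22_code w22_decode.
Proof. by case. Qed.
HB.instance Definition _ := Choice.copy w22_basis (can_type w22_codeK).

Definition hvir_code (b : hvir_basis) : (int + int) + option bool :=
  match b with
  | HL n => inl (inl n) | HI n => inl (inr n)
  | HCL => inr (Some false) | HCLI => inr (Some true) | HCI => inr None
  end.
Definition hvir_decode (c : (int + int) + option bool) : hvir_basis :=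
  match c with
  | inl (inl n) => HL n | inl (inr n) => HI n
  | inr (Some false) => HCL | inr (Some true) => HCLI | inr None => HCI
  end.
Lemma hvir_codeK : cancel hvir_code hvir_decode.
Proof. by case. Qed.
HB.instance Definition _ := Choice.copy hvir_basis (can_type hvir_codeK).

Section LieAlgebras.
Context (K : fieldType).
Local Notation kron n m := ((n == - m :> int)%:R : K).

Definition w22_LL (n m : int) : {freeg w22_basis / K} :=
  (n - m)%:~R *: << WL (n + m) >>
  + (kron n m * ((n ^+ 3 - n)%:~R / 12)) *: << WCL >>.
Definition w22_LW (n m : int) : {freeg w22_basis / K} :=
  (n - m)%:~R *: << WW (n + m) >>
  + (kron n m * ((n ^+ 3 - n)%:~R / 12)) *: << WCW >>.

Definition w22_table (a b : w22_basis) : {freeg w22_basis / K} :=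
  match a, b with
  | WL n, WL m => w22_LL n m
  | WL n, WW m => w22_LW n m
  | WW n, WL m => - w22_LW m n
  | _, _ => 0
  end.

Definition hvir_LL (n m : int) : {freeg hvir_basis / K} :=
  (n - m)%:~R *: << HL (n + m) >>
  + (kron n m * ((n ^+ 3 - n)%:~R / 12)) *: << HCL >>.
Definition hvir_LI (n m : int) : {freeg hvir_basis / K} :=
  (- m)%:~R *: << HI (n + m) >>
  - (kron n m * (n ^+ 2 + n)%:~R) *: << HCLI >>.
Definition hvir_II (n m : int) : {freeg hvir_basis / K} :=
  (n%:~R * kron n m) *: << HCI >>.

Definition hvir_table (a b : hvir_basis) : {freeg hvir_basis / K} :=
  match a, b with
  | HL n, HL m => hvir_LL n m
  | HL n, HI m => hvir_LI n m
  | HI n, HL m => - hvir_LI m n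
  | HI n, HI m => hvir_II n m
  | _, _ => 0
  end.

Lemma kron_anti n m (c d : K) :
  (n = - m -> c = d) -> kron n m * c = kron m n * d.
Proof.
rewrite [m == - n]eq_sym eqr_oppLR; case: eqP => [-> ->|_ _] //.
by rewrite !mul0r.
Qed.

Lemma kron_diag n (c : K) : (n = 0 -> c = 0) -> kron n n * c = 0.
Proof.
rewrite eq_sym eqNr; case: eqP => [-> ->|_ _] //; first by rewrite mulr0.
by rewrite mul0r.
Qed.

Lemma w22_table_anti a b : w22_table a b = - w22_table b a.
Proof.
case: a b => [n|n||] [m|m||] //=; rewrite ?oppr0 ?opprK //.
rewrite /w22_LL [m + n]addrC opprD -!scaleNr.
congr (_ *: _ + _ *: _); first by ring.
by rewrite -mulrN; apply: kron_anti => ->; ring.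
Qed.

Lemma w22_table_alt a : w22_table a a = 0.
Proof.
case: a => [n|n||] //=; rewrite /w22_LL subrr scale0r add0r.
by rewrite kron_diag ?scale0r // => ->; rewrite expr0n subrr mul0r.
Qed.

Lemma hvir_table_anti a b : hvir_table a b = - hvir_table b a.
Proof.
case: a b => [n|n|||] [m|m|||] //=; rewrite ?oppr0 ?opprK //.
  rewrite /hvir_LL [m + n]addrC opprD -!scaleNr.
  congr (_ *: _ + _ *: _); first by ring.
  by rewrite -mulrN; apply: kron_anti => ->; ring.
rewrite /hvir_II -scaleNr; congr (_ *: _).
rewrite mulrC [m%:~R * _]mulrC -mulrN.
by apply: kron_anti => ->; ring.
Qed.

Lemma hvir_table_alt a : hvir_table a a = 0.
Proof.
case: a => [n|n|||] //=.
  rewrite /hvir_LL subrr scale0r add0r.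
  by rewrite kron_diag ?scale0r // => ->; rewrite expr0n subrr mul0r.
by rewrite /hvir_II mulrC kron_diag ?scale0r // => ->.
Qed.

Lemma w22_LL_jacobi n m k :
  (m - k)%:~R *: w22_LL n (m + k) + (k - n)%:~R *: w22_LL m (k + n)
  + (n - m)%:~R *: w22_LL k (n + m) = 0.
Proof.
rewrite /w22_LL -!addr_eq0.
have -> : m + (k + n) = n + (m + k) by ring.
have -> : k + (n + m) = n + (m + k) by ring.
apply/eqP/freeg_eqP => z; rewrite !(coeffD, coeffZ) coeff0.
move: (coeff z _) (coeff z _) => u v.
case: eqP => [/eqP|_] /=; last by ring.
by rewrite addrA addrC addr_eq0 => /eqP ->; ring.
Qed.

Lemma w22_LW_jacobi n m k :
  (m - k)%:~R *: w22_LW n (m + k) - (n - k)%:~R *: w22_LW m (n + k)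
  = (n - m)%:~R *: w22_LW (n + m) k.
Proof.
rewrite /w22_LW -!addr_eq0.
have -> : m + (n + k) = n + (m + k) by ring.
have -> : n + m + k = n + (m + k) by ring.
apply/eqP/freeg_eqP => z; rewrite !(coeffB, coeffD, coeffZ).
move: (coeff z _) (coeff z _) => u v.
case: eqP => [/eqP|_] /=; last by ring.
by rewrite addrA addrC addr_eq0 => /eqP ->; ring.
Qed.

Lemma w22_table_jacobi a b c :
  table_br w22_table << a >> (w22_table b c)
  + table_br w22_table << b >> (w22_table c a)
  + table_br w22_table << c >> (w22_table a b) = 0.
Proof.
have brE := (table_brDr, table_brNr, table_brZr, table_brU, table_br0r).
case: a b c => [n|n||] [m|m||] [k|k||] //=.
all: rewrite ?brE /= ?oppr0 ?scaler0 ?addr0 ?add0r ?subr0 //=.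
all: rewrite ?brE /= ?oppr0 ?scaler0 ?addr0 ?add0r ?subr0 //=.
- exact: w22_LL_jacobi.
- by rewrite w22_LW_jacobi scalerN subrr.
- by rewrite scalerN addrC addrA w22_LW_jacobi subrr.
- by rewrite scalerN -addrA w22_LW_jacobi addNr.
Qed.

Definition w22 : lieAlgebra K :=
  lieAlgebra_of_table w22_table_alt w22_table_anti w22_table_jacobi.

Lemma hvir_LL_jacobi n m k :
  (m - k)%:~R *: hvir_LL n (m + k) + (k - n)%:~R *: hvir_LL m (k + n)
  + (n - m)%:~R *: hvir_LL k (n + m) = 0.
Proof.
rewrite /hvir_LL -!addr_eq0.
have -> : m + (k + n) = n + (m + k) by ring.
have -> : k + (n + m) = n + (m + k) by ring.
apply/eqP/freeg_eqP => z; rewrite !(coeffD, coeffZ) coeff0.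
move: (coeff z _) (coeff z _) => u v.
case: eqP => [/eqP|_] /=; last by ring.
by rewrite addrA addrC addr_eq0 => /eqP ->; ring.
Qed.

Lemma hvir_LI_jacobi n m k :
  (- k)%:~R *: hvir_LI n (m + k) - (- k)%:~R *: hvir_LI m (n + k)
  = (n - m)%:~R *: hvir_LI (n + m) k.
Proof.
rewrite /hvir_LI -!addr_eq0.
have -> : m + (n + k) = n + (m + k) by ring.
have -> : n + m + k = n + (m + k) by ring.
apply/eqP/freeg_eqP => z; rewrite !(coeffB, coeffD, coeffZ).
move: (coeff z _) (coeff z _) => u v.
case: eqP => [/eqP|_] /=; last by ring.
by rewrite addrA addrC addr_eq0 => /eqP ->; ring.
Qed.

Lemma hvir_II_jacobi n m k :
  (- k)%:~R *: hvir_II n (m + k) = (- n)%:~R *: hvir_II k (m + n).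
Proof.
rewrite /hvir_II -!addr_eq0 !scalerA; congr (_ *: _).
have -> : k + (m + n) = n + (m + k) by ring.
by ring.
Qed.

Lemma hvir_table_jacobi a b c :
  table_br hvir_table << a >> (hvir_table b c)
  + table_br hvir_table << b >> (hvir_table c a)
  + table_br hvir_table << c >> (hvir_table a b) = 0.
Proof.
have brE := (table_brDr, table_brNr, table_brZr, table_brU, table_br0r).
case: a b c => [n|n|||] [m|m|||] [k|k|||] //=.
all: rewrite ?brE /= ?oppr0 ?scaler0 ?addr0 ?add0r ?subr0 //=.
all: rewrite ?brE /= ?oppr0 ?scaler0 ?addr0 ?add0r ?subr0 //=.
- exact: hvir_LL_jacobi.
- by rewrite hvir_LI_jacobi scalerN subrr.
- by rewrite scalerN addrC addrA hvir_LI_jacobi subrr.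
- by rewrite hvir_II_jacobi addNr.
- by rewrite scalerN -addrA hvir_LI_jacobi addNr.
- by rewrite hvir_II_jacobi subrr.
- by rewrite hvir_II_jacobi addNr.
Qed.

Definition hvir : lieAlgebra K :=
  lieAlgebra_of_table hvir_table_alt hvir_table_anti hvir_table_jacobi.

End LieAlgebras.

Section Modules.
Context (K : fieldType) (g : lieAlgebra K).

Definition lie_module (V : lmodType K) (act : g -> V -> V) : Prop :=
  [/\ forall v, linear (act^~ v), forall x, linear (act x) &
      forall x y v, act (lie_br x y) v = act x (act y v) - act y (act x v)].

Definition submodule (V : lmodType K) (act : g -> V -> V) (S : set V) : Prop :=
  [/\ S 0, forall a u v, S u -> S v -> S (a *: u + v) &
      forall x v, S v -> S (act x v)].

Definition irreducible_module (V : lmodType K) (act : g -> V -> V) : Prop :=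
  [/\ lie_module act, exists v : V, v != 0 &
      forall S, submodule act S -> S = [set 0] \/ S = setT].

Definition generates (V : lmodType K) (act : g -> V -> V) (v : V) : Prop :=
  forall S, submodule act S -> S v -> S = setT.

Definition module_hom (V1 V2 : lmodType K) (act1 : g -> V1 -> V1)
    (act2 : g -> V2 -> V2) (f : V1 -> V2) : Prop :=
  linear f /\ forall x v, f (act1 x v) = act2 x (f v).

Definition short_exact (V1 V V2 : lmodType K) (act1 : g -> V1 -> V1)
    (act : g -> V -> V) (act2 : g -> V2 -> V2) (i : V1 -> V) (q : V -> V2) :
    Prop :=
  [/\ module_hom act1 act i, module_hom act act2 q, injective i,
      forall w, exists v, q v = w & forall v, q v = 0 <-> range i v].

Definition splits (V V2 : lmodType K) (act : g -> V -> V)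
    (act2 : g -> V2 -> V2) (q : V -> V2) : Prop :=
  exists2 s : V2 -> V, module_hom act2 act s & cancel s q.

End Modules.

Section HighestWeight.
Context (K : fieldType).

Definition hvir_highest_weight_module (V : lmodType K)
    (act : hvir K -> V -> V) (cL cI cLI h hI : K) : Prop :=
  lie_module act /\ exists v : V,
  [/\ v != 0 /\ generates act v,
      forall n : int, 0 < n -> act << HL n >> v = 0 /\ act << HI n >> v = 0,
      act << HL 0 >> v = h *: v /\ act << HI 0 >> v = hI *: v &
      [/\ act << HCL >> v = cL *: v, act << HCI >> v = cI *: v &
          act << HCLI >> v = cLI *: v]].

Definition w22_highest_weight_module (V : lmodType K)
    (act : w22 K -> V -> V) (cL cW h hW : K) : Prop :=
  lie_module act /\ exists v : V,
  [/\ v != 0 /\ generates act v,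
      forall n : int, 0 < n -> act << WL n >> v = 0 /\ act << WW n >> v = 0,
      act << WL 0 >> v = h *: v /\ act << WW 0 >> v = hW *: v &
      act << WCL >> v = cL *: v /\ act << WCW >> v = cW *: v].

(* The sum over [int] is the finitely supported sum of [fsbigop]; on a highest
   weight module of level c_I = 0 it has finitely many nonzero terms. *)
Definition w22_op (V : lmodType K) (act : hvir K -> V -> V) (cL cLI : K)
    (b : w22_basis) (v : V) : V :=
  match b with
  | WL n => act << HL n >> v
  | WW n => (- 2 * cLI * (n + 1)%:~R) *: act << HI n >> v
            + \sum_(i \in [set: int]) act << HI (- i) >> (act << HI (n + i) >> v)
  | WCL => cL *: v
  | WCW => (- 24 * cLI ^+ 2) *: v
  end.

Definition w22_action (V : lmodType K) (act : hvir K -> V -> V) (cL cLI : K) :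
    w22 K -> V -> V :=
  fun x v => fglift (fun b => w22_op act cL cLI b v) x.

Definition w22_nonsplit_extension (V : lmodType K) (act : w22 K -> V -> V)
    (cL cW : K) : Prop :=
  lie_module act /\
  exists (V1 V2 : lmodType K) (act1 : w22 K -> V1 -> V1)
    (act2 : w22 K -> V2 -> V2) (i : V1 -> V) (q : V -> V2),
  [/\ irreducible_module act1 /\
      (exists h1 hW1, w22_highest_weight_module act1 cL cW h1 hW1),
      irreducible_module act2 /\
      (exists h2 hW2, w22_highest_weight_module act2 cL cW h2 hW2),
      short_exact act1 act act2 i q & ~ splits act act2 q].

Definition h_pr (cL : K) (p r : nat) : K :=
  (1 - p%:R ^+ 2) * ((cL - 2) / 24) + p%:R * (p%:R - 1)
  + p%:R * ((1 - r%:R) / 2).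

Definition atypical (cL cLI : K) : set (K * K) :=
  [set w | exists p r : nat, [/\ (0 < p)%N, (0 < r)%N &
             w = (h_pr cL p r, (1 + p%:R) * cLI)]]
  `|` [set w | exists p r : nat, [/\ (0 < p)%N, (0 < r)%N &
             w = (h_pr cL p r, (1 - p%:R) * cLI)]].

End HighestWeight.

(* Main.v *)
(* Put t = hI / cLI - 1. On suitable I-monomials W(n) acts as
   2 cLI (t - n) I(n), so if t is not a positive integer then a vector killed
   by all W(n), n > 0, is killed by all I(n), n > 0, and every nonzero
   W(2,2)-submodule contains the vacuum v. The contragredient dual of L(h, hI)
   is L(h, 2 cLI - hI); it changes t into -t and W(n) into its transpose W(-n),
   and taking annihilators reverses the lattice of W(2,2)-submodules. If t is
   not a nonzero integer, the vacuum criterion for the module and for its dual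
   gives irreducibility; otherwise duality reduces to t = - p with p > 0.

   In that case the Verma module has a singular vector of degree p, namely
   sum_i s_(p-i) L(-i) v plus a polynomial in the I(-k), where s_j is a Schur
   polynomial in the I(-k); it vanishes in L(h, hI). Multiplying by powers of
   I(-p) shows that, up to terms with fewer factors I(-p),
     L(-p) I(-p)^k v = (h_(p,k+1) - h) / (p cLI) I(-p)^(k+1) v.
   Hence the submodule generated by v climbs through all the powers of I(-p),
   unless h = h_(p,r) for some r. Then the span N of the terms with fewer than
   r factors I(-p) is a submodule, and stripping words of their letters L(-n)
   by W(n), and W(-n) by L(n), n != p, shows that N is the only proper nonzero
   submodule, which gives the non-split extension. *)

Require Import Defs.
From HB Require Import structures.
From mathcomp Require Import all_boot all_order all_algebra.
From mathcomp Require Import finmap ring zify.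
From mathcomp Require Import boolp classical_sets functions fsbigop reals complex.
From mathcomp.multinomials Require Import freeg.

Set Implicit Arguments.
Unset Strict Implicit.
Unset Printing Implicit Defensive.

Import Order.TTheory GRing.Theory Num.Theory.
Local Open Scope classical_set_scope.
Local Open Scope ring_scope.

(** * Subspaces and linear spans *)

Section Subspaces.
Context (K : fieldType) (V : lmodType K).
Implicit Types (S E : set V) (x y : V) (a : K).

(** No basis of [V] is computed: the words in [L(-n)], [W(-n)] and [I(-p)] are only shown to span.
    What a basis would give at once, such as I(-p)^r v lying outside N, is obtained from lowering
    operators: when a combination of words lies in a smaller space, brackets with W(n) or L(n) bring
    this down to its coefficients.

    The obstacle is the letter p. For hI = (1 - p) c the bracket of W(m) with L(-m) acts by 2 m c^2
    (p^2 - m^2) where W(0) acts by hW, and on vectors killed by the positive I(n) the coefficient of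
    I(-m) in W(-m) is 2 c (m - p). Both vanish at m = p, so L(-p) and W(-p) cannot be stripped and
    I(-p) cannot be recovered from W(-p). The words therefore avoid p: W(-p) reduces to the I(-m)
    with m < p, L(-p) is eliminated by the singular vector, and I(-p) becomes a letter of its own,
    counted by the filtration. *)

Definition subspace S :=
  S 0 /\ forall a x y, S x -> S y -> S (a *: x + y).

Lemma subsZ S a x : subspace S -> S x -> S (a *: x).
Proof. by move=> [S0 SD] Sx; rewrite -[_ *: _]addr0; apply: SD. Qed.

Lemma subsD S x y : subspace S -> S x -> S y -> S (x + y).
Proof. by move=> [S0 SD] Sx Sy; rewrite -[x]scale1r; apply: SD. Qed.

Lemma subsN S x : subspace S -> S x -> S (- x).
Proof. by move=> sS Sx; rewrite -scaleN1r; apply: subsZ. Qed.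

Lemma subsB S x y : subspace S -> S x -> S y -> S (x - y).
Proof. by move=> sS Sx Sy; apply: subsD => //; apply: subsN. Qed.

Lemma subs_sum S (J : Type) (r : seq J) (P : pred J) (F : J -> V) :
  subspace S -> (forall i, P i -> S (F i)) -> S (\sum_(i <- r | P i) F i).
Proof.
by move=> sS SF; elim/big_ind: _ => //; [case: sS | move=> x y; apply: subsD].
Qed.

Lemma subsDr S x y : subspace S -> S y -> S (x + y) -> S x.
Proof. by move=> sS Sy Sxy; rewrite -[x](addrK y); apply: subsB. Qed.

Lemma subsDl S x y : subspace S -> S x -> S (x + y) -> S y.
Proof. by move=> sS Sx; rewrite addrC; apply: subsDr. Qed.

Lemma subsZV S a x : subspace S -> a != 0 -> S (a *: x) -> S x.
Proof. by move=> sS a0 Sax; rewrite -[x](scalerK a0); apply: subsZ. Qed.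

Lemma subspace_set0 : subspace [set 0].
Proof. by split=> // a x y -> ->; rewrite scaler0 addr0. Qed.

Inductive lspan E : V -> Prop :=
| lspan0 : lspan E 0
| lspanS a e x : E e -> lspan E x -> lspan E (a *: e + x).

Lemma lspanW E e : E e -> lspan E e.
Proof.
by move=> Ee; rewrite -[e]addr0 -[e]scale1r; apply: lspanS => //; apply: lspan0.
Qed.

Lemma lspan_subspace E : subspace (lspan E).
Proof.
split=> [|a x y]; first exact: lspan0.
elim=> [|b e z Ee _ IH] Sy; first by rewrite scaler0 add0r.
by rewrite scalerDr scalerA -addrA; apply: lspanS => //; apply: IH.
Qed.

Lemma lspan_min E S : subspace S -> (forall e, E e -> S e) ->
  forall x, lspan E x -> S x.
Proof. by move=> [S0 SD] ES x; elim=> // a e y Ee _; apply: SD; apply: ES. Qed.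

Lemma lspan_sub E E' : (forall e, E e -> E' e) -> forall x, lspan E x -> lspan E' x.
Proof.
by move=> EE'; apply: lspan_min => [|e /EE']; [apply: lspan_subspace | apply: lspanW].
Qed.

End Subspaces.

Lemma subspace_preim (K : fieldType) (V W : lmodType K)
    (f : {linear W -> V}) (S : set V) :
  subspace S -> subspace (fun w : W => S (f w)).
Proof.
by move=> [S0 SD]; split=> [|a x y Sx Sy]; rewrite ?linear0 ?linearP //; apply: SD.
Qed.

Lemma lspan_map (K : fieldType) (V : lmodType K) (E S : set V)
    (f : {linear V -> V}) : subspace S ->
  (forall e, E e -> S (f e)) -> forall x, lspan E x -> S (f x).
Proof. by move=> sS; apply: lspan_min; apply: subspace_preim. Qed.

#[export] Hint Resolve lspan_subspace subspace_set0 : core.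

(** * Highest weight modules and their grading *)

(* The central elements and [I 0] are replaced by the scalars by which they
   act on an irreducible highest weight module; here [c_I = 0]. *)
Record hmod (K : fieldType) (V : lmodType K) (L I : int -> {linear V -> V})
    (cL c hI : K) : Prop := HMod {
  LLE : forall n m x, L n (L m x) = L m (L n x) + (n - m)%:~R *: L (n + m) x
    + ((n == - m)%:R * ((n ^+ 3 - n)%:~R / 12) * cL) *: x;
  LIE : forall n m x, L n (I m x) = I m (L n x) - m%:~R *: I (n + m) x
    - ((n == - m)%:R * (n ^+ 2 + n)%:~R * c) *: x;
  IIC : forall n m x, I n (I m x) = I m (I n x);
  I0E : forall x, I 0 x = hI *: x
}.

Section HighestWeightVector.
Context (K : numFieldType) (V : lmodType K) (L I : int -> {linear V -> V}).
Context (cL c hI : K) (H : hmod L I cL c hI).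

Record hwvec (h : K) (v : V) : Prop := HWVec {
  Lv : forall n, 0 < n -> L n v = 0;
  Iv : forall n, 0 < n -> I n v = 0;
  L0v : L 0 v = h *: v
}.

Definition hstable (S : set V) :=
  [/\ subspace S, forall n x, S x -> S (L n x) & forall n x, S x -> S (I n x)].

(* The elements of weight [h + d]. The degree is an [int], the negative ones
   being [0], so that no side condition is needed for [L n] and [I n]. *)
Inductive hs (v : V) : int -> V -> Prop :=
| hs_v : hs v 0 v
| hs_0 d : hs v d 0
| hs_D d a x y : hs v d x -> hs v d y -> hs v d (a *: x + y)
| hs_L d k x : 0 < k -> hs v d x -> hs v (d + k) (L (- k) x)
| hs_I d k x : 0 < k -> hs v d x -> hs v (d + k) (I (- k) x).

Lemma hs_subspace v d : subspace (hs v d).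
Proof. by split=> [|a x y]; [apply: hs_0 | apply: hs_D]. Qed.
#[local] Hint Resolve hs_subspace : core.

Lemma hs_cast v d d' x : hs v d x -> d = d' -> hs v d' x.
Proof. by move=> + <-. Qed.

Lemma hs_lt0 v d x : hs v d x -> d < 0 -> x = 0.
Proof.
elim=> [|//|d' a y z _ IHy _ IHz|d' k y k0 _ IH|d' k y k0 _ IH] dlt.
- by [].
- by rewrite IHy // IHz // scaler0 addr0.
- by rewrite IH ?linear0 //; lia.
- by rewrite IH ?linear0 //; lia.
Qed.

Section Fix.
Context (h : K) (v : V) (Hv : hwvec h v).

(** By induction on the construction of [x]; [n] stays general because passing a letter of degree
    [k] calls for the case [n - k]. *)
Lemma hs_LI d x : hs v d x ->
  forall n, hs v (d - n) (L n x) /\ hs v (d - n) (I n x).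
Proof.
elim=> [|{}d|{}d a y z _ IHy _ IHz|{}d k y k0 Hy IH|{}d k y k0 Hy IH] n.
- have [n0|n0|->] := ltrgt0P n.
  + by rewrite (Lv Hv) // (Iv Hv) //; split; apply: hs_0.
  + rewrite -[n]opprK; split; apply: (@hs_cast v (0 + - n)); try lia.
      by apply: hs_L; [lia | apply: hs_v].
    by apply: hs_I; [lia | apply: hs_v].
  + rewrite (L0v Hv) (I0E H); split; apply: subsZ => //; apply: hs_cast (hs_v _) _; lia.
- by rewrite !linear0; split; apply: hs_0.
- by rewrite !linearP; have [? ?] := IHy n; have [? ?] := IHz n; split; apply: hs_D.
- have [Ln In] := IH n; have [Lnk Ink] := IH (n - k).
  split.
    rewrite (LLE H); apply: subsD => //; first apply: subsD => //.
    + by apply: hs_cast (hs_L k0 Ln) _; lia.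
    + by apply: subsZ => //; apply: hs_cast Lnk _; lia.
    + case: eqP => [nk|_]; last by rewrite !mul0r scale0r; apply: hs_0.
      by apply: subsZ => //; apply: hs_cast Hy _; lia.
  have -> : I n (L (- k) y) = L (- k) (I n y) + n%:~R *: I (- k + n) y
      + ((- k == - n)%:R * ((- k) ^+ 2 + - k)%:~R * c) *: y.
    by rewrite (LIE H) addrAC !subrK.
  apply: subsD => //; first apply: subsD => //.
  + by apply: hs_cast (hs_L k0 In) _; lia.
  + by apply: subsZ => //; rewrite [- k + n]addrC; apply: hs_cast Ink _; lia.
  + case: eqP => [nk|_]; last by rewrite !mul0r scale0r; apply: hs_0.
    by apply: subsZ => //; apply: hs_cast Hy _; lia.
- have [Ln In] := IH n; have [Lnk Ink] := IH (n - k).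
  split; last by rewrite (IIC H); apply: hs_cast (hs_I k0 In) _; lia.
  rewrite (LIE H); apply: subsB => //; first apply: subsB => //.
  + by apply: hs_cast (hs_I k0 Ln) _; lia.
  + by apply: subsZ => //; apply: hs_cast Ink _; lia.
  + case: eqP => [nk|_]; last by rewrite !mul0r scale0r; apply: hs_0.
    by apply: subsZ => //; apply: hs_cast Hy _; lia.
Qed.

Lemma hsL d n x : hs v d x -> hs v (d - n) (L n x).
Proof. by move=> Hx; case: (hs_LI Hx n). Qed.

Lemma hsI d n x : hs v d x -> hs v (d - n) (I n x).
Proof. by move=> Hx; case: (hs_LI Hx n). Qed.

Lemma hs_L0 d x : hs v d x -> L 0 x = (h + d%:~R) *: x.
Proof.
elim=> [|{}d|{}d a y z _ IHy _ IHz|{}d k y k0 Hy IH|{}d k y k0 Hy IH].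
- by rewrite addr0 (L0v Hv).
- by rewrite linear0 scaler0.
- by rewrite linearP IHy IHz !scalerDr !scalerA mulrC.
- rewrite (LLE H) IH linearZ /= add0r sub0r opprK.
  rewrite [0 == _]eq_sym (gt_eqF k0) !mul0r scale0r addr0 -scalerDl.
  by congr (_ *: _); ring.
- rewrite (LIE H) IH linearZ /= add0r expr0n addr0 mulr0 mul0r scale0r subr0.
  by rewrite -scalerBl; congr (_ *: _); ring.
Qed.

Definition hsum (x : V) :=
  exists N (f : nat -> V), (forall i : nat, hs v i (f i)) /\ x = \sum_(i < N) f i.

Lemma hsum_mono N N' (f : nat -> V) : (N <= N')%N ->
  \sum_(i < N) f i = \sum_(i < N') (if (i < N)%N then f i else 0) :> V.
Proof.
move=> le; rewrite (big_ord_widen _ (fun i => f i) le).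
by rewrite big_mkcond.
Qed.

Lemma hsum_subspace : subspace hsum.
Proof.
split=> [|a x y [N [f [Hf ->]]] [N' [f' [Hf' ->]]]].
  by exists 0%N, (fun=> 0); split=> [i|]; [apply: hs_0 | rewrite big_ord0].
exists (maxn N N'); rewrite (hsum_mono _ (leq_maxl N N')).
rewrite (hsum_mono _ (leq_maxr N N')).
exists (fun i => a *: (if (i < N)%N then f i else 0)
                 + (if (i < N')%N then f' i else 0)); split=> [i|].
  by apply: hs_D; case: ifP => // _; apply: hs_0.
by rewrite big_split -scaler_sumr.
Qed.

Lemma hsum_hs d x : hs v d x -> hsum x.
Proof.
case: d => [d|d] Hx; last by rewrite (hs_lt0 Hx) //; case: hsum_subspace.
exists d.+1, (fun i => if i == d then x else 0); split=> [i|].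
  by case: eqP => [->//|_]; apply: hs_0.
rewrite (bigD1 ord_max) //= eqxx big1 ?addr0 // => i.
by rewrite -val_eqE /= => /negPf->.
Qed.

Lemma hsum_stable : hstable hsum.
Proof.
split; first exact: hsum_subspace.
  move=> n x [N [f [Hf ->]]]; rewrite linear_sum.
  by apply: subs_sum => [|i _]; [apply: hsum_subspace | apply/hsum_hs/hsL/Hf].
move=> n x [N [f [Hf ->]]]; rewrite linear_sum.
by apply: subs_sum => [|i _]; [apply: hsum_subspace | apply/hsum_hs/hsI/Hf].
Qed.

(* A Vandermonde argument: [L 0] separates the homogeneous components. *)
Lemma hs_comp (S : set V) : subspace S -> (forall x, S x -> S (L 0 x)) ->
  forall N (f : nat -> V), (forall i : nat, hs v i (f i)) ->
  S (\sum_(i < N) f i) -> forall i, (i < N)%N -> S (f i).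
Proof.
move=> sS SL; elim=> // N IH f Hf SN.
have Si i : (i < N)%N -> S (f i).
  move=> iN; apply: (@subsZV _ _ _ (i%:R - N%:R)) => //.
    by rewrite subr_eq0 eqr_nat ltn_eqF.
  apply: (IH (fun i => (i%:R - N%:R) *: f i)) => // [j|]; first exact: subsZ.
  have -> : \sum_(j < N) (j%:R - N%:R) *: f j =
      L 0 (\sum_(j < N.+1) f j) - (h + N%:R) *: \sum_(j < N.+1) f j.
    rewrite !big_ord_recr linearD linear_sum /= (hs_L0 (Hf N)) scalerDr.
    rewrite [X in _ - X]addrC opprD addrA addrK scaler_sumr -sumrB.
    apply: eq_bigr => j _; rewrite (hs_L0 (Hf j)) -scalerBl; congr (_ *: _).
    by rewrite -!pmulrn; ring.
  by apply: subsB => //; [apply: SL | apply: subsZ].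
move=> i; rewrite ltnS leq_eqVlt => /orP[/eqP->|]; last exact: Si.
move: SN; rewrite big_ord_recr /=; apply: subsDl => //.
by apply: subs_sum => // j _; apply: Si.
Qed.

Lemma hs_uniq d d' x : hs v d x -> hs v d' x -> d != d' -> x = 0.
Proof.
move=> Hd Hd' ne; apply/eqP; move: (hs_L0 Hd'); rewrite (hs_L0 Hd) => /eqP.
rewrite -subr_eq0 -scalerBl scaler_eq0 => /orP[|//].
have -> : h + d%:~R - (h + d'%:~R) = (d - d')%:~R by ring.
by rewrite intr_eq0 subr_eq0 (negPf ne).
Qed.

End Fix.
End HighestWeightVector.

(** * Finitely supported sums over the integers *)

Section IntegerSums.
Context (K : fieldType) (V : lmodType K).
Implicit Types (F G : int -> V).

(** The sum over [[set: int]] defaults to 0 on a family of infinite support, so additivity is proved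
    under this bound. *)
Definition finz F := exists C : nat, forall i : int, (C < `|i|)%N -> F i = 0.

Lemma zsum_seq F (r : seq int) : uniq r -> (forall i, i \notin r -> F i = 0) ->
  \sum_(i \in [set: int]) F i = \sum_(i <- r) F i.
Proof.
move=> ur Fr; rewrite (fsbigTE (seq_fset tt r)) => [|i]; last by rewrite seq_fsetE => /Fr.
apply: perm_big; apply: uniq_perm => [||i]; [exact: fset_uniq | exact: ur |].
by rewrite seq_fsetE.
Qed.

Definition zrange (C : nat) := [seq i%:Z - C%:Z | i <- iota 0 (2 * C).+1].

Lemma mem_zrange C i : (i \in zrange C) = (`|i| <= C)%N.
Proof.
apply/mapP/idP => [[j]|le].
  by rewrite mem_iota => /andP[_ jC] ->; lia.
by exists `|(i + C%:Z)%R|%N; rewrite ?mem_iota; lia.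
Qed.

Lemma zrange_uniq C : uniq (zrange C).
Proof. by rewrite map_inj_uniq ?iota_uniq // => i j /addIr[]. Qed.

Lemma zsumE F C : (forall i : int, (C < `|i|)%N -> F i = 0) ->
  \sum_(i \in [set: int]) F i = \sum_(i <- zrange C) F i.
Proof.
move=> FC; apply: zsum_seq => [|i]; first exact: zrange_uniq.
by rewrite mem_zrange -ltnNge => /FC.
Qed.

Lemma finzW F C C' : (C <= C')%N -> (forall i : int, (C < `|i|)%N -> F i = 0) ->
  forall i : int, (C' < `|i|)%N -> F i = 0.
Proof. by move=> le FC i /(leq_ltn_trans le)/FC. Qed.

Lemma finzD F G : finz F -> finz G -> finz (fun i => F i + G i).
Proof.
move=> [C FC] [C' GC]; exists (maxn C C') => i; rewrite gtn_max => /andP[Ci Ci'].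
by rewrite FC // GC // addr0.
Qed.

Lemma finzZ (a : int -> K) F : finz F -> finz (fun i => a i *: F i).
Proof. by move=> [C FC]; exists C => i /FC->; rewrite scaler0. Qed.

Lemma finz_delta a F : finz (fun i => (i == a)%:R *: F i).
Proof.
exists `|a|%N => i ia; case: eqP => [ai|_]; last by rewrite scale0r.
by rewrite ai ltnn in ia.
Qed.

Lemma finz_shift a F : finz F -> finz (fun i => F (i + a)).
Proof. by move=> [C FC]; exists (C + `|a|)%N => i iC; apply: FC; lia. Qed.

Lemma zsumD F G : finz F -> finz G ->
  \sum_(i \in [set: int]) (F i + G i)
  = \sum_(i \in [set: int]) F i + \sum_(i \in [set: int]) G i.
Proof.
move=> [C FC] [C' GC].
have FD := finzW (leq_maxl C C') FC; have GD := finzW (leq_maxr C C') GC.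
rewrite (zsumE FD) (zsumE GD) -big_split (@zsumE _ (maxn C C')) // => i iC.
by rewrite FD // GD // addr0.
Qed.

Lemma zsumZ a F : finz F ->
  a *: (\sum_(i \in [set: int]) F i) = \sum_(i \in [set: int]) a *: F i.
Proof.
move=> [C FC]; rewrite (zsumE FC) (@zsumE _ C) ?scaler_sumr // => i /FC->.
by rewrite scaler0.
Qed.

Lemma zsum_delta a F : \sum_(i \in [set: int]) (i == a)%:R *: F i = F a.
Proof.
rewrite (@zsum_seq _ [:: a]) // => [|i]; first by rewrite big_seq1 eqxx scale1r.
by rewrite inE => /negPf->; rewrite scale0r.
Qed.

Lemma zsum_shift a F :
  \sum_(i \in [set: int]) F i = \sum_(i \in [set: int]) F (i + a).
Proof.
rewrite (@reindex_fsbigT _ _ _ _ _ (fun i => i + a)) //.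
by exists (fun i => i - a) => i; rewrite ?addrK ?subrK.
Qed.

End IntegerSums.

Lemma zsum_map (K : fieldType) (V V' : lmodType K) (f : {linear V -> V'})
    (F : int -> V) : finz F ->
  f (\sum_(i \in [set: int]) F i) = \sum_(i \in [set: int]) f (F i).
Proof.
move=> [C FC]; rewrite (zsumE FC) (@zsumE _ _ _ C) ?linear_sum // => i /FC->.
by rewrite linear0.
Qed.

(** Irreducibility takes the form [hw_irr]: a nonzero stable subspace contains the vacuum, hence is
    everything by [hw_gen]. *)
Record hwmod (K : numFieldType) (V : lmodType K)
    (L I : int -> {linear V -> V}) (cL c h hI : K) (v : V) : Prop := HWMod {
  hw_mod : hmod L I cL c hI;
  hw_vec : hwvec L I h v;
  hw_n0 : v != 0;
  hw_gen : forall S, hstable L I S -> S v -> forall x, S x;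
  hw_irr : forall S, hstable L I S -> forall x, S x -> x != 0 -> S v
}.

(** * Homogeneous components and the quadratic operators W(n) *)

Section Graded.
Context (K : numFieldType) (V : lmodType K) (L I : int -> {linear V -> V}).
Context (cL c h hI : K) (v : V) (M : hwmod L I cL c h hI v).
Let H := hw_mod M.
Let Hv := hw_vec M.
Local Notation hsu := (hs L I).
Local Notation hs := (hsu v).

Lemma dec x : hsum L I v x.
Proof. by apply: (hw_gen M) (hsum_stable H Hv) _ x; apply/hsum_hs/hs_v. Qed.

(** If [u] were nonzero it would be a highest weight vector generating a submodule in degrees at
    least [d > 0]; irreducibility puts [v], of degree 0, in it, forcing [v = 0]. *)
Lemma hs_sing0 (d : int) u : hs d u -> 0 < d ->
  (forall n, 0 < n -> L n u = 0) -> (forall n, 0 < n -> I n u = 0) -> u = 0.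
Proof.
move=> Hu d0 Lu Iu; apply/eqP/negP => /negP u0.
have Hw : hwvec L I (h + d%:~R) u by split=> //; apply: (hs_L0 H Hv).
have Hshift e y : hsu u e y -> hs (e + d) y.
  elim=> [|{}e|{}e a y' z _ IHy _ IHz|{}e k y' k0 _ IH|{}e k y' k0 _ IH].
  - by rewrite add0r.
  - exact: hs_0.
  - exact: hs_D.
  - by apply: hs_cast (hs_L k0 IH) _; lia.
  - by apply: hs_cast (hs_I k0 IH) _; lia.
have [N [f [Hf Ev]]] : hsum L I u v.
  by apply: (hw_irr M) (hsum_stable H Hw) _ _ u0; apply/hsum_hs/hs_v.
have S0 : hsu v 0 (\sum_(i < N) f i) by rewrite -Ev; apply: hs_v.
case/negP: (hw_n0 M); rewrite Ev big1 // => i _.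
have A : hs 0 (f i).
  apply: (hs_comp H Hw _ _ Hf S0) => // [|x Hx]; first exact: hs_subspace.
  by rewrite -[0]subr0; apply: (hsL H Hv).
by apply: (hs_uniq H Hv (Hshift _ _ (Hf i)) A); lia.
Qed.

Lemma hs_0E x : hs 0 x -> exists a, x = a *: v.
Proof.
suff gen d y : hs d y -> d = 0 -> exists a, y = a *: v by move=> /gen; apply.
elim=> [_|{}d _|{}d a z z' _ IHy _ IHz dE|{}d k z k0 Hy _ dE|{}d k z k0 Hy _ dE].
- by exists 1; rewrite scale1r.
- by exists 0; rewrite scale0r.
- have [b ->] := IHy dE; have [e ->] := IHz dE.
  by exists (a * b + e); rewrite scalerDl scalerA.
- by exists 0; rewrite (hs_lt0 Hy) ?linear0 ?scale0r //; lia.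
- by exists 0; rewrite (hs_lt0 Hy) ?linear0 ?scale0r //; lia.
Qed.

(** Supplies vectors that are singular modulo [T]: by minimality of [d], a degree-lowering operator
    that preserves [S] sends [y] into [T]. *)
Lemma hs_minimal (S T : set V) :
  subspace S -> (forall x, S x -> S (L 0 x)) -> subspace T ->
  forall x, S x -> ~ T x ->
  exists (d : nat) y, [/\ hs d y, S y, ~ T y &
    forall (d' : int) z, d' < d -> hs d' z -> S z -> T z].
Proof.
move=> sS SL sT x Sx NTx.
have [N [f [Hf Ex]]] := dec x.
have Sf := hs_comp H Hv sS SL Hf (eq_ind x S Sx _ Ex).
pose P (d : nat) := `[< exists y, [/\ hs d y, S y & ~ T y] >].
have exP : exists d, P d.
  apply: contra_notP NTx => NP; rewrite Ex; apply: subs_sum => // i _.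
  apply: contra_notP NP => NTf; exists i; apply/asboolP; exists (f i).
  by split=> //; apply: Sf.
case: (ex_minnP exP) => d /asboolP[y [Hy Sy NTy]] dmin.
exists d, y; split=> // -[d'|d'] z lt Hz Sz; last first.
  by rewrite (hs_lt0 Hz) //; case: sT.
apply: contrapT => NTz; have : P d' by apply/asboolP; exists z.
by move/dmin; lia.
Qed.

Lemma hs_bounded d x : hs d x -> forall k, d < k -> I k x = 0.
Proof. by move=> Hx k dk; apply: (@hs_lt0 _ _ _ _ _ (d - k)); [apply: (hsI H Hv) | lia]. Qed.

Lemma I_bounded x : exists B : nat, forall k : int, B%:Z < k -> I k x = 0.
Proof.
have [N [f [Hf ->]]] := dec x; exists N => k Nk; rewrite linear_sum big1 // => i _.
by apply: hs_bounded (Hf i) _ _; have := ltn_ord i; lia.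
Qed.

(** The two indices have constant sum [a + b], so for large [|i|] one of them is too large not to
    kill [x]; commutativity brings it next to [x]. *)
Lemma finzII a b x : finz (fun i => I (a - i) (I (b + i) x)).
Proof.
have [B HB] := I_bounded x; exists (B + `|a| + `|b|)%N => i iB.
have [i0|i0] := ltP 0 i; first by rewrite HB ?linear0 //; lia.
by rewrite (IIC H) HB ?linear0 //; lia.
Qed.

Lemma finzII0 b x : finz (fun i => I (- i) (I (b + i) x)).
Proof.
have [C HC] := finzII 0 b x; exists C => i /HC; by rewrite sub0r.
Qed.

(** Replaces the correction [a] by its component of degree [d], so that degree arguments apply to
    it. *)
Lemma hs_component (S T : set V) (d : nat) e a : subspace S ->
  (forall x, S x -> S (L 0 x)) -> subspace T -> (forall x, T x -> T (L 0 x)) ->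
  hs d e -> T a -> S (e + a) -> exists a', [/\ T a', hs d a' & S (e + a')].
Proof.
move=> sS SL sT TL He Ta Sea; have [N [f [Hf aE]]] := dec a.
have Tf' i : (i < N)%N -> T (f i) by apply: (hs_comp H Hv sT TL Hf); rewrite -aE.
pose f' i := if (i < N)%N then f i else 0.
(* Padding beyond [d] makes the index [d] available even if [a] has no component there. *)
have aE' : a = \sum_(i < maxn N d.+1) f' i by rewrite aE (hsum_mono _ (leq_maxl N d.+1)).
have Tf'' i : T (f' i) by rewrite /f'; case: ifP => [/Tf'//|_]; case: sT.
have Hf' (i : nat) : hs i (f' i) by rewrite /f'; case: ifP => // _; apply: hs_0.
exists (f' d); split=> //.
pose f'' i := (if i == d then e else 0) + f' i.
have -> : e + f' d = f'' d by rewrite /f'' eqxx.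
have dN : (d < maxn N d.+1)%N by rewrite leq_max ltnSn orbT.
apply: (fun Hf2 S2 => hs_comp H Hv sS SL (f := f'') Hf2 S2 dN) => [i|].
  apply: subsD; [exact: hs_subspace | case: eqP => [->//|_]; exact: hs_0 | exact: Hf'].
rewrite big_split -aE' (bigD1 (Ordinal dN)) //= eqxx big1 ?addr0 // => i /eqP ne.
by case: eqP => // E; case: ne; apply: val_inj.
Qed.

(** Group the combination by degree: the components of degree other than [d] vanish, because [L 0]
    separates degrees. *)
Lemma lspan_hs (E : set V) (d : nat) x :
  (forall e, E e -> exists d' : nat, hs d' e) -> lspan E x -> hs d x ->
  lspan (fun e => E e /\ hs d e) x.
Proof.
move=> EH Ex Hx; pose T (i : nat) := lspan (fun e => E e /\ hs i e).
have sT i : subspace (T i) by apply: lspan_subspace.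
have TH i y : T i y -> hs i y.
  by apply: lspan_min => [|e []//]; apply: hs_subspace.
pose P y := exists N f, (forall i, T i (f i)) /\ y = \sum_(i < N) f i.
have widen N N' (f : nat -> V) : (N <= N')%N -> \sum_(i < N) f i =
    \sum_(i < N') (if (i < N)%N then f i else 0) by apply: hsum_mono.
have [N [f [Tf' xE]]] : P x.
  apply: lspan_min Ex => [|e Ee].
    split=> [|a y z [N [f [Tf1 ->]]] [N' [f' [Tf2 ->]]]].
      by exists 0%N, (fun=> 0); split=> [i|]; [case: (sT i) | rewrite big_ord0].
    exists (maxn N N'), (fun i => a *: (if (i < N)%N then f i else 0)
      + (if (i < N')%N then f' i else 0)); split=> [i|].
      apply: subsD => //; first apply: subsZ => //.
        by case: ifP => // _; case: (sT i).
      by case: ifP => // _; case: (sT i).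
    rewrite (widen _ _ f (leq_maxl N N')) (widen _ _ f' (leq_maxr N N')).
    by rewrite scaler_sumr -big_split.
  have [d' He] := EH e Ee.
  exists d'.+1, (fun i => if i == d' then e else 0); split=> [i|].
    by case: eqP => [->|_]; [apply: lspanW | case: (sT i)].
  rewrite (bigD1 ord_max) //= eqxx big1 ?addr0 // => i.
  by rewrite -val_eqE /= => /negPf->.
have Hf (i : nat) : hs i (f i) by apply: TH.
have Sd : hs d (\sum_(i < N) f i) by rewrite -xE.
have L0d y : hs d y -> hs d (L 0 y).
  by move=> Hy; rewrite -[d%:Z]subr0; apply: (hsL H Hv).
have Hd := hs_comp H Hv (hs_subspace _ _ _ _) L0d Hf Sd.
rewrite xE; apply: subs_sum => [|i _]; first exact: (sT d).
have [<-|ne] := eqVneq (i : nat) d; first exact: Tf'.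
rewrite (hs_uniq H Hv (Hf i) (Hd i (ltn_ord i))); last by [].
by case: (sT d).
Qed.

Definition Wop n x := (- 2 * c * (n + 1)%:~R) *: I n x
  + \sum_(i \in [set: int]) I (- i) (I (n + i) x).

Lemma Wop_linear n : linear (Wop n).
Proof.
move=> a x y; rewrite /Wop linearP !scalerDr !scalerA [a * _]mulrC -!addrA.
congr (_ + _); rewrite addrCA; congr (_ + _).
rewrite zsumZ; last exact: finzII0.
rewrite -zsumD; [|exact/finzZ/finzII0|exact: finzII0].
by apply: eq_fsbigr => i _; rewrite !linearP.
Qed.

Lemma Wop_I n m x : Wop n (I m x) = I m (Wop n x).
Proof.
rewrite /Wop linearD linearZ (IIC H) (zsum_map (I m)); last exact: finzII0.
congr (_ + _); apply: eq_fsbigr => i _.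
by rewrite (IIC H (n + i)) (IIC H (- i)).
Qed.

Lemma zsum_in (S : set V) (F : int -> V) : subspace S -> (forall i, S (F i)) ->
  S (\sum_(i \in [set: int]) F i).
Proof. by move=> sS SF; apply: subs_sum. Qed.

Lemma Wop_hs n d x : hs d x -> hs (d - n) (Wop n x).
Proof.
move=> Hx; apply: subsD; first exact: hs_subspace.
  by apply: subsZ; [apply: hs_subspace | apply: (hsI H Hv)].
apply: zsum_in => [|i]; first exact: hs_subspace.
by apply: hs_cast (hsI H Hv _ (hsI H Hv _ Hx)) _; lia.
Qed.

Lemma Wop_W n m x : Wop n (Wop m x) = Wop m (Wop n x).
Proof.
pose Wn : {linear V -> V} := HB.pack (Wop n)
  (GRing.isLinear.Build K V V *:%R (Wop n) (Wop_linear n)).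
have E y : Wop n y = Wn y by [].
rewrite {2}/Wop [RHS]/Wop (E (_ + _)) linearD linearZ (zsum_map Wn); last exact: finzII0.
congr (_ *: _ + _); first by rewrite -E Wop_I.
by apply: eq_fsbigr => i _; rewrite -E !Wop_I.
Qed.

(** Each factor of a quadratic term contributes one bracket. The central terms of these brackets are
    the two Kronecker deltas, which complete the linear part of W(n + m); the charge [-24 c^2] comes
    from the linear part of W(m). *)
Lemma LWop n m x : L n (Wop m x) = Wop m (L n x) + (n - m)%:~R *: Wop (n + m) x
  + ((n == - m)%:R * ((n ^+ 3 - n)%:~R / 12) * (- 24 * c ^+ 2)) *: x.
Proof.
have E i : L n (I (- i) (I (m + i) x)) = I (- i) (I (m + i) (L n x))
    + (i%:~R *: I (n - i) (I (m + i) x)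
    + ((- (m + i))%:~R *: I (- i) (I (n + m + i) x)
    + ((i == n)%:R *: ((- (n ^+ 2 + n)%:~R * c) *: I (m + i) x)
    + (i == - (n + m))%:R *: ((- (n ^+ 2 + n)%:~R * c) *: I (- i) x)))).
  rewrite (LIE H) (LIE H n (m + i)) !(linearB (I (- i))) !(linearZZ (I (- i))) /= opprK.
  have -> : (n == i) = (i == n) by rewrite eq_sym.
  have -> : (n == - (m + i)) = (i == - (n + m)) by apply/eqP/eqP; lia.
  rewrite -!scaleNr !scalerA [LHS](ACl (1*(4*(2*(5*3))))).
  have -> : n + (m + i) = n + m + i by ring.
  congr (_ + (_ *: I _ (I _ _) + (_ + (_ *: _ + _ *: _)))); first by ring.
  - by congr (_ *: _); ring.
  - by ring.
  - by ring.
rewrite /Wop linearD linearZ /= [L n (I m x)](LIE H) (zsum_map (L n)); last exact: finzII0.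
rewrite (eq_fsbigr _ _ (fun i _ => E i)) {E}.
have F1 := finzII0 m (L n x).
have F2 : finz (fun i => i%:~R *: I (n - i) (I (m + i) x)) by apply/finzZ/finzII.
have F3 : finz (fun i => (- (m + i))%:~R *: I (- i) (I (n + m + i) x)).
  by apply/finzZ/finzII0.
have F4 : finz (fun i => (i == n)%:R *: ((- (n ^+ 2 + n)%:~R * c) *: I (m + i) x)).
  exact: finz_delta.
have F5 : finz (fun i => (i == - (n + m))%:R *: ((- (n ^+ 2 + n)%:~R * c) *: I (- i) x)).
  exact: finz_delta.
have F45 := finzD F4 F5; have F35 := finzD F3 F45; have F25 := finzD F2 F35.
rewrite (zsumD F1 F25) (zsumD F2 F35) (zsumD F3 F45) (zsumD F4 F5) {F25 F35 F45 F4 F5}.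
rewrite (zsum_delta n (fun i => (- (n ^+ 2 + n)%:~R * c) *: I (m + i) x)).
rewrite (zsum_delta (- (n + m)) (fun i => (- (n ^+ 2 + n)%:~R * c) *: I (- i) x)).
rewrite opprK {F1}.
(* After the shift by [n] the coefficient is [i + n = (n - m) + (m + i)]; the second part cancels
   the other sum. *)
have {F2 F3} -> : \sum_(i \in [set: int]) i%:~R *: I (n - i) (I (m + i) x)
  = (n - m)%:~R *: \sum_(i \in [set: int]) I (- i) (I (n + m + i) x)
    - \sum_(i \in [set: int]) (- (m + i))%:~R *: I (- i) (I (n + m + i) x).
  rewrite (zsum_shift n) zsumZ; last exact: finzII0.
  apply/eqP; rewrite eq_sym subr_eq; apply/eqP.
  have E i : (i + n)%:~R *: I (n - (i + n)) (I (m + (i + n)) x)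
      = (i + n)%:~R *: I (- i) (I (n + m + i) x).
    by congr (_ *: I _ (I _ _)); ring.
  rewrite (eq_fsbigr _ _ (fun i _ => E i)) -zsumD; last exact: F3; last first.
    exact/finzZ/finzII0.
  apply: eq_fsbigr => i _.
  by rewrite -scalerDl; congr (_ *: _); ring.
move: (\sum_(i \in [set: int]) _) => T.
move: (\sum_(i \in [set: int]) _) => A.
move: (\sum_(i \in [set: int]) _) => S.
rewrite [m + n]addrC subrKA !(scalerBr, scalerDr) !scalerA -!scaleNr -scalerDl.
rewrite [LHS](AC (3*(1*(1*1))) (1*4*(2*6*5)*3)) /= -scalerDl.
congr (_ + _ + (_ *: _ + _) + _ *: _); first by ring.
case: eqP => [->|_]; last by rewrite !mul0r mulr0 oppr0.
have : (12 : K) != 0 by rewrite pnatr_eq0.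
by move=> ?; field.
Qed.

End Graded.

Lemma mklin_ex (K : fieldType) (V V' : lmodType K) (f : V -> V') :
  linear f -> {g : {linear V -> V'} | forall x, g x = f x}.
Proof.
move=> fL; pose g : {linear V -> V'} :=
  HB.pack f (GRing.isLinear.Build K V V' *:%R f fL).
by exists g.
Qed.

(** Taken from an opaque existence lemma, so that the linear map never unfolds and is handled
    through [mklinE]. *)
Definition mklin (K : fieldType) (V V' : lmodType K) (f : V -> V')
  (fL : linear f) : {linear V -> V'} := sval (mklin_ex fL).

Lemma mklinE (K : fieldType) (V V' : lmodType K) (f : V -> V') (fL : linear f) x :
  mklin fL x = f x.
Proof. exact: (svalP (mklin_ex fL)). Qed.

(** * The operators W(n) *)

Section WOperators.
Context (K : numFieldType) (V : lmodType K) (L I W : int -> {linear V -> V}).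
Context (cL c h hI : K) (v : V) (M : hwmod L I cL c h hI v).
Context (WE : forall n x, W n x = Wop I c n x).
Let H := hw_mod M.
Let Hv := hw_vec M.
Local Notation hs := (hs L I v).
Local Notation cW := (- 24 * c ^+ 2).
Local Notation hW := (hI ^+ 2 - 2 * c * hI).

Lemma WIC n m x : W n (I m x) = I m (W n x).
Proof. by rewrite !WE (Wop_I M). Qed.

Lemma WWC n m x : W n (W m x) = W m (W n x).
Proof. by rewrite !WE (Wop_W M). Qed.

Lemma LWE n m x : L n (W m x) = W m (L n x) + (n - m)%:~R *: W (n + m) x
  + ((n == - m)%:R * ((n ^+ 3 - n)%:~R / 12) * cW) *: x.
Proof. by rewrite !WE (LWop M). Qed.

Lemma WLE n m x : W n (L m x) = L m (W n x) + (n - m)%:~R *: W (n + m) x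
  + ((n == - m)%:R * ((n ^+ 3 - n)%:~R / 12) * cW) *: x.
Proof.
rewrite LWE [m + n]addrC [RHS](ACl (1*((2*4)*(3*5)))) /= -!scalerDl -[LHS]addr0.
congr (_ + _).
have -> : (m - n)%:~R + (n - m)%:~R = 0 :> K by ring.
have -> : (m == - n) = (n == - m) by apply/eqP/eqP; lia.
rewrite scale0r add0r -mulrDl -mulrDr -mulrDl.
case: eqP => [->|_]; last by rewrite !mul0r scale0r.
have -> : (m ^+ 3 - m)%:~R + ((- m) ^+ 3 - - m)%:~R = 0 :> K by ring.
by rewrite mul0r mulr0 mul0r scale0r.
Qed.

Lemma hsW n d x : hs d x -> hs (d - n) (W n x).
Proof. by rewrite WE; apply: (Wop_hs M). Qed.

(** The hypotheses kill all quadratic terms but the two with a factor [I 0], at [i = 0] and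
    [i = - n]; they add [2 hI] to the linear coefficient [- 2 c (n + 1)]. *)
Lemma W_top n x : 0 < n -> (forall a b, 0 < a -> 0 < b -> I a (I b x) = 0) ->
  (forall m, n < m -> I m x = 0) -> W n x = (2 * (hI - c * (n%:~R + 1))) *: I n x.
Proof.
move=> n0 Iab Im; rewrite WE /Wop (@zsum_seq _ _ _ [:: 0; - n]).
- rewrite big_cons big_seq1 oppr0 opprK subrr addr0 !(I0E H).
  by rewrite linearZ /= -!scalerDl; congr (_ *: _); ring.
- by rewrite /= inE andbT eq_sym oppr_eq0 gt_eqF.
- move=> i; rewrite !inE negb_or => /andP[i0 iN].
  have [lt|le] := ltP 0 i; first by rewrite Im ?linear0 //; lia.
  have [lt|le'] := ltP n (- i); first by rewrite (IIC H) Im ?linear0 //.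
  by apply: Iab; lia.
Qed.

Section IVacuum.
Context (x : V) (Ix : forall k, 0 < k -> I k x = 0).

Lemma W_pos n : 0 < n -> W n x = 0.
Proof.
move=> n0; rewrite WE /Wop Ix // scaler0 add0r (@zsum_seq _ _ _ [::]) ?big_nil //.
move=> i _; have [lt|le] := ltP 0 (n + i); first by rewrite Ix ?linear0.
by rewrite (IIC H) Ix ?linear0 //; lia.
Qed.

(** Only the indices from 0 to [m + 1] avoid a positive [I]; the two end terms carry [I 0] and join
    the linear term. *)
Lemma W_neg (m : nat) : W (- m.+1%:Z) x = (2 * (hI + c * m%:R)) *: I (- m.+1%:Z) x
  + \sum_(i < m) I (- i.+1%:Z) (I (- (m - i)%N%:Z) x).
Proof.
rewrite WE /Wop (@zsum_seq _ _ _ [seq i%:Z | i <- iota 0 m.+2]).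
- rewrite big_map -[iota 0 m.+2]/(index_iota 0 m.+2) big_nat_recl // big_nat_recr //=.
  rewrite big_mkord oppr0 addr0 addNr !(I0E H) linearZ /=.
  rewrite [LHS](AC (1*(1*(1*1))) (1*2*4*3)) /= -!scalerDl; congr (_ *: _ + _).
    by rewrite -natr1; ring.
  by apply: eq_bigr => i _; congr (I _ (I _ _)); have := ltn_ord i; lia.
- by rewrite map_inj_uniq ?iota_uniq // => i j [].
- move=> i iN; have [lt|le] := ltP i 0; first by rewrite (IIC H) Ix ?linear0 //; lia.
  have [lt|le'] := ltP 0 (- m.+1%:Z + i); first by rewrite Ix ?linear0.
  case/negP: iN; apply/mapP; exists `|i|%N; last by lia.
  by rewrite mem_iota; lia.
Qed.
End IVacuum.

(** [hW] collects the linear term and the term [i = 0]; every other term contains a positive [I],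
    which can be moved next to [x]. *)
Lemma W_0 (S : set V) x : subspace S -> (forall i, 0 < i -> S (I (- i) (I i x))) ->
  S (W 0 x - hW *: x).
Proof.
move=> sS Sx; have [C FC] := finzII0 M 0 x.
rewrite WE /Wop (zsumE FC) (bigD1_seq 0) ?zrange_uniq ?mem_zrange //=.
rewrite oppr0 addr0 add0r !(I0E H) !scalerA -scaleNr.
rewrite [X in S X](AC ((1*2)*1) ((4*(1*2))*3)) /= -!scalerDl.
have -> : - (hI ^+ 2 - 2 * c * hI) + (-2 * c * 1%:~R * hI + hI * hI) = 0 by ring.
rewrite scale0r add0r; apply: subs_sum => // i i0.
have [lt|lt|] := ltrgt0P i; last by move/eqP: i0.
  by rewrite ?add0r; apply: Sx.
by rewrite add0r (IIC H); have := Sx (- i); rewrite opprK; apply; lia.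
Qed.

Lemma W_0_vac x : (forall k, 0 < k -> I k x = 0) -> W 0 x = hW *: x.
Proof.
move=> Ix; apply/eqP; rewrite -subr_eq0; apply/eqP.
by apply: (W_0 (S := [set 0])) => // i i0; rewrite /= Ix ?linear0.
Qed.

Definition Imon (ns : seq int) x := foldr (fun n y => I n y) x ns.

Lemma Imon_I ns n x : Imon ns (I n x) = I n (Imon ns x).
Proof. by elim: ns => //= m ns ->; rewrite (IIC H). Qed.

Lemma Imon_W ns n x : Imon ns (W n x) = W n (Imon ns x).
Proof. by elim: ns => //= m ns ->; rewrite WIC. Qed.

Lemma Imon0 ns : Imon ns 0 = 0.
Proof. by elim: ns => //= m ns ->; rewrite linear0. Qed.

Definition pos (ns : seq int) := all (fun n => 0 < n) ns.

Lemma Imon_hs ns d x : pos ns -> hs d x ->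
  exists2 d', d' <= d - (size ns)%:Z & hs d' (Imon ns x).
Proof.
move=> + Hx; elim: ns => /= [_|n ns IH /andP[n0 /IH[d' le Hd']]].
  by exists d => //; rewrite subr0.
by exists (d' - n); [lia | apply: (hsI H Hv)].
Qed.

Lemma Imon_big ns (d : nat) x : pos ns -> hs d x -> (d < size ns)%N -> Imon ns x = 0.
Proof. by move=> pns /(Imon_hs pns)[d' le Hd'] lt; apply: (hs_lt0 Hd'); lia. Qed.

(* Descend on the degree [k] of the monomials in the [I n], [n > 0]: if those
   of degree [k + 1] kill [u] then on each [I]-monomial [x] of degree [k - 1]
   applied to [u] the top nonvanishing [I n x] is a nonzero multiple of [W n x]. *)
Lemma W_sing_I (d : nat) u :
  (forall n : nat, (0 < n)%N -> hI - c * (n%:R + 1) != 0) ->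
  hs d u -> (forall n, 0 < n -> W n u = 0) -> forall n, 0 < n -> I n u = 0.
Proof.
move=> nt Hu Wu.
suff P k : (0 < k)%N -> (k <= d.+1)%N -> forall ns, pos ns -> size ns = k -> Imon ns u = 0.
  by move=> n n0; apply: (P 1%N _ _ [:: n]) => //=; rewrite n0.
(* Descending induction on [k], run on [j = d + 1 - k]; at [k = d + 1] there are more positive
   letters than degrees. *)
move=> k0 kd; have [j jd] : exists j, (k + j = d.+1)%N by exists (d.+1 - k)%N; lia.
elim: j k k0 kd jd => [|j IH] k k0 kd jd ns pns sns.
  by apply: (Imon_big pns Hu); lia.
have {}IH := IH k.+1 isT ltac:(lia) ltac:(lia).
case: ns pns sns => [|n ns] /=; first by move=> _ k0'; rewrite -k0' in k0.
case/andP=> n0 pns sns; set x := Imon ns u.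
have Wx m : 0 < m -> W m x = 0 by move=> m0; rewrite /x -Imon_W Wu // Imon0.
have Iab a b : 0 < a -> 0 < b -> I a (I b x) = 0.
  by move=> a0 b0; apply: (IH [:: a, b & ns]); rewrite /= ?a0 ?b0 ?sns.
have [d' le Hx] := Imon_hs pns Hu.
have Imx m : d%:Z < m -> I m x = 0.
  by move=> dm; apply: (hs_lt0 (hsI H Hv m Hx)); lia.
(* Inner descending induction on [n]: [I n] kills [x] for [n > d], and [W_top] needs all larger
   indices settled. *)
have [i iE] : exists i : nat, (d%:Z - n < i%:Z) by exists `|(d%:Z - n)|%N.+1; lia.
elim: i n n0 iE => [|i IHi] n n0 iE; first by apply: Imx; lia.
have /eqP := Wx n n0; rewrite W_top // => [|m nm]; last by apply: IHi; lia.
rewrite scaler_eq0 mulf_eq0 pnatr_eq0 /= => /orP[|/eqP//].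
have -> : n = `|n|%N by lia.
by rewrite -pmulrn (negPf (nt _ _)) //; lia.
Qed.

Definition wstable (S : set V) :=
  [/\ subspace S, forall n x, S x -> S (L n x) & forall n x, S x -> S (W n x)].

(** A nonzero vector of least degree in [S] is killed by the positive [L] and [W], hence by the
    positive [I]; being singular, it has degree 0. *)
Lemma wstable_vac (S : set V) x :
  (forall n : nat, (0 < n)%N -> hI - c * (n%:R + 1) != 0) ->
  wstable S -> S x -> x != 0 -> S v.
Proof.
move=> nt [sS SL SW] Sx /eqP x0.
have [d [y [Hy Sy y0 ymin]]] := hs_minimal M sS (SL 0) (subspace_set0 V) Sx x0.
have Ly n : 0 < n -> L n y = 0.
  by move=> n0; apply: (ymin (d%:Z - n)); [lia | apply: (hsL H Hv) | apply: SL].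
have Wy n : 0 < n -> W n y = 0.
  by move=> n0; apply: (ymin (d%:Z - n)); [lia | apply: hsW | apply: SW].
have Iy := W_sing_I nt Hy Wy.
case: d Hy {ymin} => [|d] Hy; last by case: y0; apply: (hs_sing0 M Hy).
have [a ya] := hs_0E Hy; apply: (subsZV (a := a)) => //; last by rewrite -ya.
by apply/eqP => a0; apply: y0; rewrite ya a0 scale0r.
Qed.

(** [W 0 - hW] is a sum of terms [I(-i) I(i)], [i > 0], so each application lowers by one the number
    of positive letters that suffices to annihilate the vector. *)
Lemma W0_nilp (d : nat) x : hs d x ->
  exists N, iter N (fun y => W 0 y - hW *: y) x = 0.
Proof.
move=> Hx; exists d.+1; set f := fun y => _.
pose P k y := forall ns, pos ns -> size ns = k -> Imon ns y = 0.
have sP k : subspace (P k).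
  split=> [ns _ _|a y z Py Pz ns pns sns]; first exact: Imon0.
  suff -> : Imon ns (a *: y + z) = a *: Imon ns y + Imon ns z.
    by rewrite Py // Pz // scaler0 addr0.
  by elim: ns {pns sns} => //= n ns ->; rewrite linearP.
have Pf k y : P k.+1 y -> P k (f y).
  move=> Py; rewrite /f; apply: (W_0 (S := P k)) => [|i i0 ns pns sns]; first exact: sP.
  rewrite Imon_I Imon_I -[I i _]/(Imon (i :: ns) y) Py ?linear0 //= ?sns //.
  by rewrite i0.
have Pk k y j : P (k + j)%N y -> P k (iter j f y).
  elim: j k => [|j IH] k; first by rewrite addn0.
  by rewrite addnS -addSn => /IH; apply: Pf.
apply: (Pk 0%N x d.+1 _ [::]) => //; rewrite add0n => ns pns sns.
by apply: (Imon_big pns Hx); rewrite sns.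
Qed.

End WOperators.

(** * The singular vector of degree p *)

Section Schur.
Context (K : numFieldType) (V : lmodType K) (L I : int -> {linear V -> V}).
Context (cL c h hI : K) (v : V) (M : hwmod L I cL c h hI v).
Context (p : nat) (p0 : (0 < p)%N) (c0 : c != 0) (hIE : hI = (1 - p%:R) * c).
Let H := hw_mod M.
Let Hv := hw_vec M.
Local Notation hs := (hs L I v).

(* The coefficient of [z^j] in [exp (sum_k I(-k) z^k / (k c))], computed by
   Newton's identity with [f] as fuel. *)
Fixpoint schur_rec (f j : nat) (x : V) {struct f} : V :=
  if f is f'.+1 then
    if j is j'.+1 then
      (j'.+1%:R * c)^-1 *:
        \sum_(i < j'.+1) I (- i.+1%:Z) (schur_rec f' (j' - i)%N x)
    else x
  else x.

Lemma schur_rec_fuel f f' j x : (j <= f)%N -> (j <= f')%N ->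
  schur_rec f j x = schur_rec f' j x.
Proof.
elim: f f' j => [|f IH] [|f'] [|j] //= jf jf'.
by congr (_ *: _); apply: eq_bigr => i _; congr (I _ _); apply: IH; lia.
Qed.

(** Extended by 0 to negative indices, so that sums can be padded and shifted and Newton's identity
    holds with any number [N >= j] of summands. *)
Definition schur_fun (j : int) (x : V) : V :=
  if j is Posz n then schur_rec n n x else 0.

Lemma schur_fun_lt0 j x : j < 0 -> schur_fun j x = 0.
Proof. by case: j => // n lt; exfalso; lia. Qed.

Lemma newton_fun (N : nat) (j : int) x : j <= N%:Z ->
  \sum_(i < N) I (- i.+1%:Z) (schur_fun (j - i.+1%:Z) x)
  = (j%:~R * c) *: schur_fun j x.
Proof.
have Z (i : nat) (k : int) : k < i.+1%:Z -> schur_fun (k - i.+1%:Z) x = 0.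
  by move=> lt; apply: schur_fun_lt0; lia.
case: j => [[|j]|j] jN; last first.
- by rewrite scaler0 big1 // => i _; rewrite Z ?linear0 //; lia.
- have [k {N jN}->] : exists k, N = (j.+1 + k)%N by exists (N - j.+1)%N; lia.
  rewrite big_split_ord /= [X in _ + X]big1 ?addr0 => [|i _]; last first.
    by rewrite Z ?linear0 //; lia.
  rewrite scalerA mulfV ?scale1r ?mulf_neq0 ?pnatr_eq0 //.
  apply: eq_bigr => i _; congr (I _ _).
  have -> : j.+1%:Z - i.+1%:Z = (j - i)%N%:Z by have := ltn_ord i; lia.
  by apply: schur_rec_fuel; lia.
- by rewrite mul0r scale0r big1 // => i _; rewrite Z ?linear0 //; lia.
Qed.

Lemma schur_ind (P : int -> Prop) : (forall j, j < 0 -> P j) -> P 0 ->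
  (forall j, 0 < j -> (forall k, k < j -> P k) -> P j) -> forall j, P j.
Proof.
move=> Pn P0 PS.
suff Q (n : nat) : forall k : int, k < n%:Z -> P k.
  by move=> j; apply: (Q `|j|.+1%N); lia.
elim: n => [|n IH] k kn; first exact: Pn.
have [lt|gt|->//] := ltrgtP k 0; first exact: Pn.
by apply: PS => // i ik; apply: IH; lia.
Qed.

Lemma schur_cancel (j : int) (x y : V) : 0 < j -> (j%:~R * c) *: x = (j%:~R * c) *: y -> x = y.
Proof.
move=> j0; apply: scalerI; rewrite mulf_neq0 // intr_eq0; lia.
Qed.

Lemma schur_linear j : linear (schur_fun j).
Proof.
elim/schur_ind: j => [j j0|//|j j0 IH] a x y.
  by rewrite !schur_fun_lt0 // scaler0 addr0.
apply: (schur_cancel j0); have jle : j <= `|j|%N by lia.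
rewrite -(newton_fun _ jle) scalerDr scalerA mulrC -[(a * _) *: _]scalerA.
rewrite -!(newton_fun _ jle) scaler_sumr -big_split.
by apply: eq_bigr => i _; rewrite IH ?linearP //; lia.
Qed.

Definition schur j : {linear V -> V} := mklin (schur_linear j).
Local Notation s := schur.

Lemma schur_lt0 j x : j < 0 -> s j x = 0.
Proof. by move=> j0; rewrite mklinE schur_fun_lt0. Qed.

Lemma schur0 x : s 0 x = x.
Proof. exact: mklinE. Qed.

Lemma newton (N : nat) (j : int) x : j <= N%:Z ->
  \sum_(i < N) I (- i.+1%:Z) (s (j - i.+1%:Z) x) = (j%:~R * c) *: s j x.
Proof.
move=> jN; rewrite mklinE -(newton_fun x jN).
by apply: eq_bigr => i _; rewrite mklinE.
Qed.

Lemma schurI j n x : s j (I n x) = I n (s j x).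
Proof.
elim/schur_ind: j => [j j0||j j0 IH]; [by rewrite !schur_lt0 ?linear0|by rewrite !schur0|].
apply: (schur_cancel j0); have jle : j <= `|j|%N by lia.
rewrite -(newton _ jle) -[RHS]linearZZ -(newton _ jle) linear_sum.
by apply: eq_bigr => i _; rewrite IH ?(IIC H n) //; lia.
Qed.

Lemma schur_hs j d x : hs d x -> hs (d + j) (s j x).
Proof.
move=> Hx; elim/schur_ind: j => [j j0||j j0 IH].
- by rewrite schur_lt0 //; apply: hs_0.
- by rewrite addr0 schur0.
have jle : j <= `|j|%N by lia.
apply: (subsZV (a := j%:~R * c)); first exact: hs_subspace.
  by rewrite mulf_neq0 // intr_eq0; lia.
rewrite -(newton _ jle); apply: subs_sum => [|i _]; first exact: hs_subspace.
by apply: hs_cast (hsI H Hv _ (IH (j - i.+1%:Z) ltac:(lia))) _; lia.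
Qed.

Lemma schur_hsv j d x : hs d x -> forall e, e = d + j -> hs e (s j x).
Proof. by move=> Hx e ->; apply: schur_hs. Qed.

(** Multiply by [j c] and expand with Newton's identity. The bracket of [L 1] with [I(-1)]
    contributes [hI - 2 c = - (p + 1) c], exactly what makes the result divisible by [j]. *)
Lemma L1_schur j x :
  L 1 (s j x) = s j (L 1 x) + (j - p%:Z - 2)%:~R *: s (j - 1) x.
Proof.
elim/schur_ind: j x => [j j0||j j0 IH] x.
- by rewrite !schur_lt0 ?linear0 ?scaler0 ?addr0 //; lia.
- by rewrite !schur0 schur_lt0 // scaler0 addr0.
apply: (schur_cancel j0).
have [n nE] : exists n : nat, j = n by exists `|j|%N; lia.
have jle : j <= n.+1%:Z by lia.
rewrite -[LHS]linearZZ -(newton _ jle) linear_sum scalerDr -(newton _ jle).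
have E (i : 'I_n.+1) : L 1 (I (- i.+1%:Z) (s (j - i.+1%:Z) x)) =
    I (- i.+1%:Z) (s (j - i.+1%:Z) (L 1 x))
    + (j - i%:Z - p%:Z - 3)%:~R *: I (- i.+1%:Z) (s (j - 1 - i.+1%:Z) x)
    + (i%:Z + 1)%:~R *: I (- i%:Z) (s (j - i.+1%:Z) x)
    + (- ((i == 0%N :> nat)%:R * 2 * c)) *: s (j - i.+1%:Z) x.
  rewrite (LIE H) IH ?(linearD (I _)) ?(linearZZ (I _)); last by lia.
  rewrite -!scaleNr -!addrA; congr (_ + (_ *: I _ (s _ _) + (_ *: I _ _ + _ *: _))).
  - by congr (_%:~R); rewrite -addn1 PoszD; ring.
  - by ring.
  - by rewrite -rmorphN opprK -addn1 PoszD.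
  - by rewrite -addn1 PoszD; ring.
  - by rewrite opprK; congr (- (_%:R * _ * _)); lia.
rewrite (eq_bigr _ (fun i _ => E i)) !big_split [LHS](ACl (1*(2*(3*4)))) /=; congr (_ + _).
rewrite big_ord_recr /= [s (j - 1 - n.+1%:Z) x]schur_lt0 ?linear0 ?scaler0 ?addr0; last by lia.
rewrite [X in _ + (X + _)]big_ord_recl [X in _ + (_ + X)]big_ord_recl /=.
rewrite [X in _ + (_ + (_ + X))]big1 ?addr0 => [|i _]; last by rewrite !mul0r oppr0 scale0r.
rewrite oppr0 (I0E H) [X in X = _](AC (1*(2*1)) ((1*3)*(2*4))) /=.
have E2 (i : 'I_n) : (j - i%:Z - p%:Z - 3)%:~R *: I (- i.+1%:Z) (s (j - 1 - i.+1%:Z) x)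
    + ((bump 0 i)%:Z + 1)%:~R *: I (- (bump 0 i)%:Z) (s (j - (bump 0 i).+1%:Z) x)
    = (j - p%:Z - 1)%:~R *: I (- i.+1%:Z) (s (j - 1 - i.+1%:Z) x).
  rewrite /bump leq0n add1n.
  have -> : j - i.+2%:Z = j - 1 - i.+1%:Z by lia.
  by rewrite -scalerDl -rmorphD; congr (_%:~R *: _); rewrite -[i.+1]addn1 PoszD; ring.
rewrite -big_split (eq_bigr _ (fun i _ => E2 i)) -scaler_sumr newton; last by lia.
by rewrite !scalerA -!scalerDl hIE; congr (_ *: _); ring.
Qed.

(** As for [L 1]; the new term comes from the bracket of [L 2] with [I(-1)], which is [I 1]. *)
Lemma L2_schur j x : L 2 (s j x) = s j (L 2 x) + c^-1 *: s (j - 1) (I 1 x)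
  + (j - p%:Z - 4)%:~R *: s (j - 2) x.
Proof.
elim/schur_ind: j x => [j j0||j j0 IH] x.
- by rewrite !schur_lt0 ?linear0 ?scaler0 ?addr0 //; lia.
- by rewrite !schur0 !schur_lt0 // !scaler0 !addr0.
apply: (schur_cancel j0).
have [n nE] : exists n : nat, j = n by exists `|j|%N; lia.
have jle : j <= n.+2%:Z by lia.
rewrite -[LHS]linearZZ -(newton _ jle) linear_sum !scalerDr -(newton _ jle).
have E (i : 'I_n.+2) : L 2 (I (- i.+1%:Z) (s (j - i.+1%:Z) x)) =
    I (- i.+1%:Z) (s (j - i.+1%:Z) (L 2 x))
    + c^-1 *: I (- i.+1%:Z) (s (j - 1 - i.+1%:Z) (I 1 x))
    + (j - i%:Z - p%:Z - 5)%:~R *: I (- i.+1%:Z) (s (j - 2 - i.+1%:Z) x)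
    + (i%:Z + 1)%:~R *: I (1 - i%:Z) (s (j - i.+1%:Z) x)
    + (- ((i == 1%N :> nat)%:R * 6 * c)) *: s (j - i.+1%:Z) x.
  rewrite (LIE H) IH ?(linearD (I _)) ?(linearZZ (I _)); last by lia.
  rewrite -!scaleNr -!addrA.
  congr (_ + (_ *: I _ (s _ _) + (_ *: I _ (s _ _) + (_ *: I _ _ + _ *: _)))).
  - by ring.
  - by congr (_%:~R); rewrite -addn1 PoszD; ring.
  - by ring.
  - by rewrite -rmorphN opprK -addn1 PoszD.
  - by rewrite -addn1 PoszD; ring.
  - by rewrite opprK; congr (- (_%:R * _ * _)); lia.
rewrite (eq_bigr _ (fun i _ => E i)) !big_split [LHS](ACl (1*(2*(3*(4*5))))) /=.
rewrite -addrA; congr (_ + _); rewrite -scaler_sumr (newton (N := n.+2)); last by lia.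
rewrite 2!big_ord_recr /= ![s (j - 2 - _) x]schur_lt0 ?linear0 ?scaler0 ?addr0; try by lia.
rewrite !(big_ord_recl n.+1) !(big_ord_recl n) /=.
rewrite /bump /= [X in _ + (_ + (_ + (_ + (_ + X))))]big1 => [|i _]; last first.
  by rewrite !mul0r oppr0 scale0r.
have E2 (i : 'I_n) : (j - i%:Z - p%:Z - 5)%:~R *: I (- i.+1%:Z) (s (j - 2 - i.+1%:Z) x)
    + ((1 + (1 + i))%N%:Z + 1)%:~R *: I (1 - (1 + (1 + i))%N%:Z) (s (j - (1 + (1 + i)).+1%:Z) x)
    = (j - p%:Z - 2)%:~R *: I (- i.+1%:Z) (s (j - 2 - i.+1%:Z) x).
  have -> : j - (1 + (1 + i)).+1%:Z = j - 2 - i.+1%:Z by lia.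
  have -> : 1 - (1 + (1 + i))%N%:Z = - i.+1%:Z by lia.
  by rewrite -scalerDl -rmorphD; congr (_%:~R *: _); rewrite !PoszD; ring.
rewrite addr0 mul0r mul0r oppr0 scale0r add0r addn0.
rewrite subrr (I0E H) [0 + (_ + 0)]add0r addr0 [1%:~R *: _]scale1r.
rewrite [LHS](AC (1*(1*((1*(1*1))*1))) ((1*3)*((2*5)*(4*6)))) /=.
rewrite -big_split (eq_bigr _ (fun i _ => E2 i)) -scaler_sumr newton; last by lia.
rewrite -schurI !scalerA; congr (_ + _).
  by rewrite -[X in _ + X]scale1r -scalerDl; congr (_ *: _); field.
have -> : j - 2%N%:Z = j - 2 by [].
by rewrite -!scalerDl hIE; congr (_ *: _); ring.
Qed.

(** Killed by [L 1] and by the positive [I n], and sent by [L 2] to [- 12 c] times [s (p - 2) v].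
    Under [L 2] the main sum of [rel_vec] leaves [(cL - 2) / 2] times that vector, whence the factor
    [(cL - 2) / (24 c)]. *)
Definition rel_corr : V := \sum_(k < p) k.+1%:R *: I (- k.+1%:Z) (s (p%:Z - k.+1%:Z) v)
  - c *: s p v.

(* The singular vector of degree [p] of the Verma module, for
   [hI = (1 - p) c]; it therefore vanishes in the irreducible quotient. *)
Definition rel_vec : V := \sum_(i < p.+1) s (p%:Z - i%:Z) (L (- i%:Z) v)
  + ((cL - 2) / (24 * c)) *: rel_corr.

Lemma rel_corrE N : (p < N)%N ->
  rel_corr = \sum_(k < N) k.+1%:R *: I (- k.+1%:Z) (s (p%:Z - k.+1%:Z) v) - c *: s p v.
Proof.
move=> pN; rewrite /rel_corr; congr (_ - _).
have [k ->] : exists k, N = (p + k)%N by exists (N - p)%N; lia.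
rewrite big_split_ord /= [X in _ = _ + X]big1 ?addr0 // => i _.
by rewrite schur_lt0 ?linear0 ?scaler0 //; lia.
Qed.

Lemma rel_vecE N : (p < N)%N ->
  rel_vec = \sum_(i < N) s (p%:Z - i%:Z) (L (- i%:Z) v)
    + ((cL - 2) / (24 * c)) *: rel_corr.
Proof.
move=> pN; have [k ->] : exists k, N = (p.+1 + k)%N by exists (N - p.+1)%N; lia.
rewrite big_split_ord /= [X in _ = _ + X + _]big1 ?addr0 // => i _.
by rewrite schur_lt0 //; lia.
Qed.

Lemma Iv_schur j n : 0 < n -> I n (s j v) = 0.
Proof. by move=> n0; rewrite -schurI (Iv Hv) // linear0. Qed.

Lemma rel_corr_hs : hs p rel_corr.
Proof.
apply: subsB; first exact: hs_subspace.
  apply: subs_sum => [|i _]; first exact: hs_subspace.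
  apply: subsZ; first exact: hs_subspace.
  by apply: hs_cast (hsI H Hv _ (schur_hsv (hs_v L I v) (erefl _))) _; lia.
apply: subsZ; first exact: hs_subspace.
by apply: (schur_hsv (hs_v L I v)); lia.
Qed.

Lemma rel_vec_hs : hs p rel_vec.
Proof.
apply: subsD; first exact: hs_subspace.
  apply: subs_sum => [|i _]; first exact: hs_subspace.
  by apply: (schur_hsv (hsL H Hv _ (hs_v L I v))); lia.
by apply: subsZ; [apply: hs_subspace | apply: rel_corr_hs].
Qed.

Lemma I_rel_corr n : 0 < n -> I n rel_corr = 0.
Proof.
move=> n0; rewrite linearB linear_sum linearZZ Iv_schur // scaler0 subr0 big1 // => i _.
by rewrite linearZZ (IIC H) Iv_schur // linear0 scaler0.
Qed.

Lemma IL_v (n m : int) : 0 < n -> I n (L m v) = n%:~R *: I (n + m) v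
  + ((m == - n)%:R * ((n ^+ 2 - n)%:~R * c)) *: v.
Proof.
move=> n0; have := LIE H m n v; rewrite (Iv Hv n0) linear0.
move/esym/eqP; rewrite subr_eq add0r subr_eq => /eqP->.
rewrite [n + m]addrC [LHS]addrC; congr (_ + _ *: _).
case: eqP => [->|_]; last by rewrite !mul0r.
by rewrite !mul1r; congr (_%:~R * _); ring.
Qed.

(** The coefficient of [s (p - n) v] is n c ((1 - p) + (n - 1) + (p - n)) = 0: the term [i = n]
    gives [I 0] and the central part, the terms [i > n] add up by Newton's identity. *)
Lemma I_rel_vec n : 0 < n -> I n rel_vec = 0.
Proof.
move=> n0; have [m nE] : exists m : nat, n = m.+1%:Z by exists `|n|.-1%N; lia.
rewrite (@rel_vecE (m.+1 + p.+1)); last by lia.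
rewrite linearD linear_sum [I n (_ *: _)]linearZZ I_rel_corr // scaler0 addr0.
have E (i : int) : I n (s (p%:Z - i) (L (- i) v)) =
    n%:~R *: I (n - i) (s (p%:Z - i) v)
    + ((i == n)%:R * ((n ^+ 2 - n)%:~R * c)) *: s (p%:Z - i) v.
  by rewrite -schurI IL_v // linearD !linearZZ schurI eqr_opp.
rewrite (eq_bigr _ (fun (i : 'I_(m.+1 + p.+1)) _ => E i%:Z)) big_split_ord /= [X in X + _]big1 ?add0r => [|i _].
  rewrite big_split /= !big_ord_recl /=.
  rewrite [X in _ + (_ + X)]big1 ?addr0 => [|i _]; last first.
    by case: eqP => [|_]; [rewrite /bump; lia | rewrite mul0r scale0r].
  have -> : (m.+1 + 0)%N%:Z = n by rewrite nE addn0.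
  rewrite subrr eqxx mul1r (I0E H).
  have E2 (i : 'I_p) : n%:~R *: I (n - (m.+1 + bump 0 i)%N%:Z) (s (p%:Z - (m.+1 + bump 0 i)%N%:Z) v)
      = n%:~R *: I (- i.+1%:Z) (s (p%:Z - n - i.+1%:Z) v).
    by congr (_ *: I _ (s _ _)); rewrite /bump; lia.
  rewrite (eq_bigr _ (fun i _ => E2 i)) -scaler_sumr newton; last by lia.
  rewrite !scalerA -!scalerDl hIE.
  rewrite [X in X *: _](_ : _ = 0) ?scale0r //; ring.
rewrite Iv_schur ?scaler0 ?add0r; last by have := ltn_ord i; lia.
by case: eqP => [|_]; [have := ltn_ord i; lia | rewrite mul0r scale0r].
Qed.

Lemma L1_rel_corr : L 1 rel_corr = 0.
Proof.
have pp : (p < p.+2)%N by [].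
rewrite (rel_corrE pp) linearB linear_sum linearZZ L1_schur (Lv Hv) // linear0 add0r.
have E (k : nat) : L 1 (k.+1%:R *: I (- k.+1%:Z) (s (p%:Z - k.+1%:Z) v)) =
    (- ((k%:R + 1) * (k%:R + 3))) *: I (- k.+1%:Z) (s (p%:Z - 1 - k.+1%:Z) v)
    + (k%:R + 1) ^+ 2 *: I (- k%:Z) (s (p%:Z - k.+1%:Z) v)
    + (- ((k == 0%N)%:R * 2 * c)) *: s (p%:Z - k.+1%:Z) v.
  rewrite linearZZ (LIE H) L1_schur (Lv Hv) // linear0 add0r (linearZZ (I _)).
  rewrite !scalerBr !scalerA -!scaleNr.
  congr (_ *: I _ (s _ _) + _ *: I _ _ + _ *: _).
  - by rewrite -natr1 -addn1 PoszD; ring.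
  - by ring.
  - by rewrite -natr1 -addn1 PoszD; ring.
  - by rewrite -addn1 PoszD; ring.
  - rewrite opprK; have -> : (1 == k.+1%:Z) = (k == 0%N) by lia.
    case: eqP => [->|_]; last by rewrite !mul0r mulr0 oppr0.
    by ring.
rewrite (eq_bigr _ (fun (i : 'I_p.+2) _ => E i)) !big_split /=.
rewrite big_ord_recr /= [s (p%:Z - 1 - _) v]schur_lt0 ?linear0 ?scaler0 ?addr0; last by lia.
rewrite ![\sum_(i < p.+2) _]big_ord_recl /= [X in _ + (_ + X)]big1 => [|i _]; last first.
  by rewrite !mul0r oppr0 scale0r.
have E2 (i : nat) : (- ((i%:R + 1) * (i%:R + 3))) *: I (- i.+1%:Z) (s (p%:Z - 1 - i.+1%:Z) v)
    + ((bump 0 i)%:R + 1) ^+ 2 *: I (- (bump 0 i)%:Z) (s (p%:Z - (bump 0 i).+1%:Z) v)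
    = I (- i.+1%:Z) (s (p%:Z - 1 - i.+1%:Z) v).
  have -> : p%:Z - (bump 0 i).+1%:Z = p%:Z - 1 - i.+1%:Z by rewrite /bump; lia.
  by rewrite /bump leq0n add1n -scalerDl -natr1 -[RHS]scale1r; congr (_ *: _); ring.
rewrite [LHS](AC (((1*2)*2)*1) ((1*3)*(((2*4)*5)*6))) /= -big_split.
rewrite (eq_bigr _ (fun (i : 'I_p.+1) _ => E2 i)) newton; last by lia.
rewrite oppr0 (I0E H) addr0 !scalerA -!scaleNr -!scalerDl hIE.
by rewrite [X in X *: _](_ : _ = 0) ?scale0r //; ring.
Qed.

Lemma L2_rel_corr : L 2 rel_corr = (- 12 * c) *: s (p%:Z - 2) v.
Proof.
have pp : (p < p.+3)%N by lia.
have L2v j : L 2 (s j v) = (j - p%:Z - 4)%:~R *: s (j - 2) v.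
  by rewrite L2_schur (Lv Hv) // (Iv Hv) // !linear0 ?scaler0 !add0r.
rewrite (rel_corrE pp) linearB linear_sum linearZZ L2v.
have E (k : nat) : L 2 (k.+1%:R *: I (- k.+1%:Z) (s (p%:Z - k.+1%:Z) v)) =
    (- ((k%:R + 1) * (k%:R + 5))) *: I (- k.+1%:Z) (s (p%:Z - 2 - k.+1%:Z) v)
    + (k%:R + 1) ^+ 2 *: I (1 - k%:Z) (s (p%:Z - k.+1%:Z) v)
    + (- ((k == 1%N)%:R * 12 * c)) *: s (p%:Z - k.+1%:Z) v.
  rewrite linearZZ (LIE H) L2v (linearZZ (I _)).
  rewrite !scalerBr !scalerA -!scaleNr.
  congr (_ *: I _ (s _ _) + _ *: I _ _ + _ *: _).
  - by rewrite -natr1 -addn1 PoszD; ring.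
  - by ring.
  - by rewrite -natr1 -addn1 PoszD; ring.
  - by lia.
  - rewrite opprK; have -> : (2 == k.+1%:Z) = (k == 1%N) by lia.
    case: eqP => [->|_]; last by rewrite !mul0r mulr0 oppr0.
    by ring.
rewrite (eq_bigr _ (fun (i : 'I_p.+3) _ => E i)) !big_split /=.
rewrite 2!big_ord_recr /= ![s (p%:Z - 2 - _) v]schur_lt0 ?linear0 ?scaler0 ?addr0; try by lia.
rewrite !(big_ord_recl p.+2) !(big_ord_recl p.+1) /=.
rewrite [X in _ + (_ + (_ + X))]big1 => [|i _]; last first.
  by rewrite !mul0r oppr0 scale0r.
have E2 (i : nat) : (- ((i%:R + 1) * (i%:R + 5))) *: I (- i.+1%:Z) (s (p%:Z - 2 - i.+1%:Z) v)
    + ((bump 0 (bump 0 i))%:R + 1) ^+ 2 *: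
      I (1 - (bump 0 (bump 0 i))%:Z) (s (p%:Z - (bump 0 (bump 0 i)).+1%:Z) v)
    = 4 *: I (- i.+1%:Z) (s (p%:Z - 2 - i.+1%:Z) v).
  have -> : p%:Z - (bump 0 (bump 0 i)).+1%:Z = p%:Z - 2 - i.+1%:Z by rewrite /bump; lia.
  have -> : 1 - (bump 0 (bump 0 i))%:Z = - i.+1%:Z by rewrite /bump; lia.
  by rewrite /bump !leq0n !add1n -scalerDl -!natr1; congr (_ *: _); ring.
rewrite [I (1 - 0%N%:Z) _]Iv_schur // scaler0 !mul0r oppr0 scale0r !add0r addr0.
rewrite [LHS](AC (((1*2)*1)*1) ((1*3)*((2*4)*5))) /= -big_split.
rewrite (eq_bigr _ (fun (i : 'I_p.+1) _ => E2 i)) -scaler_sumr newton; last by lia.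
have -> : 1 - (bump 0 0)%:Z = 0 by [].
have -> : (bump 0 0)%:R = 1 :> K by [].
have -> : p%:Z - (bump 0 0).+1%:Z = p%:Z - 2 by [].
by rewrite (I0E H) !scalerA -!scaleNr -!scalerDl /= hIE; congr (_ *: _); ring.
Qed.

Lemma L1_rel_vec : L 1 rel_vec = 0.
Proof.
rewrite linearD linearZZ L1_rel_corr scaler0 addr0 linear_sum.
(* The factor of [L1_schur] at [p - i] is [- (i + 2)], so the sum telescopes; its ends vanish by
   [L 1 v = 0] and the negative index of [s]. *)
pose G (i : nat) := i.+1%:R *: s (p%:Z - i%:Z) (L (1 - i%:Z) v).
have E (i : nat) : L 1 (s (p%:Z - i%:Z) (L (- i%:Z) v)) = G i - G i.+1.
  rewrite L1_schur (LLE H) (Lv Hv (ltr01 : 0 < 1 :> int)) linear0 add0r expr1n subrr !mul0r mulr0 mul0r.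
  rewrite scale0r addr0 linearZZ -scaleNr /G; congr (_ *: _ + _ *: s _ (L _ v)).
  - by rewrite -natr1; ring.
  - by rewrite -!natr1; ring.
  - by lia.
  - by lia.
rewrite (eq_bigr _ (fun (i : 'I_p.+1) _ => E i)) -(big_mkord xpredT (fun i => G i - G i.+1)).
rewrite -[LHS]opprK -sumrN (eq_bigr (fun i => G i.+1 - G i)) => [|i _]; last by rewrite opprB.
rewrite telescope_sumr // opprB /G (Lv Hv) // linear0 schur_lt0; last by lia.
by rewrite !scaler0 subr0.
Qed.

Lemma L2_rel_vec : L 2 rel_vec = 0.
Proof.
rewrite (@rel_vecE p.+3); last by lia.
rewrite linearD linearZZ L2_rel_corr linear_sum.
(* Here the factor is [- (i + 4)] and [G i] meets [G (i + 2)]; the difference is split into two unit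
   steps. The central term leaves [cL / 2] and the [I] terms leave [- 1]. *)
pose G (i : nat) := (i%:R + 2) *: s (p%:Z - i%:Z) (L (2 - i%:Z) v).
have E (i : nat) : L 2 (s (p%:Z - i%:Z) (L (- i%:Z) v)) = (G i - G i.+1) + (G i.+1 - G i.+2)
    + ((i == 2%N)%:R * (cL / 2)) *: s (p%:Z - 2) v
    + c^-1 *: I (1 - i%:Z) (s (p%:Z - 1 - i%:Z) v).
  rewrite addrA subrK L2_schur (LLE H) (Lv Hv (ltr0n _ 2 : 0 < 2 :> int)) linear0 add0r IL_v //.
  have -> : (- i%:Z == - 1) = (1 == i%:Z) by rewrite eqr_opp eq_sym.
  rewrite expr1n subrr !mul0r mulr0 scale0r addr0 scale1r schurI !linearD !linearZZ.
  rewrite [LHS](ACl ((1*4)*2*3)) /= /G scalerN -scaleNr.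
  congr (_ *: s _ (L _ v) + _ *: s _ (L _ v) + _ + _ *: I _ (s _ v)).
  - by ring.
  - by rewrite -!natr1; ring.
  - by lia.
  - by lia.
  - rewrite opprK eq_sym; case: (i =P 2%N) => [->|ne].
      have -> : (2%N%:Z == 2) = true by [].
      rewrite !mul1r; congr (_ *: _); have : (12 : K) != 0 by rewrite pnatr_eq0.
      have : (2 : K) != 0 by rewrite pnatr_eq0.
      by move=> ? ?; field.
    have -> : (i%:Z == 2) = false by apply/eqP; lia.
    by rewrite !mul0r !scale0r.
  - by lia.
rewrite (eq_bigr _ (fun (i : 'I_p.+3) _ => E i)) big_split big_split big_split.
have tel (F : nat -> V) n : \sum_(i < n) (F i - F i.+1) = F 0%N - F n :> V.
  rewrite -(big_mkord xpredT (fun i => F i - F i.+1)) -[LHS]opprK -sumrN.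
  rewrite (eq_bigr (fun i => F i.+1 - F i)) => [|i _]; last by rewrite opprB.
  by rewrite telescope_sumr // opprB.
have G0 : G 0%N = 0 by rewrite /G (Lv Hv) // linear0 scaler0.
have G1 : G 1%N = 0 by rewrite /G (Lv Hv) // linear0 scaler0.
have Gp i : (p < i)%N -> G i = 0 by move=> pi; rewrite /G schur_lt0 ?scaler0 //; lia.
rewrite (tel G) (tel (fun i => G i.+1)) /= G0 G1 !Gp //; try by lia.
rewrite !subr0 !add0r.
have -> : \sum_(i < p.+3) ((i == 2%N :> nat)%:R * (cL / 2)) *: s (p%:Z - 2) v
    = (cL / 2) *: s (p%:Z - 2) v.
  rewrite !big_ord_recl /= big1 => [|i _]; last by rewrite mul0r scale0r.
  by rewrite !mul0r !scale0r !add0r addr0 mul1r.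
rewrite (big_ord_recl p.+2) (big_ord_recl p.+1) /= Iv_schur // scaler0 add0r.
have -> : 1 - (bump 0 0)%:Z = 0 by [].
have -> : p%:Z - 1 - (bump 0 0)%:Z = p%:Z - 2 by rewrite /bump; lia.
have E2 (i : nat) : c^-1 *: I (1 - (bump 0 (bump 0 i))%:Z) (s (p%:Z - 1 - (bump 0 (bump 0 i))%:Z) v)
    = c^-1 *: I (- i.+1%:Z) (s (p%:Z - 2 - i.+1%:Z) v).
  by congr (_ *: I _ (s _ _)); rewrite /bump; lia.
rewrite (eq_bigr _ (fun (i : 'I_p.+1) _ => E2 i)) -scaler_sumr newton; last by lia.
rewrite (I0E H) !scalerA -!scalerDl [X in X *: _](_ : _ = 0) ?scale0r //.
rewrite hIE; have : (24 : K) != 0 by rewrite pnatr_eq0.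
have : (2 : K) != 0 by rewrite pnatr_eq0.
by move=> ? ?; field; rewrite c0.
Qed.

(** The bracket of [L 1] with [L (m + 2)] is a nonzero multiple of [L (m + 3)], so [L 1] and [L 2]
    suffice. *)
Lemma L_rel_vec n : 0 < n -> L n rel_vec = 0.
Proof.
suff P (m : nat) : L m.+1%:Z rel_vec = 0.
  by move=> n0; have -> : n = `|n|.-1.+1%:Z by lia.
elim: m => [|[|m] IH]; [exact: L1_rel_vec | exact: L2_rel_vec |].
have := LLE H 1 m.+2%:Z rel_vec; rewrite IH L1_rel_vec !linear0 add0r.
have -> : (1 == - m.+2%:Z) = false by lia.
rewrite !mul0r scale0r addr0 => /esym/eqP; rewrite scaler_eq0 intr_eq0 => /orP[|/eqP].
  by move=> /eqP; lia.
by have -> : 1 + m.+2%:Z = m.+3%:Z by lia.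
Qed.

Lemma rel_vec0 : rel_vec = 0.
Proof.
by apply: (hs_sing0 M rel_vec_hs) => [|n|n]; [lia | apply: L_rel_vec | apply: I_rel_vec].
Qed.

End Schur.

(** * The filtration by the number of factors I(-p) *)

Section Filtration.
Context (K : numFieldType) (V : lmodType K) (L I W : int -> {linear V -> V}).
Context (cL c h hI : K) (v : V) (M : hwmod L I cL c h hI v).
Context (WE : forall n x, W n x = Wop I c n x).
Context (p : nat) (p0 : (0 < p)%N) (c0 : c != 0) (hIE : hI = (1 - p%:R) * c).
Let H := hw_mod M.
Let Hv := hw_vec M.
Local Notation hs := (hs L I v).
Local Notation hW := (hI ^+ 2 - 2 * c * hI).
Local Notation io := (I (- p%:Z)).
Let IV := WIC M WE.
Let LW := LWE M WE.
Let WL := WLE M WE.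

(* [iov j] is [I(-p)^j v]. The letter [p] is excluded from the words because
   [[L p, W (- p)]] and [[W p, L (- p)]] vanish on the vacuum. *)
Definition wmon (mu : seq nat) x := foldr (fun m y => W (- m%:Z) y) x mu.
Definition iov k := iter k io v.
Definition okp (mu : seq nat) := all (fun m => (0 < m)%N && (m != p)) mu.
Definition Agen k x := exists mu j, [/\ okp mu, (j < k)%N & x = wmon mu (iov j)].
Definition Af k := lspan (Agen k).

Lemma Af_subspace k : subspace (Af k). Proof. exact: lspan_subspace. Qed.
#[local] Hint Resolve Af_subspace : core.

Lemma Af_mono k k' x : (k <= k')%N -> Af k x -> Af k' x.
Proof.
move=> kk'; apply: lspan_sub => e [mu [j [okmu jk ->]]].
by exists mu, j; split=> //; apply: leq_trans kk'.
Qed.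

Lemma iov_Af k : Af k.+1 (iov k).
Proof. by apply: lspanW; exists [::], k. Qed.

Lemma iov_hs k : hs (p * k)%N (iov k).
Proof.
elim: k => [|k IH]; first by rewrite muln0; apply: hs_v.
by apply: hs_cast (hsI H Hv _ IH) _; lia.
Qed.

Lemma wmon_I mu n x : wmon mu (I n x) = I n (wmon mu x).
Proof. by elim: mu => //= m mu ->; rewrite IV. Qed.

Lemma wmon0 mu : wmon mu 0 = 0.
Proof. by elim: mu => //= m mu ->; rewrite linear0. Qed.

Lemma iov_I k n : 0 < n -> I n (iov k) = 0.
Proof.
move=> n0; elim: k => [|k IH]; first by rewrite (Iv Hv).
by rewrite /= (IIC H) -/(iov k) IH linear0.
Qed.

Lemma Af_I0 k x n : Af k x -> 0 < n -> I n x = 0.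
Proof.
move=> + n0; apply: (lspan_map (S := [set 0])) => // _ [mu [j [_ _ ->]]] /=.
by rewrite -wmon_I iov_I // wmon0.
Qed.

Lemma Af_W k m x : (0 < m)%N -> m != p -> Af k x -> Af k (W (- m%:Z) x).
Proof.
move=> m0 mp; apply: lspan_map => // _ [mu [j [okmu jk ->]]].
by apply: lspanW; exists (m :: mu), j; rewrite /= m0 mp.
Qed.

Lemma Af_io k x : Af k x -> Af k.+1 (io x).
Proof.
apply: lspan_map => // _ [mu [j [okmu jk ->]]].
by rewrite -wmon_I; apply: lspanW; exists mu, j.+1.
Qed.

Lemma leq_divD a b : (a %/ p + b %/ p <= (a + b) %/ p)%N.
Proof. by rewrite leq_divRL // mulnDl leq_add // leq_trunc_div. Qed.

Lemma hI_coef (m : nat) : hI + c * m%:R = c * (m.+1%:R - p%:R).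
Proof. by rewrite hIE -natr1; ring. Qed.

Lemma Af_I k m x : (0 < m)%N -> Af k x -> Af (k + m %/ p) (I (- m%:Z) x).
Proof.
elim/ltn_ind: m k x => -[//|m] IH k x _ Ax.
have [mp|mp] := eqVneq m.+1 p.
  by rewrite mp divnn p0 addn1; apply: Af_io.
have Sum : Af (k + m.+1 %/ p) (\sum_(i < m) I (- i.+1%:Z) (I (- (m - i)%N%:Z) x)).
  apply: subs_sum => // i _; have im := ltn_ord i.
  apply: Af_mono (IH i.+1 _ _ _ _ (IH (m - i)%N _ k x _ Ax)); try by lia.
  rewrite -addnA leq_add2l; apply: leq_trans (leq_divD _ _) _.
  by rewrite leq_div2r //; lia.
have WA : Af (k + m.+1 %/ p) (W (- m.+1%:Z) x).
  by apply: Af_mono (Af_W _ mp Ax) => //; apply: leq_addr.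
move: WA; rewrite (W_neg M WE) => [|n]; last exact: Af_I0 Ax.
move/(subsDr (Af_subspace _) Sum); apply: subsZV => //.
by rewrite hI_coef !mulf_neq0 ?pnatr_eq0 // subr_eq0 eqr_nat.
Qed.

Lemma Af_I_lt k m x : (0 < m)%N -> (m < p)%N -> Af k x -> Af k (I (- m%:Z) x).
Proof. by move=> m0 mp /(Af_I m0); rewrite divn_small // addn0. Qed.

Lemma Af_I_lt2 k m x : (0 < m)%N -> (m < 2 * p)%N -> Af k x -> Af k.+1 (I (- m%:Z) x).
Proof.
move=> m0 mp /(Af_I m0); apply: Af_mono; rewrite -addn1 leq_add2l.
by rewrite -ltnS ltn_divLR.
Qed.

(** For this [hI] the coefficient of [I(-p)] in W(-p) vanishes; the remaining products have indices
    strictly between [- p] and 0 and add no factor [I(-p)]. *)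
Lemma Af_Wp k x : Af k x -> Af k (W (- p%:Z) x).
Proof.
move=> Ax; have [q pE] : exists q, p = q.+1 by exists p.-1; lia.
have -> : W (- p%:Z) x = \sum_(i < q) I (- i.+1%:Z) (I (- (q - i)%N%:Z) x).
  rewrite {1}pE (W_neg M WE) => [|n]; last exact: Af_I0 Ax.
  by rewrite hI_coef -pE subrr !mulr0 scale0r add0r.
apply: subs_sum => // i _; have iq := ltn_ord i.
by apply: Af_I_lt; [lia | lia | apply: Af_I_lt => //; lia].
Qed.

Lemma Af_Wall k n x : Af k x -> Af k (W n x).
Proof.
move=> Ax; have IA := fun n => @Af_I0 k x n Ax.
have [n0|n0|->] := ltrgt0P n.
  by rewrite (W_pos M WE IA n0); case: (Af_subspace k).
  have -> : n = - `|n|%N%:Z by lia.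
  have [->|np] := eqVneq `|n|%N p; first exact: Af_Wp.
  by apply: Af_W => //; lia.
by rewrite (W_0_vac M WE IA); apply: subsZ.
Qed.

(** In W(-2p) the coefficient of [I(-2p)] is [2 (hI + c (2p - 1)) = 2 c p], and only the middle
    product [I(-p) I(-p)] can gain two factors. *)
Lemma Af_I2p k x : Af k x ->
  Af k.+1 (I (- (2 * p)%N%:Z) x + (2 * c * p%:R)^-1 *: io (io x)).
Proof.
move=> Ax; have [q pE] : exists q, (2 * p = q.+1)%N by exists (2 * p).-1; lia.
have n0 : 2 * c * p%:R != 0 by rewrite !mulf_neq0 ?pnatr_eq0 -?lt0n.
apply: (subsZV (a := 2 * c * p%:R)) => //; rewrite scalerDr scalerA mulfV // scale1r.
have pq : (p.-1 < q)%N by lia.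
have : Af k.+1 (W (- q.+1%:Z) x).
  by apply: Af_mono (leqnSn k) _; apply: Af_Wall.
rewrite (W_neg M WE) => [|n]; last exact: Af_I0 Ax.
have -> : 2 * (hI + c * q%:R) = 2 * c * p%:R by rewrite hI_coef -pE natrM; ring.
rewrite -pE.
rewrite (bigD1 (Ordinal pq)) //= addrA prednK //.
have -> : (q - p.-1)%N = p by lia.
apply: subsDr => //; apply: subs_sum => // i /eqP ip.
have iq := ltn_ord i; have ip' : i != p.-1 :> nat by apply/eqP => E; apply/ip/val_inj.
have [lt|le] := ltnP i.+1 p.
  by apply: Af_I_lt => //; apply: Af_I_lt2 => //; lia.
by apply: Af_I_lt2 => //; [lia | apply: Af_I_lt => //; lia].
Qed.

(** Up to scalars, the bracket of [L n] with a factor [I(-p)] is [I(n - p)] plus a central term,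
    which does not restore the factor it replaces. *)
Lemma L_iov k n : 0 < n -> Af k (L n (iov k)).
Proof.
move=> n0; elim: k => [|k IH]; first by rewrite /= (Lv Hv) //; case: (Af_subspace 0).
rewrite /= -/(iov k) (LIE H) opprK; apply: subsB => //; first apply: subsB => //.
- exact: Af_io.
- apply: subsZ => //; have [lt|gt|->] := ltrgtP n p%:Z.
  + have -> : n - p%:Z = - (p - `|n|)%N%:Z by lia.
    by apply: Af_I_lt; [lia | lia | apply: iov_Af].
  + by rewrite iov_I //; [case: (Af_subspace k.+1) | lia].
  + by rewrite subrr (I0E H); apply: subsZ => //; apply: iov_Af.
- by apply: subsZ => //; apply: iov_Af.
Qed.

Lemma Af_L k n x : 0 < n -> Af k x -> Af k (L n x).
Proof.
move=> n0; apply: lspan_map => // _ [mu [j [okmu jk ->]]].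
elim: mu okmu => /= [_|m mu IH /andP[_ okmu]].
  by apply: Af_mono (L_iov j n0); lia.
have A : Af k (wmon mu (iov j)) by apply: lspanW; exists mu, j.
rewrite LW; apply: subsD => //; first apply: subsD => //.
- by apply: Af_Wall; apply: IH.
- by apply: subsZ => //; apply: Af_Wall.
- exact: subsZ.
Qed.

Lemma wmon_hs mu j d : hs d (iov j) -> hs (d + (sumn mu)%:Z) (wmon mu (iov j)).
Proof.
move=> Hj; elim: mu => /= [|m mu IH]; first by rewrite addr0.
by apply: hs_cast (hsW M WE _ IH) _; lia.
Qed.

Lemma Agen_hs k x : Agen k x -> exists d : nat, hs d x.
Proof.
case=> mu [j [_ _ ->]]; exists (p * j + sumn mu)%N.
by apply: hs_cast (wmon_hs mu (iov_hs j)) _; lia.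
Qed.

Lemma Af_L0 k x : Af k x -> Af k (L 0 x).
Proof.
apply: lspan_map => // e Ae; have [d He] := Agen_hs Ae.
by rewrite (hs_L0 H Hv He); apply: subsZ => //; apply: lspanW.
Qed.

Definition lmon (la : seq nat) x := foldr (fun n y => L (- n%:Z) y) x la.
(** The bound on the letters is strict, as in [Agen]: [G k 0] is zero and [G k 1] is [Af k]. *)
Definition Ggen k l x :=
  exists la a, [/\ okp la, (size la < l)%N, Af k a & x = lmon la a].
Definition G k l := lspan (Ggen k l).

Lemma G_subspace k l : subspace (G k l). Proof. exact: lspan_subspace. Qed.
#[local] Hint Resolve G_subspace : core.

Lemma G_mono k k' l l' x : (k <= k')%N -> (l <= l')%N -> G k l x -> G k' l' x.
Proof.
move=> kk' ll'; apply: lspan_sub => e [la [a [okla sla Aa ->]]].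
by exists la, a; split=> //; [apply: leq_trans ll' | apply: Af_mono Aa].
Qed.

Lemma G_A k l a : Af k a -> G k l.+1 a.
Proof. by move=> Aa; apply: lspanW; exists [::], a. Qed.

Lemma G_Ln k l n x : (0 < n)%N -> n != p -> G k l x -> G k l.+1 (L (- n%:Z) x).
Proof.
move=> n0 np; apply: lspan_map => // _ [la [a [okla sla Aa ->]]].
by apply: lspanW; exists (n :: la), a; rewrite /= n0 np.
Qed.

Lemma G_lmon k la a : okp la -> Af k a -> G k (size la).+1 (lmon la a).
Proof. by move=> okla Aa; apply: lspanW; exists la, a. Qed.

Lemma G_W k l n x : G k l x -> G k l (W n x).
Proof.
apply: lspan_map => // _ [la [a [okla sla Aa ->]]].
apply: (G_mono (leqnn k) sla); clear l sla.
elim: la n okla => /= [n _|m la IH n /andP[/andP[m0 mp] okla]].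
  by apply: G_A; apply: Af_Wall.
rewrite WL; apply: subsD => //; first apply: subsD => //.
- by apply: G_Ln => //; apply: IH.
- by apply: subsZ => //; apply: G_mono (IH _ okla).
- by apply: subsZ => //; apply: G_mono (G_lmon okla Aa).
Qed.

(** A bracket of [W n] with [L(-m)] uses up that letter, and [W n] kills [Af k]; so one letter is
    always lost. *)
Lemma G_Wpos k l n x : 0 < n -> G k l.+1 x -> G k l (W n x).
Proof.
move=> n0; apply: lspan_map => // _ [la [a [okla sla Aa ->]]].
apply: (@G_mono k k (size la)) => //; clear l sla.
elim: la n n0 okla => /= [n n0 _|m la IH n n0 /andP[/andP[m0 mp] okla]].
  rewrite (W_pos M WE) //; last by move=> k0; apply: Af_I0 Aa.
  by case: (G_subspace k 0).
rewrite WL; apply: subsD => //; first apply: subsD => //.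
- by apply: G_Ln => //; apply: IH.
- by apply: subsZ => //; apply: G_W; apply: G_lmon.
- by apply: subsZ => //; apply: G_lmon.
Qed.

Lemma G_W0 k l x : G k l.+1 x -> G k l (W 0 x - hW *: x).
Proof.
pose f : V -> V := fun x => W 0 x - hW *: x.
have fL : linear f.
  by move=> a y z; rewrite /f linearP scalerDr scalerBr !scalerA [a * hW]mulrC opprD addrACA.
rewrite -/(f x) -(mklinE fL); apply: lspan_map => // _ [la [a [okla sla Aa ->]]].
rewrite mklinE /f; apply: (@G_mono k k (size la)) => //; clear l sla x f fL.
elim: la okla => /= [_|m la IH /andP[/andP[m0 mp] okla]].
  rewrite (W_0_vac M WE) ?subrr; first by case: (G_subspace k 0).
  by move=> k0; apply: Af_I0 Aa.
rewrite WL; have -> : (0 == - - m%:Z) = false by lia.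
rewrite !mul0r scale0r addr0 addrAC -linearZZ -linearB; apply: subsD => //.
  by apply: G_Ln => //; apply: IH.
by apply: subsZ => //; apply: G_W; apply: G_lmon.
Qed.

End Filtration.

(** * Elimination of L(-p) and the spanning words *)

Section KeyRelation.
Context (K : numFieldType) (V : lmodType K) (L I W : int -> {linear V -> V}).
Context (cL c h hI : K) (v : V) (M : hwmod L I cL c h hI v).
Context (WE : forall n x, W n x = Wop I c n x).
Context (p : nat) (p0 : (0 < p)%N) (c0 : c != 0) (hIE : hI = (1 - p%:R) * c).
Let H := hw_mod M.
Let Hv := hw_vec M.
Local Notation s := (schur I p0 c0).
Local Notation io := (I (- p%:Z)).
Let LW := LWE M WE.

Local Notation iov := (iov I v p).
Local Notation Af := (Af I W v p).
Local Notation G := (G L I W v p).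
Local Notation lmon := (lmon L).
Local Notation wmon := (wmon W).
#[local] Hint Resolve Af_subspace G_subspace : core.

Let Af0 k : Af k 0. Proof. by case: (Af_subspace I W v p k). Qed.

Lemma schur_Af k (j : int) x : j < p%:Z -> Af k x -> Af k (s j x).
Proof.
move=> + Ax; elim/(schur_ind p0 c0): j => [j j0 _||j j0 IH jp].
- by rewrite (schur_lt0 I p0 c0).
- by rewrite (schur0 I p0 c0).
have jle : j <= `|j|%N by lia.
apply: (subsZV (a := j%:~R * c)) => //; first by rewrite mulf_neq0 // intr_eq0; lia.
rewrite -(newton I p0 c0 _ jle); apply: subs_sum => // i _; have ij := ltn_ord i.
by apply: (Af_I_lt M WE p0 c0 hIE) => //; [lia | apply: IH; lia].
Qed.

Lemma sum_last n q (F : nat -> V) : n = q.+1 ->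
  \sum_(i < n) F i = \sum_(i < q) F i + F q.
Proof. by move=> ->; rewrite big_ord_recr. Qed.

Lemma schur_p_Af k x : Af k x -> Af k (s p x - (p%:R * c)^-1 *: io x).
Proof.
move=> Ax; have pc : p%:R * c != 0 by rewrite mulf_neq0 // pnatr_eq0 -lt0n.
apply: (subsZV (a := p%:R * c)) => //; rewrite scalerBr scalerA mulfV // scale1r.
have [q pE] : exists q, p = q.+1 by exists p.-1; lia.
have pq : p%:Z <= q.+1%:Z by rewrite pE.
have := newton I p0 c0 x pq; rewrite -[(p%:Z)%:~R]/(p%:R) => <-.
rewrite big_ord_recr /= -pE subrr (schur0 I p0 c0) addrK.
apply: subs_sum => // i _; have ij := ltn_ord i.
by apply: (Af_I_lt M WE p0 c0 hIE) => //; [lia | apply: schur_Af => //; lia].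
Qed.

(** By Newton's identity and induction, only [I(-(m + i + 1))] with [i = n] can reach index [p],
    with coefficient [n + 1]; dividing by [(n + 1) c] gives [c^-1]. *)
Lemma schur_comm k (m n : nat) x : (0 < m)%N -> (n.+1 + m <= p)%N -> Af k x ->
  Af k (L (- m%:Z) (s n.+1%:Z x) - s n.+1%:Z (L (- m%:Z) x)
        - (if (n.+1 + m == p)%N then c^-1 *: io x else 0)).
Proof.
move=> m0 + Ax; elim/ltn_ind: n => n IH nmp.
have n0 : n.+1%:R * c != 0 by rewrite mulf_neq0 // pnatr_eq0.
apply: (subsZV (a := n.+1%:R * c)) => //; rewrite !scalerBr -linearZZ.
have nn : n.+1%:Z <= n.+1%:Z by [].
have N y := newton I p0 c0 y nn; rewrite -[(n.+1%:Z)%:~R]/(n.+1%:R) in N.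
rewrite -!N linear_sum -sumrB.
have E (i : nat) : L (- m%:Z) (I (- i.+1%:Z) (s (n.+1%:Z - i.+1%:Z) x))
    - I (- i.+1%:Z) (s (n.+1%:Z - i.+1%:Z) (L (- m%:Z) x)) =
    I (- i.+1%:Z) (L (- m%:Z) (s (n.+1%:Z - i.+1%:Z) x)
                   - s (n.+1%:Z - i.+1%:Z) (L (- m%:Z) x))
    + i.+1%:R *: I (- (m + i.+1)%N%:Z) (s (n.+1%:Z - i.+1%:Z) x).
  rewrite (LIE H); have -> : (- m%:Z == - - i.+1%:Z) = false by lia.
  rewrite !mul0r scale0r subr0 addrAC linearB -scaleNr; congr (_ + _ *: I _ _).
    by rewrite -rmorphN opprK.
  by lia.
rewrite (eq_bigr _ (fun (i : 'I_n.+1) _ => E i)) big_ord_recr /= subrr !(schur0 I p0 c0).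
rewrite subrr linear0 add0r -addrA; apply: subsD => //.
  apply: subs_sum => // i _; have im := ltn_ord i.
  have -> : n.+1%:Z - i.+1%:Z = (n - i.+1).+1%:Z by lia.
  apply: subsD => //.
    apply: (Af_I_lt M WE p0 c0 hIE) => //; first by lia.
    have := IH (n - i.+1)%N; rewrite ifN; last by lia.
    by rewrite subr0; apply; lia.
  apply: subsZ => //; apply: (Af_I_lt M WE p0 c0 hIE) => //; try by lia.
  by apply: schur_Af => //; lia.
case: eqP => [E1|ne].
  have -> : (m + n.+1)%N = p by lia.
  by rewrite scalerA mulfK // subrr.
rewrite scaler0 subr0; apply: subsZ => //.
by apply: (Af_I_lt M WE p0 c0 hIE) => //; lia.
Qed.

Lemma iter_io_linear k : linear (iter k io).
Proof. by elim: k => // k IH a x y /=; rewrite IH linearP. Qed.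

Local Notation J k := (mklin (iter_io_linear k)).

Lemma J0 x : J 0 x = x. Proof. exact: mklinE. Qed.
Lemma JS k x : J k.+1 x = io (J k x). Proof. by rewrite !mklinE. Qed.
Lemma Jv k : J k v = iov k. Proof. exact: mklinE. Qed.

Lemma J_I k n x : J k (I n x) = I n (J k x).
Proof. by elim: k => [|k IH]; rewrite ?J0 // !JS IH (IIC H). Qed.

Lemma J_schur k j x : J k (s j x) = s j (J k x).
Proof. by elim: k => [|k IH]; rewrite ?J0 // !JS IH (schurI M). Qed.

Lemma L_iovS (i : nat) k : (0 < i)%N ->
  L (- i%:Z) (iov k.+1) - J k.+1 (L (- i%:Z) v) =
  io (L (- i%:Z) (iov k) - J k (L (- i%:Z) v)) + p%:R *: I (- (i + p)%N%:Z) (iov k).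
Proof.
move=> i0; rewrite [iov k.+1]/= -/(iov k) (LIE H) JS.
have -> : (- i%:Z == - - p%:Z) = false by lia.
rewrite !mul0r scale0r subr0 addrAC linearB -scaleNr -rmorphN opprK.
by congr (_ + _ *: I _ _); lia.
Qed.

Lemma L_iov_lt (i : nat) k : (0 < i)%N -> (i < p)%N ->
  Af k.+1 (L (- i%:Z) (iov k) - J k (L (- i%:Z) v)).
Proof.
move=> i0 ip; elim: k => [|k IH]; first by rewrite J0 subrr.
rewrite L_iovS //; apply: subsD => //; first exact: (Af_io M WE IH).
apply: subsZ => //; apply: (Af_I_lt2 M WE p0 c0 hIE); try by lia.
exact: iov_Af.
Qed.

(** Each of the [k] brackets of [L(-p)] with [I(-p)] is [p I(-2p)] and contributes [- 1 / (2 c)] by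
    [Af_I2p]. *)
Lemma L_iov_p k : Af k.+1 (L (- p%:Z) (iov k) - J k (L (- p%:Z) v)
  + (k%:R / (2 * c)) *: iov k.+1).
Proof.
have n2 : (2 : K) != 0 by rewrite pnatr_eq0.
have np : (p%:R : K) != 0 by rewrite pnatr_eq0 -lt0n.
elim: k => [|k IH]; first by rewrite J0 subrr mul0r scale0r addr0.
rewrite L_iovS //.
have E : k.+1%:R / (2 * c) = k%:R / (2 * c) + p%:R * (2 * c * p%:R)^-1.
  by rewrite -natr1; field; rewrite ?c0 ?n2 ?np.
rewrite E scalerDl addrACA; apply: subsD => //.
  have := Af_io M WE IH; rewrite linearD linearZZ; exact.
rewrite -scalerA -scalerDr; apply: subsZ => //.
rewrite addnn -mul2n; apply: (Af_I2p M WE p0 c0 hIE); exact: iov_Af.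
Qed.

Definition kap k := (h - h_pr cL p k.+1) / (p%:R * c).

(** Apply I(-p)^k to [rel_vec = 0] and collect the coefficient of [iov k.+1]: [h / (p c)] from
    [i = 0], [- 1 / c] from each of the [p - 1] middle terms, [k / (2 c)] from [i = p], and
    [(p - 1/p) (cL - 2) / (24 c)] from [rel_corr]. Times [p c] this is [h - h_pr cL p k.+1]. *)
Lemma key_relation k : G k.+1 2 (L (- p%:Z) (iov k) + kap k *: iov k.+1).
Proof.
have n2 : (2 : K) != 0 by rewrite pnatr_eq0.
have n24 : (24 : K) != 0 by rewrite pnatr_eq0.
have np : (p%:R : K) != 0 by rewrite pnatr_eq0 -lt0n.
have [q pE] : exists q, p = q.+1 by exists p.-1; lia.
have GA x : Af k.+1 x -> G k.+1 2 x by apply: G_A.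
have /(congr1 (J k)) := rel_vec0 M p0 c0 hIE.
rewrite linear0 linearD linearZZ linear_sum.
set g := (cL - 2) / (24 * c); set Tg := J k _.
have HTg : Af k.+1 (Tg - (p%:R - p%:R^-1) *: iov k.+1).
  rewrite /Tg linearB linear_sum linearZZ J_schur Jv.
  rewrite scalerBl opprB [X in Af _ X](AC (2*2) ((3*2)*(1*4))) /=; apply: subsD => //.
    have -> : p%:R^-1 *: iov k.+1 - c *: s p (iov k) =
        - (c *: (s p (iov k) - (p%:R * c)^-1 *: io (iov k))).
      by rewrite scalerBr opprB scalerA; congr (_ *: _ - _); field; rewrite ?c0 ?np.
    by apply: subsN => //; apply: subsZ => //; apply: schur_p_Af; apply: iov_Af.
  rewrite (sum_last (fun m => J k (m.+1%:R *: I (- m.+1%:Z) (s (p%:Z - m.+1%:Z) v))) pE).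
  rewrite linearZZ -pE subrr (schur0 I p0 c0) J_I Jv -[io (iov k)]/(iov k.+1) addrK.
  apply: subs_sum => // i _; have ij := ltn_ord i.
  rewrite linearZZ J_I J_schur Jv; apply: subsZ => //.
  apply: (Af_I_lt M WE p0 c0 hIE) => //; first by lia.
  by apply: schur_Af; [lia | apply: iov_Af].
have HT0 : Af k.+1 (J k (s p (L 0 v)) - (h / (p%:R * c)) *: iov k.+1).
  rewrite (L0v Hv) (linearZZ (s p)) (linearZZ (J k)) J_schur Jv.
  rewrite -scalerA -scalerBr; apply: subsZ => //; apply: schur_p_Af; exact: iov_Af.
have HTi (i : nat) : (i < q)%N ->
    G k.+1 2 (J k (s (p%:Z - i.+1%:Z) (L (- i.+1%:Z) v)) + c^-1 *: iov k.+1).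
  move=> iq; have -> : p%:Z - i.+1%:Z = (q - i.+1).+1%:Z by lia.
  have ip : (i.+1 < p)%N by lia.
  have mp : ((q - i.+1).+1 + i.+1 <= p)%N by lia.
  have := schur_comm (ltn0Sn i) mp (iov_Af I W v p k).
  rewrite ifT; last by apply/eqP; lia.
  move/GA => C1; have := schur_Af (j := (q - i.+1).+1) _ (L_iov_lt k (ltn0Sn i) ip).
  move/(_ ltac:(lia))/GA; rewrite linearB -J_schur => C2.
  have : G k.+1 2 (L (- i.+1%:Z) (s (q - i.+1).+1%:Z (iov k))).
    apply: G_Ln => //; first by lia.
    by apply: G_A; apply: schur_Af; [lia | apply: iov_Af].
  move/(subsB (G_subspace _ _ _ _ _ _ _))/(_ C1)/(subsB (G_subspace _ _ _ _ _ _ _))/(_ C2).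
  congr (G _ _ _); rewrite !opprB.
  by rewrite [LHS](AC ((1*(1*2))*2) ((1*4)*(3*6)*5*2)) /= !subrr addr0 add0r.
have Hp := L_iov_p k; move/GA: HTg => HTg; move/GA: HT0 => HT0; move/GA: Hp => Hp.
rewrite big_ord_recl.
rewrite (sum_last (fun i => J k (s (p%:Z - (bump 0 i)%:Z) (L (- (bump 0 i)%:Z) v))) pE).
rewrite {3}/bump add1n -pE subrr (schur0 I p0 c0) subr0 => E.
have Bq : bump 0 q = p by rewrite pE.
rewrite Bq in E; set T0 := J k (s p _) in E HT0; set Tp := J k (L (- p%:Z) v) in E Hp.
set Ts := \sum_(i < q) _ in E.
have HTs : G k.+1 2 (Ts + (q%:R * c^-1) *: iov k.+1).
  rewrite -scalerA scaler_nat -[X in _ *+ X]card_ord -sumr_const -big_split.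
  by apply: subs_sum => // i _; apply: HTi.
have sG := G_subspace L I W v p k.+1 2.
(* Subtracts the congruences for the separate terms; comparing the coefficients of [iov k.+1] is
   where the formula for [h_pr] arises. *)
have -> : L (- p%:Z) (iov k) + kap k *: iov k.+1 =
    (L (- p%:Z) (iov k) - Tp + (k%:R / (2 * c)) *: iov k.+1)
    - (T0 - (h / (p%:R * c)) *: iov k.+1) - (Ts + (q%:R * c^-1) *: iov k.+1)
    - g *: (Tg - (p%:R - p%:R^-1) *: iov k.+1).
  rewrite scalerBr scalerA !opprB opprD.
  rewrite [RHS](AC (3*2*2*2) ((1*((3*4)*7*8))*((5*(6*2))*9))) /= -!opprD E subr0.
  rewrite -scaleNr -!scalerDl; congr (_ + _ *: _).
  have pE' : p%:R = q%:R + 1 :> K by rewrite pE natr1.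
  have q1 : q%:R + 1 != 0 :> K by rewrite -pE'.
  rewrite /kap /h_pr /g -natr1 pE'; field; rewrite ?c0 ?n2 ?n24 ?q1.
  done.
by apply: subsB => //; [apply: subsB => //; apply: subsB | apply: subsZ].
Qed.

(** As [L(-p)] is not a letter, this is what [G_L] needs to close the words under every [L n]; with
    [k' = k] the words over [Af k] span a submodule. *)
Definition Lp_closed k k' := forall a, Af k a -> G k' 2 (L (- p%:Z) a).

Lemma Lp_closedP k k' : (k <= k')%N ->
  (forall j, (j < k)%N -> G k' 2 (L (- p%:Z) (iov j))) -> Lp_closed k k'.
Proof.
move=> kk' Hj; apply: lspan_map => // _ [mu [j [okmu jk ->]]].
elim: mu okmu => /= [_|m mu IH /andP[_ okmu]]; first exact: Hj.
have A : Af k' (wmon mu (iov j)) by apply: Af_mono kk' _; apply: lspanW; exists mu, j.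
rewrite LW; apply: subsD => //; first apply: subsD => //.
- by apply: (G_W M WE p0 c0 hIE); apply: IH.
- by apply: subsZ => //; apply: G_A; apply: (Af_Wall M WE p0 c0 hIE).
- by apply: subsZ => //; apply: G_A.
Qed.

Lemma Lp_closedS k : Lp_closed k k.+1.
Proof.
apply: Lp_closedP => // j jk.
have [jk' j2] : (j.+1 <= k.+1)%N /\ (j.+1 < k.+1)%N by lia.
apply: (subsDr (G_subspace _ _ _ _ _ _ _) _ (G_mono jk' (leqnn 2) (key_relation j))).
apply: subsZ => //; apply: G_A; apply: Af_mono j2 _; exact: iov_Af.
Qed.

(** At [j = r] the coefficient [kap r] stops the climb; for [j < r] the vector [iov j.+1] is already
    in [Af r.+1]. *)
Lemma Lp_closed_atyp r : kap r = 0 -> Lp_closed r.+1 r.+1.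
Proof.
move=> k0; apply: Lp_closedP => // j; rewrite ltnS leq_eqVlt => /orP[/eqP->|jr].
  by have := key_relation r; rewrite k0 scale0r addr0.
have [jk' j2] : (j.+1 <= r.+1)%N /\ (j.+1 < r.+1)%N by lia.
apply: (subsDr (G_subspace _ _ _ _ _ _ _) _ (G_mono jk' (leqnn 2) (key_relation j))).
apply: subsZ => //; apply: G_A; apply: Af_mono j2 _; exact: iov_Af.
Qed.

Lemma G_L k k' l n x : (k <= k')%N -> Lp_closed k k' -> G k l x ->
  G k' l.+1 (L n x).
Proof.
move=> kk' cl; apply: lspan_map => // _ [la [a [okla sla Aa ->]]].
apply: (@G_mono _ _ _ _ _ _ _ k' k' (size la).+2) => //; clear l sla.
elim: la n okla => /= [n _|m la IH n /andP[/andP[m0 mp] okla]].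
  have [n0|n0|->] := ltrgt0P n.
  - by apply: G_A; apply: Af_mono kk' _; apply: (Af_L M WE p0 c0 hIE).
  - have -> : n = - `|n|%N%:Z by lia.
    have [->|np] := eqVneq `|n|%N p; first exact: cl.
    by apply: G_Ln => //; [lia | apply: G_A; apply: Af_mono Aa].
  - by apply: G_A; apply: Af_mono kk' _; apply: (Af_L0 M WE).
rewrite (LLE H); apply: subsD => //; first apply: subsD => //.
- by apply: G_Ln => //; apply: IH.
- by apply: subsZ => //; apply: G_mono (IH _ okla).
- by apply: subsZ => //; apply: G_mono (G_lmon L okla Aa) => //; lia.
Qed.

Definition Gall x := exists k l, G k l x.

Lemma Gall_subspace : subspace Gall.
Proof.
split=> [|a x y [k [l Gx]] [k' [l' Gy]]]; first by exists 0%N, 0%N; apply: lspan0.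
exists (maxn k k'), (maxn l l'); apply: subsD => //.
  by apply: subsZ => //; apply: G_mono Gx; rewrite leq_maxl.
by apply: G_mono Gy; rewrite leq_maxr.
Qed.

Lemma Gall_I n x : Gall x -> Gall (I n x).
Proof.
have sG := Gall_subspace.
case=> k [l]; apply: lspan_map => // _ [la [a [okla _ Aa ->]]].
suff [k' [kk' Gk]] : exists k', (k <= k')%N /\ G k' (size la).+1 (I n (lmon la a)).
  by exists k', (size la).+1.
elim: la n okla => /= [n _|m la IH n /andP[/andP[m0 mp] okla]].
  have [n0|n0|->] := ltrgt0P n.
  - by exists k; split=> //; rewrite (Af_I0 M WE Aa) //; apply: lspan0.
  - have [m nE] : exists m : nat, n = - m.+1%:Z by exists `|n|.-1%N; lia.
    exists (k + m.+1 %/ p)%N; split; first exact: leq_addr.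
    by rewrite nE; apply: G_A; apply: (Af_I M WE p0 c0 hIE).
  - by exists k; split=> //; rewrite (I0E H); apply: subsZ => //; apply: G_A.
have [k1 [kk1 G1]] := IH n okla; have [k2 [kk2 G2]] := IH (n - m%:Z) okla.
have -> : I n (L (- m%:Z) (lmon la a)) = L (- m%:Z) (I n (lmon la a))
    + n%:~R *: I (n - m%:Z) (lmon la a)
    + ((- m%:Z == - n)%:R * ((- m%:Z) ^+ 2 + - m%:Z)%:~R * c) *: lmon la a.
  by rewrite (LIE H) addrAC !subrK [_ - m%:Z]addrC subrK.
exists (maxn k1 k2); split; first by rewrite leq_max kk1.
apply: subsD => //; first apply: subsD => //.
- by apply: G_Ln => //; apply: G_mono G1 => //; rewrite leq_maxl.
- by apply: subsZ => //; apply: G_mono G2 => //; rewrite leq_maxr.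
- apply: subsZ => //; apply: G_mono (G_lmon L okla Aa) => //.
  by rewrite leq_max kk1.
Qed.

(** The span contains the vacuum and is stable, provided the number of factors [I(-p)] may grow;
    [hw_gen] concludes. *)
Lemma all_Gall x : Gall x.
Proof.
apply: (hw_gen M); last first.
  by exists 1%N, 1%N; apply: G_A; apply: (iov_Af I W v p 0).
split; [exact: Gall_subspace | | exact: Gall_I].
move=> n y [k [l Gy]]; exists k.+1, l.+1.
by apply: G_L Gy => //; apply: Lp_closedS.
Qed.

End KeyRelation.

(** * Stripping words *)

Section Lowering.
Context (K : numFieldType) (V : lmodType K) (A B : {linear V -> V}) (kappa : K).
Context (F : nat -> set V) (sF : forall n, subspace (F n)).
Context (BF : forall n x, F n x -> F n.-1 (B x)).

#[local] Hint Resolve sF : core.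

Lemma iter_lin N a x y : iter N B (a *: x + y) = a *: iter N B x + iter N B y.
Proof. by elim: N => //= N ->; rewrite linearP. Qed.

Lemma iter_lin0 N : iter N B 0 = 0.
Proof. by elim: N => //= N ->; rewrite linear0. Qed.

Lemma iter_lin_sum N n (f : nat -> V) :
  iter N B (\sum_(i < n) f i) = \sum_(i < n) iter N B (f i).
Proof.
elim: n => [|n IH]; first by rewrite !big_ord0 iter_lin0.
by rewrite !big_ord_recr /= -IH addrC -[f n]scale1r iter_lin !scale1r addrC.
Qed.

(** Modulo the filtration [B] acts on powers of [A] as [kappa] times a derivative, whence the
    falling factorial. *)
Lemma lower_iter n g :
  (forall i, F (n + i).-1%N (B (iter i A g) - (i%:R * kappa) *: iter i.-1 A g)) ->
  forall i j, F (n + i - j)%N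
    (iter j B (iter i A g) - ((i ^_ j)%:R * kappa ^+ j) *: iter (i - j) A g).
Proof.
move=> Hg i; elim=> [|j IH].
  by rewrite /= ffactn0 mul1r expr0 scale1r !subn0 subrr; case: (sF (n + i)%N).
have := BF IH; rewrite -subnS linearB linearZZ => IH'.
set C := (i ^_ j)%:R * kappa ^+ j in IH' *.
have -> : (i ^_ j.+1)%:R * kappa ^+ j.+1 = C * ((i - j)%:R * kappa).
  by rewrite ffactnSr natrM exprSr /C; ring.
have [ji|ij] := leqP j i.
  apply: (subsDr (sF _) _ (y := - (C *: (B (iter (i - j) A g)
      - ((i - j)%:R * kappa) *: iter (i - j).-1 A g)))).
    apply: subsN => //; apply: subsZ => //; have := Hg (i - j)%N.
    by have -> : ((n + (i - j)).-1 = n + i - j.+1)%N by lia.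
  by rewrite scalerBr scalerA opprB [(i - j.+1)%N]subnS subrKA.
(* For [j > i] the falling factorial vanishes, so the truncated exponent [i - j] does no harm. *)
have C0 : C = 0 by rewrite /C ffact_small // mul0r.
by move: IH'; rewrite C0 mul0r !scale0r !subr0.
Qed.

(** Up to lower terms, N applications of [B] kill the powers of [A] below [N] and isolate the
    leading coefficient [g N]. *)
Lemma lower_sum l (g : nat -> V) N : (N <= l)%N ->
  (forall i, (i <= N)%N -> forall j,
    F ((l - i) + j).-1%N (B (iter j A (g i)) - (j%:R * kappa) *: iter j.-1 A (g i))) ->
  F (l - N)%N (iter N B (\sum_(i < N.+1) iter i A (g i)) - (N`!%:R * kappa ^+ N) *: g N).
Proof.
move=> Nl Hg; rewrite (iter_lin_sum _ _ (fun i => iter i A (g i))) big_ord_recr /= -addrA.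
apply: subsD => //.
  apply: subs_sum => // i _; have iN := ltn_ord i.
  have := lower_iter (Hg i (ltnW iN)) i N.
  rewrite ffact_small // mul0r scale0r subr0.
  by have -> : (l - i + i - N = l - N)%N by lia.
have := lower_iter (Hg N (leqnn N)) N N.
rewrite ffactnn subnn.
by have -> : (l - N + N - N = l - N)%N by lia.
Qed.

End Lowering.

Section Strip.
Context (K : numFieldType) (V : lmodType K) (L I W : int -> {linear V -> V}).
Context (cL c h hI : K) (v : V) (M : hwmod L I cL c h hI v).
Context (WE : forall n x, W n x = Wop I c n x).
Context (p : nat) (p0 : (0 < p)%N) (c0 : c != 0) (hIE : hI = (1 - p%:R) * c).
Let H := hw_mod M.
Local Notation cW := (- 24 * c ^+ 2).
Local Notation hW := (hI ^+ 2 - 2 * c * hI).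
Local Notation lmon := (lmon L).
Local Notation okp := (okp p).

(** The scalar by which the bracket of [W m] with [L(-m)] acts where [W 0] acts by [hW], left in the
    unreduced shape produced by [WLE] and [LWE]. *)
Definition kappa (m : nat) : K :=
  (m%:Z - - m%:Z)%:~R * hW + (1 * ((m%:Z ^+ 3 - m%:Z)%:~R / 12) * cW).

Lemma kappa_n0 m : (0 < m)%N -> m != p -> kappa m != 0.
Proof.
move=> m0 mp; have n12 : (12 : K) != 0 by rewrite pnatr_eq0.
have -> : kappa m = 2 * m%:R * c ^+ 2 * (p%:R + m%:R) * (p%:R - m%:R).
  by rewrite /kappa hIE; field.
rewrite !mulf_neq0 ?expf_neq0 ?pnatr_eq0 -?natrD ?pnatr_eq0 -?lt0n ?addn_gt0 ?p0 //.
by rewrite subr_eq0 eqr_nat eq_sym.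
Qed.

(** [D] holds the letter-free coefficients, [E l] the errors with fewer than [l] letters, [X] what
    is known and [Y] what is wanted. The instances, in [strip_sub] and [Tf_Af], compare a submodule
    with [Tf r] and [Tf r] with [Af r]. *)
Context (D : set V) (E X Y : nat -> set V).
Context (sD : subspace D) (sE : forall l, subspace (E l)).
Context (sX : forall l, subspace (X l)) (sY : forall l, subspace (Y l)).
Context (EY : forall l x, E l x -> Y l x) (YX : forall l x, Y l x -> X l x).
Context (E_mono : forall l l' x, (l <= l')%N -> E l x -> E l' x).
Context (E0 : forall x, E 0%N x -> x = 0) (D_E : forall a, D a -> E 1%N a).
Context (E_L : forall l (n : nat) x, (0 < n)%N -> E l x -> E l.+1 (L (- n%:Z) x)).
Context (E_W : forall l n x, 0 < n -> E l.+1 x -> E l (W n x)).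
Context (E_W0 : forall l x, E l.+1 x -> E l (W 0 x - hW *: x)).
Context (D_W : forall n a, 0 < n -> D a -> W n a = 0).
Context (X_W : forall l n x, 0 < n -> X l.+1 x -> X l (W n x)).
Context (Y_L : forall l (n : nat) x, (0 < n)%N -> n != p -> Y l x -> Y l.+1 (L (- n%:Z) x)).
Context (DXY : forall a, D a -> X 0%N a -> Y 0%N a).

Definition Ugen l m x := exists la a,
  [/\ okp la, size la = l, all (fun n => (n <= m)%N) la, D a & x = lmon la a].
Definition U l m := lspan (Ugen l m).

Let sU l m : subspace (U l m). Proof. exact: lspan_subspace. Qed.
#[local] Hint Resolve sU sE sX sY : core.

Lemma U_E l m x : U l m x -> E l.+1 x.
Proof.
apply: lspan_min => // _ [la [a [okla <- _ Da ->]]].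
elim: la okla => /= [_|n la IH /andP[/andP[n0 _] okla]]; first exact: D_E.
by apply: E_L => //; apply: IH.
Qed.

Lemma E_iterL (n : nat) i l x : (0 < n)%N -> E l x ->
  E (l + i)%N (iter i (L (- n%:Z)) x).
Proof.
by move=> n0 Ex; elim: i => [|i IH]; rewrite ?addn0 // addnS; apply: E_L.
Qed.

Lemma W_L_diag (m : nat) y : W m (L (- m%:Z) y) = L (- m%:Z) (W m y)
  + kappa m *: y + (m%:Z - - m%:Z)%:~R *: (W 0 y - hW *: y).
Proof.
rewrite (WLE M WE) opprK eqxx subrr /kappa [X in _ = _ + X + _]scalerDl.
rewrite [X in _ = _ + X]scalerBr scalerA opprK.
by rewrite [RHS](AC ((1*2)*2) ((1*4*3)*(2*5))) /= subrr addr0.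
Qed.

(** All letters are below [n], so the bracket with one of them leaves a positive [W], which removes
    a second letter: hence [l.-1] instead of [l]. *)
Lemma low_word l m (n : nat) g : (m < n)%N -> U l m g -> E l.-1 (W n g).
Proof.
move=> mn; apply: lspan_map => // _ [la [a [okla <- lam Da ->]]].
have n0 : 0 < n%:Z by lia.
elim: la okla lam => [_ _|k la IH /= /andP[/andP[k0 kp] okla] /andP[km lam]] /=.
  apply: (E_mono (leqnn 0)); rewrite (D_W n0 Da); case: (sE 0%N) => //.
have Ey : E (size la).+1 (lmon la a).
  by apply: (U_E (m := m)); apply: lspanW; exists la, a.
rewrite (WLE M WE); have -> : (n%:Z == - - k%:Z) = false by lia.
rewrite !mul0r scale0r addr0; apply: subsD => //.
  case: la okla lam IH Ey => [|j la] okla lam IH Ey.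
    by rewrite (D_W n0 Da) linear0; case: (sE 0%N).
  by apply: E_L => //; apply: IH.
by apply: subsZ => //; apply: E_W => //; lia.
Qed.

(** Each letter [L(-n)] contributes [kappa n]; the rest comes from [W 0 - hW] and from [W n] on [g],
    and both lose enough letters. *)
Lemma low_iterL l m (n : nat) g : (m < n)%N -> U l m g -> forall i,
  E (l + i).-1%N (W n (iter i (L (- n%:Z)) g)
    - (i%:R * kappa n) *: iter i.-1 (L (- n%:Z)) g).
Proof.
move=> mn Ug; have n0 : (0 < n)%N by lia.
elim=> [|i IH].
  by rewrite addn0 mul0r scale0r subr0; apply: low_word Ug.
rewrite addnS /=; set y := iter i _ g in IH *.
have Ey : E (l + i).+1 y by rewrite -addSn; apply: E_iterL => //; apply: U_E Ug.
have S z : (i.+1%:R * kappa n) *: z = (i%:R * kappa n) *: z + kappa n *: z.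
  by rewrite -natr1 mulrDl mul1r scalerDl.
rewrite W_L_diag S opprD.
rewrite [X in E _ X](AC ((1*1*1)*2) (((1*4)*(2*5))*3)) /= subrr addr0.
apply: subsD => //; last by apply: subsZ => //; apply: E_W0.
rewrite {S}/y {y} in IH Ey *; case: i IH Ey => [|i] IH Ey.
  rewrite mul0r scale0r subr0 addn0.
  have := low_word mn Ug; case: (l) => [|l'] /= Ew; last exact: E_L.
  by rewrite (E0 Ew) linear0; case: (sE 0%N).
have := E_L n0 IH; rewrite linearB linearZZ.
by apply: E_mono; lia.
Qed.

Lemma E_comm l (n k : nat) i y : (0 < n)%N -> (0 < k)%N -> E l y ->
  E (l + i)%N (L (- n%:Z) (iter i (L (- k%:Z)) y) - iter i (L (- k%:Z)) (L (- n%:Z) y)).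
Proof.
move=> n0 k0 Ey; elim: i => [|i IH]; first by rewrite subrr; case: (sE (l + 0)%N).
rewrite /= (LLE H) addnS; have -> : (- n%:Z == - - k%:Z) = false by lia.
rewrite !mul0r scale0r addr0 addrAC -linearB; apply: subsD => //; first exact: E_L.
apply: subsZ => //; have -> : - n%:Z - k%:Z = - (n + k)%N%:Z by lia.
by apply: E_L; [lia | apply: E_iterL].
Qed.

(** Collecting the letters [L(-(m+1))] in front costs commutators, which have fewer letters and are
    absorbed by [E l]. *)
Lemma split_word l m u : m.+1 != p -> U l m.+1 u -> exists g : nat -> V,
  (forall i, (i <= l)%N -> U (l - i) m (g i)) /\
  E l (u - \sum_(i < l.+1) iter i (L (- m.+1%:Z)) (g i)).
Proof.
move=> mp; set A := L _.
pose P l u := exists g : nat -> V, (forall i, (i <= l)%N -> U (l - i) m (g i)) /\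
  E l (u - \sum_(i < l.+1) iter i A (g i)).
have sP k : subspace (P k).
  split=> [|a x y [g [Ug Eg]] [g' [Ug' Eg']]].
    exists (fun=> 0); split=> [i _|]; first exact: lspan0.
    rewrite big1 ?subrr => [|i _]; first by case: (sE k).
    exact: iter_lin0.
  exists (fun i => a *: g i + g' i); split=> [i il|].
    by apply: subsD => //; [apply: subsZ => //; apply: Ug | apply: Ug'].
  have -> : \sum_(i < k.+1) iter i A (a *: g i + g' i) =
      a *: \sum_(i < k.+1) iter i A (g i) + \sum_(i < k.+1) iter i A (g' i).
    by rewrite scaler_sumr -big_split; apply: eq_bigr => i _; apply: iter_lin.
  by rewrite opprD addrACA -scalerBr; apply: subsD => //; apply: subsZ.
suff : forall u, U l m.+1 u -> P l u by apply.
apply: lspan_min => // _ [la [a [okla <- lam Da ->]]].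
elim: la okla lam => [_ _|n la IH /= /andP[/andP[n0 np] okla] /andP[nm lam]].
  exists (fun=> a); rewrite big_ord1 subrr; split; last by case: (sE 0%N).
  by case=> // _; apply: lspanW; exists [::], a.
have [g [Ug Eg]] := IH okla lam; set k := size la in Ug Eg *.
have [nE|nm'] := eqVneq n m.+1.
  exists (fun i => if i is j.+1 then g j else 0); split=> [[|i]|] /=.
  - by move=> _; apply: lspan0.
  - by rewrite ltnS => ik; apply: Ug.
  - rewrite nE big_ord_recl /= add0r.
    have := E_L (ltn0Sn m) Eg; rewrite linearB linear_sum; congr (E _ (_ - _)).
have {}nm : (n <= m)%N by rewrite -ltnS ltn_neqAle nm'.
exists (fun i => if (i <= k)%N then L (- n%:Z) (g i) else 0); split=> [i ik|].
  case: leqP => [ik'|_]; last exact: lspan0.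
  rewrite subSn //; move: (g i) (Ug i ik'); apply: lspan_map => // _ [la' [a' [okla' <- lam' Da' ->]]].
  by apply: lspanW; exists (n :: la'), a'; rewrite /= n0 np nm.
rewrite big_ord_recr /= ltnn iter_lin0 linear0 addr0.
have := E_L n0 Eg; rewrite linearB linear_sum => E1.
rewrite -(subrK (\sum_(i < k.+1) L (- n%:Z) (iter i A (g i))) (L (- n%:Z) _)) -addrA.
apply: subsD => //; rewrite -sumrB; apply: subs_sum => // i _.
have ik : (i <= k)%N by rewrite -ltnS.
rewrite ik; have := E_comm i n0 (ltn0Sn m) (U_E (Ug i ik)).
by have -> : ((k - i).+1 + i = k.+1)%N by lia.
Qed.

(* Peels off the letters [L (- m)], largest [m] first: [W m] removes one of
   them at the price of the nonzero factor [kappa m]. *)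
Theorem strip m l u : U l m u -> X l u -> Y l u.
Proof.
elim: m l u => [|m IHm] l u Uu Xu.
  case: l Uu Xu => [|l] Uu Xu.
    apply: DXY => //; apply: lspan_min Uu => // _ [la [a [_ la0 _ Da ->]]].
    by move/size0nil: la0 => ->.
  (* With bound 0 no letter is available, so a span of nonempty words is zero. *)
  suff -> : u = 0 by case: (sY l.+1).
  apply: (lspan_min (S := [set 0])) Uu => // e [la [a [okla sla lam _ _]]]; exfalso.
  by case: la okla sla lam => //= n la /andP[/andP[n0 _] _] _ /andP[n0' _]; lia.
(* The letter [p] does not occur in the words, so the bound drops to [m]. *)
have [mp|mp] := eqVneq m.+1 p.
  apply: IHm => //; apply: lspan_sub Uu => _ [la [a [okla sla lam Da ->]]].
  exists la, a; split=> //; elim: la okla lam {sla} => //= n la IH.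
  move=> /andP[/andP[n0 np] okla] /andP[nm lam]; rewrite IH // andbT.
  lia.
have [g [Ug Eg]] := split_word mp Uu.
set A := L (- m.+1%:Z) in Eg; pose Z N := \sum_(i < N) iter i A (g i).
have YZ : Y l (u - Z l.+1) by apply: EY.
(* The powers of [A] are removed from the top: once [g N] is known to be in [Y], the sum is one term
   shorter. *)
suff HN N : (N <= l.+1)%N -> X l (Z N) -> Y l (Z N).
  have XZ : X l (Z l.+1).
    by rewrite -[Z _](subKr u); apply: subsB => //; apply: YX.
  by rewrite -[u](subrK (Z l.+1)); apply: subsD => //; apply: HN.
elim: N => [|N IHN] Nl XZ; first by rewrite /Z big_ord0; case: (sY l).
have XN : X (l - N)%N (iter N (W m.+1) (Z N.+1)).
  have W1 j : (j <= l)%N -> X (l - j)%N (iter j (W m.+1) (Z N.+1)).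
    elim: j => [|j IHj] jl; first by rewrite subn0.
    by apply: X_W => //; rewrite -subSn // subSS; apply: IHj; lia.
  by apply: W1.
have EB n x : E n x -> E n.-1 (W m.+1 x).
  case: n => [|n] Ex; last exact: E_W.
  by rewrite (E0 Ex) linear0; case: (sE 0%N).
(* [N] applications of [W m.+1] leave a multiple of [g N], whose letters are at most [m], so the
   induction on [m] applies. *)
have := lower_sum sE EB (A := A) (kappa := kappa m.+1) (g := g) (N := N) Nl.
move=> /(_ (fun i iN => low_iterL (ltnSn m) (Ug i (leq_trans iN Nl)))) EN.
have YN : Y (l - N)%N (g N).
  apply: IHm; first exact: Ug.
  apply: (subsZV (a := N`!%:R * kappa m.+1 ^+ N)) => //.
    by rewrite mulf_neq0 ?expf_neq0 ?kappa_n0 // pnatr_eq0 -lt0n fact_gt0.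
  have : X (l - N)%N (iter N (W m.+1) (Z N.+1) - (iter N (W m.+1) (Z N.+1)
      - (N`!%:R * kappa m.+1 ^+ N) *: g N)).
    by apply: subsB => //; apply/YX/EY.
  by rewrite subKr.
have YA j : Y (l - N + j)%N (iter j A (g N)).
  by elim: j => [|j IHj]; rewrite ?addn0 // addnS; apply: Y_L.
have {}YA : Y l (iter N A (g N)) by have := YA N; rewrite subnK.
have ZS : Z N.+1 = Z N + iter N A (g N) by rewrite /Z big_ord_recr.
rewrite ZS; apply: subsD => //; apply: IHN; first exact: ltnW.
by apply: (subsDr (sX l) (YX YA)); rewrite -ZS.
Qed.

End Strip.

(** * Comparison of arbitrary submodules with the filtration *)

Section Core.
Context (K : numFieldType) (V : lmodType K) (L I W : int -> {linear V -> V}).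
Context (cL c h hI : K) (v : V) (M : hwmod L I cL c h hI v).
Context (WE : forall n x, W n x = Wop I c n x).
Context (p : nat) (p0 : (0 < p)%N) (c0 : c != 0) (hIE : hI = (1 - p%:R) * c).
Let H := hw_mod M.
Let Hv := hw_vec M.
Local Notation hs := (hs L I v).
Local Notation cW := (- 24 * c ^+ 2).
Local Notation hW := (hI ^+ 2 - 2 * c * hI).
Local Notation io := (I (- p%:Z)).
Let WV := WWC M WE.
Let LW := LWE M WE.
Local Notation iov := (iov I v p).
Local Notation Af := (Af I W v p).
Local Notation G := (G L I W v p).
Local Notation lmon := (lmon L).
Local Notation wmon := (wmon W).
Local Notation kap := (kap cL c h p).
Local Notation okp := (okp p).
Local Notation wstable := (wstable L W).
#[local] Hint Resolve Af_subspace G_subspace : core.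

(** [Av], [Vf] and [Tf] release one bound each: the number of factors [I(-p)] is free in [Av] and
    [Vf], the number of letters [L] in [Tf]. *)
Definition Av a := exists k, Af k a.
Definition Vf l x := exists k, G k l x.
Definition Tf r x := exists l, G r l x.

Lemma Av_subspace : subspace Av.
Proof.
split=> [|a x y [k Ax] [k' Ay]]; first by exists 0%N; apply: lspan0.
exists (maxn k k'); apply: subsD => //.
  by apply: subsZ => //; apply: Af_mono Ax; rewrite leq_maxl.
by apply: Af_mono Ay; rewrite leq_maxr.
Qed.

Lemma Vf_subspace l : subspace (Vf l).
Proof.
split=> [|a x y [k Ax] [k' Ay]]; first by exists 0%N; apply: lspan0.
exists (maxn k k'); apply: subsD => //.
  by apply: subsZ => //; apply: G_mono Ax; rewrite ?leq_maxl.
by apply: G_mono Ay; rewrite ?leq_maxr.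
Qed.

Lemma Tf_subspace r : subspace (Tf r).
Proof.
split=> [|a x y [k Ax] [k' Ay]]; first by exists 0%N; apply: lspan0.
exists (maxn k k'); apply: subsD => //.
  by apply: subsZ => //; apply: G_mono Ax; rewrite ?leq_maxl.
by apply: G_mono Ay; rewrite ?leq_maxr.
Qed.
#[local] Hint Resolve Av_subspace Vf_subspace Tf_subspace : core.

Lemma G0 k x : G k 0 x -> x = 0.
Proof. by apply: (lspan_min (S := [set 0])) => // e [la [a [_ sla _ _]]]. Qed.

Lemma G1 k x : G k 1 x -> Af k x.
Proof.
apply: lspan_min => // _ [la [a [_ la0 Aa ->]]].
by case: la la0.
Qed.

Lemma Af_0 x : Af 0 x -> x = 0.
Proof. by apply: (lspan_min (S := [set 0])) => // e [mu [j [_ jk _]]]. Qed.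

Lemma Av_I0 a n : Av a -> 0 < n -> I n a = 0.
Proof. by move=> [k Aa]; apply: (Af_I0 M WE Aa). Qed.

Lemma Vf_L l (n : nat) x : Vf l x -> Vf l.+1 (L (- n%:Z) x).
Proof.
move=> [k Gx]; exists k.+1; apply: (G_L M WE p0 c0 hIE _ _ _ Gx) => //.
exact: (Lp_closedS M WE p0 c0 hIE).
Qed.

Lemma leq_sumn mu : all (fun m => (m <= sumn mu)%N) mu.
Proof.
elim: mu => //= n mu IH; rewrite leq_addr /=.
by apply: sub_all IH => m /leq_trans; apply; apply: leq_addl.
Qed.

Lemma G_split k l x : G k l.+1 x -> exists m u e,
  [/\ U L p (Af k) l m u, G k l e & x = u + e].
Proof.
pose P x := exists m u e, [/\ U L p (Af k) l m u, G k l e & x = u + e].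
have U_mono m m' y : (m <= m')%N -> U L p (Af k) l m y -> U L p (Af k) l m' y.
  move=> mm'; apply: lspan_sub => _ [la [a [okla sla lam Aa ->]]].
  exists la, a; split=> //; apply: sub_all lam => n /leq_trans; exact.
have sP : subspace P.
  split=> [|a y z [m [u [e [Uu Ge ->]]]] [m' [u' [e' [Uu' Ge' ->]]]]].
    by exists 0%N, 0, 0; rewrite addr0; split=> //; apply: lspan0.
  exists (maxn m m'), (a *: u + u'), (a *: e + e'); split.
  - apply: subsD; first exact: lspan_subspace.
      apply: subsZ; first exact: lspan_subspace.
      by apply: U_mono Uu; rewrite leq_maxl.
    by apply: U_mono Uu'; rewrite leq_maxr.
  - by apply: subsD => //; apply: subsZ.
  - by rewrite scalerDr addrACA.
apply: (lspan_min (S := P)) => // _ [la [a [okla sla Aa ->]]].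
have [sl|ne] := eqVneq (size la) l.
  exists (sumn la), (lmon la a), 0; rewrite addr0; split=> //; last exact: lspan0.
  apply: lspanW; exists la, a; split=> //.
  exact: leq_sumn.
exists 0%N, 0, (lmon la a); rewrite add0r; split=> //; first exact: lspan0.
by apply: lspanW; exists la, a; split=> //; rewrite ltn_neqAle ne.
Qed.

Lemma U_D (D D' : set V) l m x : (forall a, D a -> D' a) ->
  U L p D l m x -> U L p D' l m x.
Proof.
move=> DD'; apply: lspan_sub => _ [la [a [okla sla lam Da ->]]].
by exists la, a; split=> //; apply: DD'.
Qed.

Section StripSubmodule.
Context (S : set V) (sS : wstable S) (r : nat) (TS : forall x, Tf r x -> S x).

Let sSS : subspace S. Proof. by case: sS. Qed.
#[local] Hint Resolve sSS : core.

(** Induction on the number of letters: stripping puts the top part of an element of [S] in [Tf r]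
    up to shorter words, and the remainder is still in [S] because [Tf r] is contained in [S]. *)
Lemma strip_sub : (forall f, S f -> Av f -> Af r f) -> forall x, S x -> Tf r x.
Proof.
move=> Sf.
pose X l x := exists y z, [/\ S y, Vf l z & x = y + z].
pose Y l x := exists y z, [/\ Tf r y, Vf l z & x = y + z].
have sXY (T : set V) l : subspace T ->
    subspace (fun x => exists y z, [/\ T y, Vf l z & x = y + z]).
  move=> sT; split=> [|a x x' [y [z [Ty Vz ->]]] [y' [z' [Ty' Vz' ->]]]].
    by exists 0, 0; rewrite addr0; split=> //; [case: sT | case: (Vf_subspace l)].
  exists (a *: y + y'), (a *: z + z'); split; last by rewrite scalerDr addrACA.
    by apply: subsD => //; apply: subsZ.
  by apply: subsD => //; apply: subsZ.
have St l m u : U L p Av l m u -> X l u -> Y l u.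
  apply: (strip M WE p0 c0 hIE (E := Vf)) => {l m u}.
  - exact: Av_subspace.
  - exact: Vf_subspace.
  - by move=> l; apply: sXY.
  - by move=> l; apply: sXY.
  - by move=> l x Vx; exists 0, x; rewrite add0r; split=> //; case: (Tf_subspace r).
  - by move=> l x [y [z [Ty Vz ->]]]; exists y, z; split=> //; apply: TS.
  - by move=> l l' x ll' [k Gx]; exists k; apply: G_mono Gx.
  - by move=> x [k /G0].
  - by move=> a [k Aa]; exists k; apply: G_A.
  - by move=> l n x _; apply: Vf_L.
  - by move=> l n x n0 [k Gx]; exists k; apply: (G_Wpos M WE p0 c0 hIE).
  - by move=> l x [k Gx]; exists k; apply: (G_W0 M WE p0 c0 hIE).
  - by move=> n a n0 Aa; apply: (W_pos M WE) => // k; apply: Av_I0.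
  - move=> l n x n0 [y [z [Sy [k Gz] ->]]]; exists (W n y), (W n z).
    rewrite linearD; split=> //; first by case: sS => _ _; apply.
    by exists k; apply: (G_Wpos M WE p0 c0 hIE).
  - move=> l n x n0 np [y [z [[l' Gy] Vz ->]]]; exists (L (- n%:Z) y), (L (- n%:Z) z).
    by rewrite linearD; split=> //; [exists l'.+1; apply: G_Ln | apply: Vf_L].
  - move=> a Aa [y [z [Sy [k /G0->] ay]]]; rewrite addr0 in ay.
    exists a, 0; rewrite addr0; split=> //; last by case: (Vf_subspace 0).
    by exists 1%N; apply: G_A; apply: Sf => //; rewrite ay.
suff VT l x : Vf l x -> S x -> Tf r x.
  by move=> x; have [k [l Gx]] := all_Gall M WE p0 c0 hIE x; apply: (VT l); exists k.
elim: l x => [|l IH] x [k Gx] Sx; first by rewrite (G0 Gx); case: (Tf_subspace r).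
have [m [u [e [Uu Ge xE]]]] := G_split Gx.
have [y [z [Ty Vz uE]]] : Y l u.
  apply: (St l m); first by apply: U_D Uu => a Aa; exists k.
  exists x, (- e); split=> //; last by rewrite xE addrK.
  by exists k; apply: subsN.
have xE' : x = y + (z + e) by rewrite addrA -uE.
rewrite xE'; apply: subsD => //; apply: IH.
  by apply: subsD => //; exists k.
by apply: (subsDl sSS (TS Ty)); rewrite -xE'.
Qed.

End StripSubmodule.

(** Does the work of linear independence: if a letter-free [a] is written with letters over [Af r],
    its top part [a - e] is also a combination of shorter words, and stripping shortens it over
    [Af r] itself. *)
Lemma Tf_Af r a : Lp_closed L I W v p r r -> Tf r a -> Av a -> Af r a.
Proof.
move=> cl [l Ga] Aa; have {Ga} : G r l.+1 a by apply: G_mono Ga.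
elim: l => [|l IH] Ga; first exact: G1.
have V0 : subspace (fun x => x = 0 :> V) by apply: subspace_set0.
have St m u : U L p (Af r) l.+1 m u -> Vf l.+1 u -> G r l.+1 u.
  apply: (strip M WE p0 c0 hIE (E := G r) (X := Vf) (Y := G r)) => {l m u a Aa Ga IH} //.
  - by move=> l x Gx; exists r.
  - by move=> l l' x ll'; apply: G_mono.
  - exact: G0.
  - exact: G_A.
  - by move=> l n x _; apply: (G_L M WE p0 c0 hIE).
  - by move=> l n x n0; apply: (G_Wpos M WE p0 c0 hIE).
  - by move=> l x; apply: (G_W0 M WE p0 c0 hIE).
  - move=> n a n0 Aa; apply: (W_pos M WE) => // k.
    exact: (Af_I0 M WE Aa).
  - by move=> l n x n0 [k Gx]; exists k; apply: (G_Wpos M WE p0 c0 hIE).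
  - by move=> l n x; apply: G_Ln.
  - by move=> a _ [k /G0->]; apply: lspan0.
have [m [u [e [Uu Ge aE]]]] := G_split Ga.
apply: IH; rewrite aE; apply: subsD => //; apply: (St m) => //.
have -> : u = a - e by rewrite aE addrK.
apply: subsB => //; last by exists r.
by case: Aa => k Aa; exists k; apply: G_mono (G_A L 0 Aa).
Qed.

(** The bracket of [L p] with [I(-p)] is the scalar [p hI - (p^2 + p) c = - 2 p^2 c], so [L p] acts
    as a derivative in [I(-p)]. *)
Lemma L_iovE k : L p%:Z (iov k.+1) = (k.+1%:R * (- 2 * p%:R ^+ 2 * c)) *: iov k.
Proof.
have E j : L p%:Z (iov j.+1) = io (L p%:Z (iov j)) + (- 2 * p%:R ^+ 2 * c) *: iov j.
  rewrite /= -/(iov j) (LIE H) opprK eqxx subrr (I0E H) scalerA -addrA -opprD -scalerDl -scaleNr.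
  by congr (_ + _ *: _); rewrite hIE -[true%:R]/(1 : K); ring.
elim: k => [|k IH]; first by rewrite E /= (Lv Hv) ?linear0 ?add0r ?mul1r //; lia.
by rewrite E IH linearZZ /= -/(iov k) -scalerDl -[k.+2%:R]natr1 mulrDl mul1r.
Qed.

Lemma L_iovE_n0 k : k.+1%:R * (- 2 * p%:R ^+ 2 * c) != 0 :> K.
Proof.
by rewrite !mulf_neq0 ?oppr_eq0 ?expf_neq0 ?pnatr_eq0 -?lt0n.
Qed.

(* In level [p * (k + 1)] the words of [Af] carrying [k] factors [I(-p)] have
   [W]-part of level [p]; since [p] is excluded its letters are [< p], hence
   commute with [L p] on the vacuum. *)
Lemma L_p_descent k a : Af k.+1 a -> hs (p * k.+1)%N a -> Af k (L p%:Z a).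
Proof.
have pz : 0 < p%:Z by lia.
move=> Aa Ha; have EH e : Agen I W v p k.+1 e -> exists d' : nat, hs d' e.
  exact: (Agen_hs M WE p0 c0).
have := lspan_hs M EH Aa Ha.
apply: lspan_map => // _ [[mu [j [okmu jk ->]]] He].
have [jk'|jk'] := ltnP j k.
  by apply: (Af_L M WE p0 c0 hIE) => //; apply: lspanW; exists mu, j.
have {jk jk'}jE : j = k by apply/eqP; rewrite eqn_leq jk' -ltnS jk.
rewrite {j}jE in He *.
have [z0|/eqP nz] := eqVneq (wmon mu (iov k)) 0.
  by rewrite z0 linear0; apply: lspan0.
have Hw := wmon_hs M WE p0 c0 mu (iov_hs M p0 c0 k).
have sumE : sumn mu = p.
  apply/eqP/negP => /negP ne; case: nz; apply: (hs_uniq H Hv Hw He); lia.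
have mup : all (fun m => (m < p)%N) mu.
  apply/allP => m mmu; have /andP[_ mp] := allP okmu m mmu.
  by rewrite ltn_neqAle mp -sumE; apply: (allP (leq_sumn mu)).
elim: mu mup {okmu He nz Hw sumE} => /= [_|m mu IH /andP[mp mup]].
  exact: (L_iov M WE p0 c0 hIE).
have Iy n : 0 < n -> I n (wmon mu (iov k)) = 0.
  by move=> n0; rewrite -(wmon_I M WE) (iov_I M) // wmon0.
rewrite LW (W_pos M WE Iy); last by lia.
have -> : (p%:Z == - - m%:Z) = false by lia.
rewrite !mul0r scale0r scaler0 !addr0.
by apply: (Af_Wall M WE p0 c0 hIE); apply: IH.
Qed.

Section StripVacuum.
Context (S : set V) (sS : wstable S).
Let sSS : subspace S. Proof. by case: sS. Qed.
Let SL n x : S x -> S (L n x). Proof. by case: sS => _ + _; apply. Qed.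
Let SW n x : S x -> S (W n x). Proof. by case: sS => _ _; apply. Qed.
#[local] Hint Resolve sSS : core.

(** Pass to the component of degree [p (k + 1)] and apply [L p]: the power drops by one with nonzero
    coefficient, and the correction drops too by [L_p_descent]. *)
Lemma descend k a C : C != 0 -> Af k.+1 a -> S (C *: iov k.+1 + a) ->
  exists C' a', [/\ C' != 0, Af k a' & S (C' *: iov k + a')].
Proof.
move=> C0 Aa Sa.
have He : hs (p * k.+1)%N (C *: iov k.+1).
  by apply: subsZ; [apply: hs_subspace | apply: (iov_hs M p0 c0)].
have [a' [Aa' Ha' Sa']] := hs_component M sSS (SL 0) (Af_subspace _ _ _ _ _)
  (fun x => Af_L0 M WE p0 c0 (k := k.+1) (x := x)) He Aa Sa.
exists (C * (k.+1%:R * (- 2 * p%:R ^+ 2 * c))), (L p%:Z a'); split.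
- by rewrite mulf_neq0 // L_iovE_n0.
- exact: L_p_descent.
- by rewrite -scalerA -L_iovE -linearZZ -linearD; apply: SL.
Qed.

Lemma descend_to r k a C : (r <= k)%N -> C != 0 -> Af k a -> S (C *: iov k + a) ->
  exists C' a', [/\ C' != 0, Af r a' & S (C' *: iov r + a')].
Proof.
elim: k a C => [|k IH] a C.
  by rewrite leqn0 => /eqP-> C0 Aa Sa; exists C, a.
rewrite leq_eqVlt => /orP[/eqP->|rk] C0 Aa Sa; first by exists C, a.
by have [C' [a' [C0' Aa' Sa']]] := descend C0 Aa Sa; apply: IH Sa'.
Qed.

(** The top layer of [Af k.+1] over [Af k], with the letters bounded for the induction. *)
Definition Bgen k m x := exists mu,
  [/\ okp mu, all (fun n => (n <= m)%N) mu & x = wmon mu (iov k)].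
Definition B k m := lspan (Bgen k m).

Let sB k m : subspace (B k m). Proof. exact: lspan_subspace. Qed.
#[local] Hint Resolve sB : core.

Lemma B_Af k m x : B k m x -> Af k.+1 x.
Proof.
by apply: lspan_sub => _ [mu [okmu _ ->]]; exists mu, k.
Qed.

(** The letters being below [n], each bracket is a positive [W], which kills the rest of the word;
    [L n] thus reaches [iov k] and removes a factor there. *)
Lemma low_W k m (n : nat) g : (m < n)%N -> B k m g -> Af k (L n g).
Proof.
move=> mn; have n0 : 0 < n%:Z by lia.
apply: lspan_map => // _ [mu [okmu mum ->]].
elim: mu okmu mum => /= [_ _|j mu IH /andP[_ okmu] /andP[jm mum]].
  exact: (L_iov M WE p0 c0 hIE).
have Iy i : 0 < i -> I i (wmon mu (iov k)) = 0.
  by move=> i0; rewrite -(wmon_I M WE) (iov_I M) // wmon0.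
rewrite LW (W_pos M WE Iy); last by lia.
have -> : (n%:Z == - - j%:Z) = false by lia.
rewrite !mul0r scale0r scaler0 !addr0.
by apply: (Af_Wall M WE p0 c0 hIE); apply: IH.
Qed.

Lemma Af_iterW k i n x : Af k x -> Af k (iter i (W n) x).
Proof. by move=> Ax; elim: i => //= i; apply: (Af_Wall M WE p0 c0 hIE). Qed.

(** Exact, without error term, since the letters [W] commute and [W 0] acts on [Af k] by [hW]. *)
Lemma low_iterW k (m : nat) g : (0 < m)%N -> Af k g -> forall i,
  L m (iter i (W (- m%:Z)) g) - (i%:R * kappa c hI m) *: iter i.-1 (W (- m%:Z)) g
  = iter i (W (- m%:Z)) (L m g).
Proof.
move=> m0 Ag; elim=> [|i IH]; first by rewrite mul0r scale0r subr0.
rewrite /= -IH; set y := iter i _ g.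
have Ay : Af k y by apply: Af_iterW.
rewrite LW; have -> : (m%:Z == - - m%:Z) = true by rewrite opprK eqxx.
rewrite subrr (W_0_vac M WE) => [|n n0]; last exact: (Af_I0 M WE Ay).
have -> : (i.+1%:R * kappa c hI m) *: y = (i%:R * kappa c hI m) *: y + kappa c hI m *: y.
  by rewrite -natr1 mulrDl mul1r scalerDl.
have KE : (m%:Z - - m%:Z)%:~R *: (hW *: y)
    + (true%:R * ((m%:Z ^+ 3 - m%:Z)%:~R / 12) * cW) *: y = kappa c hI m *: y.
  by rewrite scalerA -scalerDl.
rewrite -(addrA (W _ _)) KE opprD [LHS](AC (2*2) ((1*3)*(2*4))) /= subrr addr0.
rewrite (linearB (W _)) (linearZZ (W _)); congr (_ - _).
by case: (i) @y {IH Ay KE} => [|j] y; rewrite ?mul0r ?scale0r.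
Qed.

Lemma split_W k m u : m.+1 != p -> B k m.+1 u -> exists N (g : nat -> V),
  (forall i, B k m (g i)) /\ u = \sum_(i < N) iter i (W (- m.+1%:Z)) (g i).
Proof.
move=> mp; set A := W _.
pose P u := exists N (g : nat -> V),
  (forall i, B k m (g i)) /\ u = \sum_(i < N) iter i A (g i).
have widen N N' (g : nat -> V) : (N <= N')%N -> \sum_(i < N) iter i A (g i) =
    \sum_(i < N') iter i A (if (i < N)%N then g i else 0).
  move=> NN'; rewrite (hsum_mono (fun i => iter i A (g i)) NN').
  by apply: eq_bigr => i _; case: ifP => // _; rewrite iter_lin0.
apply: (lspan_min (S := P)) => [|_ [mu [okmu mum ->]]].
  split=> [|a x y [N [g [Bg ->]]] [N' [g' [Bg' ->]]]].
    by exists 0%N, (fun=> 0); split=> [i|]; [apply: lspan0 | rewrite big_ord0].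
  exists (maxn N N'), (fun i => a *: (if (i < N)%N then g i else 0)
    + (if (i < N')%N then g' i else 0)); split=> [i|].
    apply: subsD => //; first apply: subsZ => //.
      by case: ifP => // _; apply: lspan0.
    by case: ifP => // _; apply: lspan0.
  rewrite (widen _ _ g (leq_maxl N N')) (widen _ _ g' (leq_maxr N N')).
  by rewrite scaler_sumr -big_split; apply: eq_bigr => i _; rewrite iter_lin.
elim: mu okmu mum => [_ _|n mu IH /= /andP[/andP[n0 np] okmu] /andP[nm mum]].
  exists 1%N, (fun=> iov k); rewrite big_ord1; split=> // _.
  by apply: lspanW; exists [::].
have [N [g [Bg ->]]] := IH okmu mum.
have [nE|nm'] := eqVneq n m.+1.
  exists N.+1, (fun i => if i is j.+1 then g j else 0); split=> [[|i]|] //.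
    exact: lspan0.
  by rewrite big_ord_recl /= add0r nE linear_sum.
have {}nm : (n <= m)%N by rewrite -ltnS ltn_neqAle nm'.
exists N, (fun i => W (- n%:Z) (g i)); split=> [i|].
  apply: lspan_map (Bg i) => // _ [mu' [okmu' mum' ->]].
  by apply: lspanW; exists (n :: mu'); rewrite /= n0 np nm.
rewrite linear_sum; apply: eq_bigr => i _.
by move: (g i) => y; elim: (i : nat) => //= j <-; rewrite WV.
Qed.

(** The descent of [strip] with [L] and [W] exchanged, modulo [Af k]. Once the letters are gone a
    multiple of [iov k] is left, and the hypothesis on [S] makes it zero. *)
Lemma strip_W k : ~ (exists C a, [/\ C != 0, Af k a & S (C *: iov k + a)]) ->
  forall m u, B k m u -> (exists2 a, Af k a & S (u + a)) -> Af k u.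
Proof.
move=> NS; elim=> [|m IHm] u Bu [a Aa Sua].
  have [C uE] : exists C, u = C *: iov k.
    apply: (lspan_min (S := fun u => exists C, u = C *: iov k)) Bu.
      split=> [|b x y [C ->] [C' ->]]; first by exists 0; rewrite scale0r.
      by exists (b * C + C'); rewrite scalerDl scalerA.
    move=> _ [[|n mu] [okmu mum ->]]; first by exists 1; rewrite scale1r.
    by move: okmu mum => /= /andP[/andP[n0 _] _] /andP[n0' _]; lia.
  have [C0|C0] := eqVneq C 0; first by rewrite uE C0 scale0r; apply: lspan0.
  by case: NS; exists C, a; rewrite -uE.
have [mp|mp] := eqVneq m.+1 p.
  apply: IHm; last by exists a.
  apply: lspan_sub Bu => _ [mu [okmu mum ->]]; exists mu; split=> //.
  elim: mu okmu mum => //= n mu IH /andP[/andP[n0 np] okmu] /andP[nm mum].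
  by rewrite IH // andbT; lia.
have [N [g [Bg uE]]] := split_W mp Bu; rewrite {Bu}uE in Sua *.
elim: N a Aa Sua => [|N IHN] a Aa Sua; first by rewrite big_ord0; apply: lspan0.
set A := W (- m.+1%:Z) in Sua IHN *; pose Z n := \sum_(i < n) iter i A (g i).
have sF (n : nat) : subspace (Af k) by [].
have BF (n : nat) x : Af k x -> Af k (L m.+1%:Z x) by apply: (Af_L M WE p0 c0 hIE).
have Hg i : (i <= N)%N -> forall j, Af k (L m.+1%:Z (iter j A (g i))
    - (j%:R * kappa c hI m.+1) *: iter j.-1 A (g i)).
  move=> iN j; rewrite (low_iterW (ltn0Sn m) (B_Af (Bg i))).
  by apply: Af_iterW; apply: low_W (Bg i).
have EN := lower_sum (F := fun=> Af k) sF BF (leqnn N) Hg.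
set C := _ * _ in EN.
have C0 : C != 0.
  by rewrite mulf_neq0 ?expf_neq0 ?(kappa_n0 p0 c0 hIE) // pnatr_eq0 -lt0n fact_gt0.
have SL' n x : S x -> S (iter n (L m.+1%:Z) x) by move=> Sx; elim: n => //= n; apply: SL.
have AL' n x : Af k x -> Af k (iter n (L m.+1%:Z) x).
  by move=> Ax; elim: n => //= n; apply: BF.
have Ag : Af k (g N).
  (* Applying [L m.+1] to the element of [S] [N] times and dividing by [C] exhibits [g N], up to
     [Af k], in [S]. *)
  apply: IHm (Bg N) _; exists (C^-1 *: (iter N (L m.+1%:Z) (Z N.+1) - C *: g N
      + iter N (L m.+1%:Z) a)).
    by apply: subsZ => //; apply: subsD => //; apply: AL'.
  have := SL' N _ Sua; rewrite -[_ + a]/(Z N.+1 + a).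
  rewrite -[Z N.+1]scale1r iter_lin !scale1r => Sit.
  rewrite -{1}[g N](scalerK C0) -scalerDr; apply: subsZ => //.
  by rewrite addrA [C *: _ + _]addrC subrK.
have AA : Af k (iter N A (g N)) by apply: Af_iterW.
have ZS : \sum_(i < N.+1) iter i A (g i) = Z N + iter N A (g N) by rewrite /Z big_ord_recr.
rewrite ZS in Sua *; apply: subsD => //; apply: (IHN (iter N A (g N) + a)).
  exact: subsD.
by rewrite addrA.
Qed.

(** For the least [k] with [f] in [Af k.+1], stripping the top layer exposes [C *: iov k + a] in
    [S], and [descend_to] lowers [k] to [r]. *)
Lemma strip_Av r f : (forall a, Af r a -> S a) -> S f -> Av f -> ~ Af r f ->
  S (iov r).
Proof.
move=> AS Sf [k0 Af0] NAf.
have exk : exists k, `[< Af k f >] by exists k0; apply/asboolP.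
case: (ex_minnP exk) => -[|k] /asboolP Ak kmin.
  by case: NAf; apply: Af_mono Ak.
have NAk : ~ Af k f by move/asboolP/kmin; rewrite ltnn.
have rk : (r <= k)%N.
  by rewrite leqNgt; apply/negP => kr; apply: NAf; apply: Af_mono Ak.
have [m [u [a [Bu Aa fE]]]] : exists m u a, [/\ B k m u, Af k a & f = u + a].
  have BM m m' y : (m <= m')%N -> B k m y -> B k m' y.
    move=> mm'; apply: lspan_sub => _ [mu [okmu mum ->]]; exists mu; split=> //.
    by apply: sub_all mum => n /leq_trans; apply.
  apply: (lspan_min (S := fun f => exists m u a, [/\ B k m u, Af k a & f = u + a])) Ak.
    split=> [|b y z [m [u [a [Bu Aa ->]]]] [m' [u' [a' [Bu' Aa' ->]]]]].
      by exists 0%N, 0, 0; rewrite addr0; split=> //; apply: lspan0.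
    exists (maxn m m'), (b *: u + u'), (b *: a + a'); split.
    - apply: subsD => //; last by apply: BM Bu'; rewrite leq_maxr.
      by apply: subsZ => //; apply: BM Bu; rewrite leq_maxl.
    - by apply: subsD => //; apply: subsZ.
    - by rewrite scalerDr addrACA.
  move=> _ [mu [j [okmu jk ->]]]; rewrite ltnS leq_eqVlt in jk.
  case/orP: jk => [/eqP->|jk].
    exists (sumn mu), (wmon mu (iov k)), 0; rewrite addr0; split=> //; last exact: lspan0.
    by apply: lspanW; exists mu; split=> //; apply: leq_sumn.
  exists 0%N, 0, (wmon mu (iov j)); rewrite add0r; split=> //; first exact: lspan0.
  by apply: lspanW; exists mu, j.
have [C [a' [C0 Aa' Sa']]] : exists C a, [/\ C != 0, Af k a & S (C *: iov k + a)].
  apply: contrapT => NS; case: NAk; rewrite fE; apply: subsD => //.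
  by apply: (strip_W NS Bu); exists a; rewrite -?fE.
have [C' [a2 [C0' Aa2 Sa2]]] := descend_to rk C0 Aa' Sa'.
by apply: (subsZV sSS C0'); apply: (subsDr sSS (AS _ Aa2)).
Qed.

(** [key_relation] expresses [kap k' *: iov k'.+1] through [L(-p)] on [iov k'] and words over
    [Af k'.+1], all of which are already in [S]. *)
Lemma key_S k k' : (k <= k')%N -> (forall j, (k <= j)%N -> (j < k')%N -> kap j != 0) ->
  (forall a, Af k.+1 a -> S a) -> forall a, Af k'.+1 a -> S a.
Proof.
elim: k' => [|k' IH].
  by rewrite leqn0 => /eqP->.
rewrite leq_eqVlt => /orP[/eqP->//|kk'] kn0 AS.
have {}IH := IH kk' (fun j kj jk => kn0 j kj (leqW jk)) AS.
have Si : S (iov k'.+1).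
  apply: (subsZV sSS (kn0 k' kk' (ltnSn k'))).
  have : S (L (- p%:Z) (iov k') + kap k' *: iov k'.+1).
    apply: lspan_min (key_relation M WE p0 c0 hIE k') => // _ [la [a [okla _ Aa ->]]].
    by elim: la {okla} => [|n la IHla]; [apply: IH | apply: SL].
  by apply: subsDl => //; apply: SL; apply: IH; apply: iov_Af.
apply: lspan_min => // _ [mu [j [okmu jk ->]]].
elim: mu okmu => [_|n mu IHmu /andP[_ okmu]]; last by apply: SW; apply: IHmu.
rewrite ltnS leq_eqVlt in jk; case/orP: jk => [/eqP->//|jk].
by apply: IH; apply: Af_mono jk _; apply: iov_Af.
Qed.

Lemma all_S : (forall k a, Af k a -> S a) -> forall x, S x.
Proof.
move=> AS x; have [k [l]] := all_Gall M WE p0 c0 hIE x.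
apply: lspan_min => // _ [la [a [okla _ Aa ->]]].
by elim: la {okla} => [|n la IHla]; [apply: AS Aa | apply: SL].
Qed.

Lemma Af1_S : S v -> forall a, Af 1 a -> S a.
Proof.
move=> Sv; apply: lspan_min => // _ [mu [j [_ j0 ->]]].
have -> : j = 0%N by lia.
by elim: mu => //= n mu; apply: SW.
Qed.

End StripVacuum.
End Core.

Definition w_irr (K : numFieldType) (V : lmodType K) (L W : int -> {linear V -> V}) :=
  forall S : set V, wstable L W S -> (forall x, S x -> x = 0) \/ forall x, S x.

Definition w_chain (K : numFieldType) (V : lmodType K) (L W : int -> {linear V -> V}) :=
  exists N : set V, [/\ wstable L W N, exists2 x, N x & x != 0, exists x, ~ N x &
    forall S : set V, wstable L W S ->
      [\/ forall x, S x -> x = 0, forall x, S x <-> N x | forall x, S x]].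

(** * The lattice of submodules for hI = (1 - p) c *)

Section CoreTheorem.
Context (K : numFieldType) (V : lmodType K) (L I W : int -> {linear V -> V}).
Context (cL c h hI : K) (v : V) (M : hwmod L I cL c h hI v).
Context (WE : forall n x, W n x = Wop I c n x).
Context (p : nat) (p0 : (0 < p)%N) (c0 : c != 0) (hIE : hI = (1 - p%:R) * c).
Local Notation wstable := (wstable L W).

Lemma vac_in (S : set V) : wstable S -> ~ (forall x, S x -> x = 0) -> S v.
Proof.
move=> sS NS; have [x Sx x0] : exists2 x, S x & x != 0.
  apply: contrapT => NE; apply: NS => x Sx; apply/eqP; apply: contrapT => /negP x0.
  by apply: NE; exists x.
apply: (wstable_vac M WE _ sS Sx x0) => n n0.
have -> : hI - c * (n%:R + 1) = - (c * (p + n)%:R) by rewrite hIE natrD; ring.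
by rewrite oppr_eq0 mulf_neq0 // pnatr_eq0 -lt0n addn_gt0 p0.
Qed.

Lemma kap_n0 j : h != h_pr cL p j.+1 -> kap cL c h p j != 0.
Proof.
move=> hj; rewrite mulf_neq0 ?subr_eq0 // invr_eq0 mulf_neq0 // pnatr_eq0 -lt0n //.
Qed.

Theorem core_irr : (forall j, h != h_pr cL p j.+1) -> w_irr L W.
Proof.
move=> hn S sS; case: (pselect (forall x, S x -> x = 0)); first by left.
move=> NS; right; have Sv := vac_in sS NS.
apply: (all_S M WE p0 c0 hIE sS) => k a Aa.
apply: (key_S M WE p0 c0 hIE sS (k := 0) (k' := k) _ _ (Af1_S p0 c0 sS Sv)) => //.
  by move=> j _ _; apply: kap_n0.
by apply: Af_mono Aa.
Qed.

Theorem core_chain r : h = h_pr cL p r.+1 -> w_chain L W.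
Proof.
move=> hr.
have kr : kap cL c h p r = 0 by rewrite /kap hr subrr mul0r.
(* [h_pr] is affine in its last argument with slope [- p / 2], so [kap] vanishes at [r] only. *)
have kn0 j : j != r -> kap cL c h p j != 0.
  move=> jr; apply: kap_n0; rewrite hr /h_pr -subr_eq0.
  have n2 : (2 : K) != 0 by rewrite pnatr_eq0.
  rewrite (_ : _ - _ = p%:R * (j%:R - r%:R) / 2).
    by rewrite !mulf_neq0 ?invr_eq0 ?pnatr_eq0 -?lt0n // subr_eq0 eqr_nat.
  by rewrite -!natr1; field.
have cl : Lp_closed L I W v p r.+1 r.+1 by apply: (Lp_closed_atyp M WE p0 c0 hIE).
pose N := Tf L I W v p r.+1.
have sN : wstable N.
  split; first exact: Tf_subspace.
    by move=> n x [l Gx]; exists l.+1; apply: (G_L M WE p0 c0 hIE _ _ cl Gx).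
  by move=> n x [l Gx]; exists l; apply: (G_W M WE p0 c0 hIE).
have Ni : ~ N (iov I v p r.+1).
  move=> Ni; have iAv : Av I W v p (iov I v p r.+1).
    by exists r.+2; apply: iov_Af.
  have Ai := Tf_Af M WE p0 c0 hIE cl Ni iAv.
  have s0 : wstable [set 0].
    by split=> [|n x ->|n x ->]; rewrite ?linear0 //; apply: subspace_set0.
  (* Read [iov r.+1 - iov r.+1 = 0] as an element of the zero submodule with leading coefficient 1:
     descending to power 0 gives [C *: v = 0] with [C != 0]. *)
  have := descend_to M WE p0 c0 hIE s0 (a := - iov I v p r.+1) (leq0n r.+1) (oner_neq0 K).
  case; first by apply: subsN => //; apply: Af_subspace.
    by rewrite scale1r subrr.
  move=> C [a [C0 /Af_0-> /=]]; rewrite addr0 => /eqP; rewrite scaler_eq0.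
  by rewrite (negPf C0) (negPf (hw_n0 M)).
have NS (S : set V) : wstable S -> S v -> forall x, N x -> S x.
  move=> sS Sv x [l]; apply: lspan_min => [|_ [la [a [okla _ Aa ->]]]]; first by case: sS.
  have SA : forall a, Af I W v p r.+1 a -> S a.
    apply: (key_S M WE p0 c0 hIE sS (k := 0) (k' := r) _ _ (Af1_S p0 c0 sS Sv)) => // j _ jr.
    by apply: kn0; rewrite neq_ltn jr.
  by elim: la {okla} => [|n la IH]; [apply: SA | case: sS => _ SL _; apply: SL].
exists N; split=> //.
- exists v; last exact: hw_n0 M.
  exists 1%N; apply: G_A; apply: Af_mono (iov_Af I W v p 0); lia.
- by exists (iov I v p r.+1).
move=> S sS; case: (pselect (forall x, S x -> x = 0)); first by constructor 1.
move=> /(vac_in sS) Sv; have {}NS := NS S sS Sv.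
case: (pselect (forall x, S x -> N x)) => [SN|NSN].
  by constructor 2 => x; split; [apply: SN | apply: NS].
constructor 3.
have SA1 : forall a, Af I W v p r.+1 a -> S a.
  by move=> a Aa; apply: NS; exists 1%N; apply: G_A.
(* Otherwise every letter-free element of [S] would lie in [Af r.+1], and [strip_sub] would put [S]
   inside [N]. *)
have Si : S (iov I v p r.+1).
  apply: contrapT => NSi; apply: NSN.
  apply: (strip_sub M WE p0 c0 hIE sS NS) => f Sf Avf; apply: contrapT => NAf.
  exact: NSi (strip_Av M WE p0 c0 hIE sS SA1 Sf Avf NAf).
have SA2 : forall a, Af I W v p r.+2 a -> S a.
  have sSS : subspace S by case: sS.
  apply: lspan_min => // _ [mu [j [okmu jk ->]]].
  elim: mu okmu => [_|n mu IH /andP[_ okmu]]; last first.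
    by case: sS => _ _ SW; apply: SW; apply: IH.
  rewrite ltnS leq_eqVlt in jk; case/orP: jk => [/eqP->//|jk].
  by apply: SA1; apply: Af_mono jk _; apply: iov_Af.
(* Above [r] no [kap] vanishes, so the climb resumes from [r.+1] and reaches everything. *)
apply: (all_S M WE p0 c0 hIE sS) => k a Aa.
apply: (key_S M WE p0 c0 hIE sS (k := r.+1) (k' := maxn k r.+1) _ _ SA2).
- exact: leq_maxr.
- by move=> j rj _; apply: kn0; rewrite neq_ltn rj orbT.
- by apply: Af_mono Aa; rewrite leqW // leq_maxl.
Qed.

End CoreTheorem.

(** * Quotients and duality *)

Section SubmoduleTypes.
Context (K : fieldType) (U : lmodType K) (S : set U) (sS : subspace S).

(** The proof is an argument so that the closure instance can be found from the predicate alone. *)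
Definition spred of subspace S : {pred U} := fun x => `[< S x >].

Lemma spred_closed : subsemimod_closed (spred sS).
Proof.
split; first by split=> [|x y]; rewrite !unfold_in /spred;
  [apply/asboolP; case: sS | move=> /asboolP Sx /asboolP Sy; apply/asboolP; apply: subsD].
by move=> a x; rewrite !unfold_in => /asboolP Sx; apply/asboolP; apply: subsZ.
Qed.

HB.instance Definition _ := GRing.isSubmodClosed.Build K U (spred sS) spred_closed.

Record sub_type := SubType { sub_val :> U; _ : sub_val \in spred sS }.
HB.instance Definition _ := [isSub for sub_val].
HB.instance Definition _ := [Choice of sub_type by <:].
HB.instance Definition _ := [SubChoice_isSubLmodule of sub_type by <:].

Lemma sub_lmod : exists (V1 : lmodType K) (i : {linear V1 -> U}),
  injective i /\ forall x, S x <-> exists y, i y = x.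
Proof.
exists sub_type, (val : {linear sub_type -> U}); split; first exact: val_inj.
move=> x; split=> [Sx|[y <-]].
  have xS : x \in spred sS by rewrite unfold_in; apply/asboolP.
  by exists (SubType xS).
by have := valP y; rewrite unfold_in => /asboolP.
Qed.

Local Open Scope quotient_scope.
Local Notation quo := (Quotient.quot (spred sS)).

Lemma pi_eq (x y : U) : (\pi_quo x = \pi_quo y) <-> S (x - y).
Proof.
split=> [/eqP|Sxy]; last first.
  by apply/eqP; rewrite -Quotient.idealrBE unfold_in; apply/asboolP.
by rewrite -Quotient.idealrBE unfold_in => /asboolP.
Qed.

Lemma S_repr (x : U) : S (repr (\pi_quo x) - x).
Proof. by apply/pi_eq; rewrite reprK. Qed.

Definition quo_scale (a : K) (x : quo) : quo := \pi_quo (a *: repr x).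

Lemma pi_scale a x : quo_scale a (\pi_quo x) = \pi_quo (a *: x).
Proof. by apply/pi_eq; rewrite -scalerBr; apply: subsZ => //; apply: S_repr. Qed.

Lemma piD (x y : U) : \pi_quo (x + y) = \pi_quo x + \pi_quo y.
Proof. exact: Quotient.pi_add. Qed.

Lemma pi_surj (x : quo) : exists y, x = \pi_quo y.
Proof. by exists (repr x); rewrite reprK. Qed.

Lemma quo_scaleA a b (x : quo) : quo_scale a (quo_scale b x) = quo_scale (a * b) x.
Proof. by have [y ->] := pi_surj x; rewrite !pi_scale scalerA. Qed.

Lemma quo_scale1 (x : quo) : quo_scale 1 x = x.
Proof. by have [y ->] := pi_surj x; rewrite pi_scale scale1r. Qed.

Lemma quo_scaleDr : right_distributive quo_scale +%R.
Proof.
move=> a x y; have [x' ->] := pi_surj x; have [y' ->] := pi_surj y.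
by rewrite !pi_scale -!piD pi_scale scalerDr.
Qed.

Lemma quo_scaleDl (x : quo) : {morph quo_scale^~ x : a b / a + b}.
Proof.
by move=> a b; have [y ->] := pi_surj x; rewrite !pi_scale -piD scalerDl.
Qed.

HB.instance Definition _ := GRing.Zmodule_isLmodule.Build K quo
  quo_scaleA quo_scale1 quo_scaleDr quo_scaleDl.

Lemma quot_lmod : exists (V2 : lmodType K) (q : {linear U -> V2}),
  (forall y, exists x, q x = y) /\ forall x, q x = 0 <-> S x.
Proof.
have qL : linear (\pi_quo : U -> quo).
  by move=> a x y; rewrite piD -[_ *: \pi_quo x]/(quo_scale a _) pi_scale.
pose q : {linear U -> quo} := HB.pack (\pi_quo : U -> quo)
  (GRing.isLinear.Build K U quo *:%R (\pi_quo : U -> quo) qL).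
exists quo, q; split=> [y|x]; first by exists (repr y); rewrite /= reprK.
have q0 : \pi_quo (0 : U) = 0 by apply: (addrI (\pi_quo (0 : U))); rewrite -piD !addr0.
by rewrite -[q x]/(\pi_quo x) -[X in S X]subr0 -q0; apply: pi_eq.
Qed.

End SubmoduleTypes.

(** * Separation by functionals on the finitely generated degrees *)

Section FiniteLevels.
Context (K : numFieldType) (V : lmodType K) (L I : int -> {linear V -> V}) (v : V).
Local Notation hs := (hs L I v).

Lemma hs_finite (d : nat) : exists e : seq V, (forall x, x \in e -> hs d x) /\
  forall x, hs d x -> lspan (fun y => y \in e) x.
Proof.
elim/ltn_ind: d => d IH.
have /cid[E HE] : exists E : nat -> seq V, forall d', (d' < d)%N ->
    (forall x, x \in E d' -> hs d' x) /\
    forall x, hs d' x -> lspan (fun y => y \in E d') x.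
  have /choice[E HE] : forall d', exists e : seq V, (d' < d)%N ->
      (forall x, x \in e -> hs d' x) /\ forall x, hs d' x -> lspan (fun y => y \in e) x.
    by move=> d'; case: (ltnP d' d) => [/IH[e He]|_]; [exists e | exists [::]].
  by exists E.
pose ops d' x := [:: L (- (d - d')%N%:Z) x; I (- (d - d')%N%:Z) x].
pose e := nseq (d == 0%N) v ++ flatten [seq flatten [seq ops d' x | x <- E d'] | d' <- iota 0 d].
have eP d' x y : (d' < d)%N -> x \in E d' -> y \in ops d' x -> y \in e.
  move=> dd Ex yx; rewrite mem_cat; apply/orP; right; apply/flattenP.
  exists (flatten [seq ops d' x | x <- E d']); first by apply/map_f; rewrite mem_iota.
  by apply/flattenP; exists (ops d' x) => //; apply/map_f.
exists e; split=> [x|].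
  rewrite mem_cat => /orP[|/flattenP[_ /mapP[d' + ->] /flattenP[_ /mapP[y Ey ->]]]].
    by case: eqP => // ->; rewrite inE => /eqP->; apply: hs_v.
  rewrite mem_iota add0n => /= dd; have Hy := (HE d' dd).1 y Ey.
  by rewrite !inE => /orP[] /eqP->; [apply: hs_cast (hs_L _ Hy) _ | apply: hs_cast (hs_I _ Hy) _]; lia.
suff gen d0 y : hs d0 y -> d0 = d -> lspan (fun y => y \in e) y by move=> x /gen; apply.
elim=> [E0|{}d0 _|{}d0 a z z' _ IHy _ IHz dE|{}d0 k z k0 Hz _ dE|{}d0 k z k0 Hz _ dE].
- apply: lspanW; rewrite /e mem_cat; apply/orP; left.
  by rewrite (_ : d == 0%N) ?mem_head //; apply/eqP; lia.
- exact: lspan0.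
- by case: (lspan_subspace (fun y => y \in e)) => _; apply; [apply: IHy | apply: IHz].
- case: d0 dE Hz => [d0|d0] dE Hz; last first.
    by rewrite (hs_lt0 Hz) // linear0; apply: lspan0.
  have dd : (d0 < d)%N by lia.
  apply: lspan_map ((HE d0 dd).2 z Hz) => // w Ew; apply: lspanW; apply: (eP d0 w) => //.
  by rewrite (_ : k = (d - d0)%N%:Z) ?mem_head //; lia.
- case: d0 dE Hz => [d0|d0] dE Hz; last first.
    by rewrite (hs_lt0 Hz) // linear0; apply: lspan0.
  have dd : (d0 < d)%N by lia.
  apply: lspan_map ((HE d0 dd).2 z Hz) => // w Ew; apply: lspanW; apply: (eP d0 w) => //.
  by rewrite (_ : k = (d - d0)%N%:Z) ?inE ?eqxx ?orbT //; lia.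
Qed.

End FiniteLevels.

Section Separation.
Context (K : numFieldType) (V1 V2 : lmodType K) (b : V1 -> {linear V2 -> K^o}).
Context (bL : forall y, linear (b^~ y : V1 -> K^o)).

(** Gaussian elimination along [e]: a pivot [q] in [P] with [b q a != 0] clears the value at [a]
    from [P] and from [f]. *)
Lemma finite_sep (e : seq V2) (P : set V1) (f : V1) : subspace P ->
  (exists y, [/\ lspan (fun z => z \in e) y, forall p, P p -> b p y = 0 & b f y != 0]) \/
  exists2 p, P p & forall y, y \in e -> b p y = b f y.
Proof.
have bB f1 f2 y : b (f1 - f2) y = b f1 y - b f2 y.
  by rewrite addrC -scaleN1r bL addrC /GRing.scale /= mulN1r.
have bZ a f1 y : b (a *: f1) y = a * b f1 y.
  have b0 : b 0 y = 0 by have := bB 0 0 y; rewrite !subrr.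
  by rewrite -[a *: f1]addr0 bL b0 addr0.
have wid a (e' : seq V2) y : lspan (fun z => z \in e') y -> lspan (fun z => z \in a :: e') y.
  by apply: lspan_sub => z ze; rewrite inE ze orbT.
elim: e P f => [|a e IH] P f sP; first by right; exists 0 => //; case: sP.
have [[q Pq qa]|Na] := pselect (exists2 q, P q & b q a != 0); last first.
  have Pa p : P p -> b p a = 0.
    by move=> Pp; apply/eqP; apply: contrapT => /negP pa; apply: Na; exists p.
  have [fa|fa] := eqVneq (b f a) 0; last first.
    by left; exists a; split=> //; apply: lspanW; apply: mem_head.
  have [[y [ey Py fy]]|[p Pp pE]] := IH P f sP.
    by left; exists y; split=> //; apply: wid.
  by right; exists p => // y; rewrite inE => /orP[/eqP->|/pE//]; rewrite Pa.
pose P' p := P p /\ b p a = 0.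
have sP' : subspace P'.
  split=> [|t x y [Px xa] [Py ya]].
    by split; [case: sP | have := bB 0 0 a; rewrite !subrr].
  by split; [case: sP => _; apply | rewrite bL xa ya scaler0 addr0].
pose red p := p - (b p a / b q a) *: q.
have reda p : b (red p) a = 0 by rewrite /red bB bZ divfK ?subrr.
have redP p : P p -> P' (red p).
  by move=> Pp; split=> //; apply: subsB => //; apply: subsZ.
have [[y [ey Py fy]]|[p [Pp pa] pE]] := IH P' (red f) sP'; last first.
  right; exists (p + (b f a / b q a) *: q) => [|y].
    by apply: subsD => //; apply: subsZ.
  rewrite -[_ *: q]opprK bB -scaleNr bZ mulNr opprK inE => /orP[/eqP->|/pE->].
    by rewrite pa divfK // add0r.
  by rewrite bB bZ subrK.
(* The multiple of [a] makes the vector orthogonal to the pivot [q] as well. *)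
left; exists (y - (b q y / b q a : K) *: a).
have qy : b q (y - (b q y / b q a : K) *: a) = 0.
  by rewrite linearB linearZ /= /GRing.scale /= divfK // subrr.
have E p : b p (y - (b q y / b q a : K) *: a) = b (red p) y.
  have pE : p = (b p a / b q a) *: q + red p by rewrite addrC subrK.
  rewrite [in LHS]pE bL qy scaler0 add0r linearB (linearZZ (b (red p))) reda.
  by rewrite scaler0 subr0.
split=> [|p Pp|].
- apply: subsB => //; first exact: wid.
  by apply: subsZ => //; apply: lspanW; apply: mem_head.
- by rewrite E; apply: Py; apply: redP.
- by rewrite E.
Qed.

Context (L1 I1 : int -> {linear V1 -> V1}) (L2 I2 : int -> {linear V2 -> V2}).
Context (cL1 c1 hI1 cL2 c2 hI2 h : K) (v1 : V1) (v2 : V2).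
Context (M1 : hwmod L1 I1 cL1 c1 h hI1 v1) (M2 : hwmod L2 I2 cL2 c2 h hI2 v2).
Context (adj : forall x y, b (L1 0 x) y = b x (L2 0 y)).
Context (nd : forall x, (forall y, b x y = 0) -> x = 0).

Lemma hs_orth d d' x y : hs L1 I1 v1 d x -> hs L2 I2 v2 d' y -> d != d' -> b x y = 0.
Proof.
move=> Hx Hy ne; have := adj x y.
have b0 : b 0 y = 0 by have := bL y (-1) 0 0; rewrite scaler0 addr0 scaleN1r addNr.
rewrite (hs_L0 (hw_mod M1) (hw_vec M1) Hx) (hs_L0 (hw_mod M2) (hw_vec M2) Hy).
rewrite linearZ /= -[_ *: x]addr0 bL b0 addr0 => /eqP.
rewrite -subr_eq0 -scalerBl scaler_eq0 => /orP[|/eqP//].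
have -> : h + d%:~R - (h + d'%:~R) = (d - d')%:~R by ring.
by rewrite intr_eq0 subr_eq0 (negPf ne).
Qed.

(** Some component of [x], of degree [d] say, is outside [P], and [finite_sep] applies to the
    generators of degree [d] on the other side. In its second case nondegeneracy identifies that
    component with one of an element of [P]. *)
Lemma separation (P : set V1) x : subspace P -> (forall y, P y -> P (L1 0 y)) ->
  ~ P x -> exists2 y, (forall p, P p -> b p y = 0) & b x y != 0.
Proof.
move=> sP PL NPx; have H1 := hw_mod M1; have Hv1 := hw_vec M1.
have bB f1 f2 y : b (f1 - f2) y = b f1 y - b f2 y.
  by rewrite addrC -scaleN1r bL addrC /GRing.scale /= mulN1r.
have bsum N (f : nat -> V1) y : b (\sum_(i < N) f i) y = \sum_(i < N) b (f i) y.
  by have := linear_sum (mklin (bL y)) (index_enum 'I_N) xpredT f; rewrite mklinE => ->;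
    apply: eq_bigr => i _; rewrite mklinE.
have proj N (f : nat -> V1) (d : nat) y : (forall i : nat, hs L1 I1 v1 i (f i)) ->
    (d < N)%N -> hs L2 I2 v2 d y -> b (\sum_(i < N) f i) y = b (f d) y.
  move=> Hf dN Hy; rewrite bsum (bigD1 (Ordinal dN)) //= big1 ?addr0 // => i ne.
  by apply: (hs_orth (Hf i) Hy); apply: contra ne => /eqP ne; apply/eqP/val_inj; case: ne.
have [N [f [Hf xE]]] := dec M1 x.
have [d dN NPf] : exists2 d : nat, (d < N)%N & ~ P (f d).
  apply: contrapT => NE; apply: NPx; rewrite xE; apply: subs_sum => // i _.
  by apply: contrapT => NPf; apply: NE; exists i.
have [e [eH He]] := hs_finite L2 I2 v2 d.
have [[y [ey Py fy]]|[p Pp pE]] := finite_sep e (f d) sP.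
  exists y => //; rewrite xE (proj _ _ d) //.
  by apply: lspan_min ey => //; apply: hs_subspace.
case: NPf; have [N' [g [Hg gE]]] := dec M1 p.
pose g' i := if (i < N')%N then g i else 0.
have gE' : p = \sum_(i < maxn N' d.+1) g' i by rewrite gE (hsum_mono _ (leq_maxl N' d.+1)).
have Hg' (i : nat) : hs L1 I1 v1 i (g' i) by rewrite /g'; case: ifP => // _; apply: hs_0.
have dN' : (d < maxn N' d.+1)%N by rewrite leq_max ltnSn orbT.
have Pg : P (g' d) by apply: (hs_comp H1 Hv1 sP PL Hg' _ dN'); rewrite -gE'.
suff -> : f d = g' d by [].
apply/eqP; rewrite -subr_eq0; apply/eqP; apply: nd => y.
have [N2 [k [Hk ->]]] := dec M2 y; rewrite linear_sum big1 // => i _.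
have [<-|ne] := eqVneq d (i : nat); last first.
  apply: (hs_orth (d := d) _ (Hk i)) => //.
  by apply: subsB => //; apply: hs_subspace.
have : lspan (fun z => z \in e) (k d) by apply: He; apply: Hk.
move: (k d); apply: lspan_min => [|z ez].
  by split=> [|a z z' Ez Ez']; rewrite ?linear0 // linearP Ez Ez' scaler0 addr0.
rewrite bB -(pE z ez) gE' (proj _ g' d) ?subrr //; exact: eH.
Qed.

End Separation.

(** * Annihilators reverse the lattice of submodules *)

Section Duality.
Context (K : numFieldType) (V D : lmodType K).
Context (L I W : int -> {linear V -> V}) (Ld Id Wd : int -> {linear D -> D}).
Context (cL c h hI cLd cd hId : K) (v : V) (vD : D).
Context (M : hwmod L I cL c h hI v) (MD : hwmod Ld Id cLd cd h hId vD).
Context (b : D -> {linear V -> K^o}) (bL : forall x, linear (b^~ x : D -> K^o)).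
Context (bLn : forall n d x, b (Ld n d) x = b d (L (- n) x)).
Context (bWn : forall n d x, b (Wd n d) x = b d (W (- n) x)).
Context (ndl : forall d, (forall x, b d x = 0) -> d = 0).
Context (ndr : forall x, (forall d, b d x = 0) -> x = 0).

Definition perpr (S : set V) : set D := fun d => forall x, S x -> b d x = 0.
Definition perpl (S : set D) : set V := fun x => forall d, S d -> b d x = 0.

Lemma pair0 x : b 0 x = 0.
Proof. by have := bL x (-1) 0 0; rewrite scaler0 addr0 scaleN1r addNr. Qed.

Lemma perpr_stable S : wstable L W S -> wstable Ld Wd (perpr S).
Proof.
move=> [sS SL SW]; split=> [|n d pd x Sx|n d pd x Sx]; last 2 first.
- by rewrite bLn; apply/pd/SL.
- by rewrite bWn; apply/pd/SW.
split=> [x _|a d d' pd pd' x Sx]; first exact: pair0.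
by rewrite bL pd // pd' // scaler0 addr0.
Qed.

Lemma perpl_stable S : wstable Ld Wd S -> wstable L W (perpl S).
Proof.
move=> [sS SL SW]; split=> [|n x px d Sd|n x px d Sd]; last 2 first.
- by rewrite -[n]opprK -bLn; apply/px/SL.
- by rewrite -[n]opprK -bWn; apply/px/SW.
split=> [d _|a x x' px px' d Sd]; first exact: linear0.
by rewrite linearP px // px' // scaler0 addr0.
Qed.

Lemma sepr (S : set V) x : wstable L W S -> ~ S x -> exists2 d, perpr S d & b d x != 0.
Proof.
move=> [sS SL _] NSx.
pose b' y : {linear D -> K^o} := mklin (bL y).
have b'E y d : b' y d = b d y by apply: (mklinE (bL y)).
have b'L d : linear (b'^~ d : V -> K^o) by move=> a y z; rewrite !b'E linearP.
have [||d Sd xd] := separation b'L M MD _ _ sS (SL 0) NSx.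
- by move=> y d; rewrite !b'E bLn oppr0.
- by move=> y yd; apply: ndr => d; rewrite -b'E.
by exists d => [y Sy|]; rewrite -b'E //; apply: Sd.
Qed.

Lemma sepl (S : set D) d : wstable Ld Wd S -> ~ S d -> exists2 x, perpl S x & b d x != 0.
Proof.
move=> [sS SL _] NSd; have adj d' x : b (Ld 0 d') x = b d' (L 0 x) by rewrite bLn oppr0.
exact: (separation bL MD M adj ndl sS (SL 0) NSd).
Qed.

Lemma perpr_eq0 S : wstable L W S -> (forall d, perpr S d -> d = 0) -> forall x, S x.
Proof.
move=> sS p0 x; apply: contrapT => /(sepr sS)[d /p0->].
by rewrite pair0 eqxx.
Qed.

Lemma perpr_full (S : set V) : (forall d, perpr S d) -> forall x, S x -> x = 0.
Proof. by move=> pT x Sx; apply: ndr => d; apply: pT. Qed.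

Lemma w_irr_dual : w_irr Ld Wd -> w_irr L W.
Proof.
move=> irr S sS; have [p0|pT] := irr _ (perpr_stable sS).
  by right; apply: perpr_eq0.
by left; apply: perpr_full.
Qed.

Lemma w_chain_dual : w_chain Ld Wd -> w_chain L W.
Proof.
move=> [N [sN [d Nd d0] [d' Nd'] chain]]; exists (perpl N); split.
- exact: perpl_stable.
- have [x px bx] := sepl sN Nd'; exists x => //.
  by apply: contra bx => /eqP->; rewrite linear0.
- apply: contrapT => NE; move/eqP: d0; apply; apply: ndl => x.
  by apply: contrapT => bx; apply: NE; exists x => px; apply: bx; apply: px.
move=> S sS; case: (chain _ (perpr_stable sS)) => [p0|pN|pT].
- by constructor 3; apply: perpr_eq0.
- constructor 2 => x; split=> [Sx d1 /pN|px]; first exact.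
  by apply: contrapT => /(sepr sS)[d1 /pN/px->]; rewrite eqxx.
- by constructor 1; apply: perpr_full.
Qed.

Context (WE : forall n x, W n x = Wop I c n x).
Context (WdE : forall n x, Wd n x = Wop Id cd n x).
Context (bvv : b vD v = 1).

(** A nonzero [S] contains [v]; were its annihilator nonzero it would contain [vD], against
    [b vD v = 1]. *)
Lemma w_irr_generic :
  (forall n : nat, (0 < n)%N -> hI - c * (n%:R + 1) != 0) ->
  (forall n : nat, (0 < n)%N -> hId - cd * (n%:R + 1) != 0) -> w_irr L W.
Proof.
move=> nt ntd S sS; case: (pselect (forall x, S x -> x = 0)); first by left.
move=> NS; right; have [x Sx x0] : exists2 x, S x & x != 0.
  apply: contrapT => NE; apply: NS => x Sx; apply/eqP; apply: contrapT => /negP x0.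
  by apply: NE; exists x.
have Sv := wstable_vac M WE nt sS Sx x0.
apply: perpr_eq0 => // d pd; apply/eqP; apply: contrapT => /negP d0.
have /(_ v Sv) := wstable_vac MD WdE ntd (perpr_stable sS) pd d0.
by rewrite bvv => /eqP; rewrite oner_eq0.
Qed.

End Duality.

(** * The contragredient module *)

Section VacuumFunctional.
Context (K : numFieldType) (V : lmodType K) (L I : int -> {linear V -> V}).
Context (cL c h hI : K) (v : V) (M : hwmod L I cL c h hI v).
Let H := hw_mod M.
Let Hv := hw_vec M.
Local Notation hs := (hs L I v).

Definition above := lspan (fun x => exists2 d : nat, (0 < d)%N & hs d x).

Lemma above_hs (d : int) x : hs d x -> d != 0 -> above x.
Proof.
case: d => [d|d] Hx d0; last by rewrite (hs_lt0 Hx) //; apply: lspan0.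
by apply: lspanW; exists d => //; move: d0; rewrite lt0n.
Qed.

Lemma vac_coord_ex x : exists a : K^o, above (x - a *: v).
Proof.
have [[|N] [f [Hf ->]]] := dec M x.
  by exists 0; rewrite big_ord0 scale0r subr0; apply: lspan0.
have [a fa] := hs_0E (Hf 0%N); exists a; rewrite big_ord_recl /= fa addrAC subrr add0r.
by apply: subs_sum => [|i _]; [apply: lspan_subspace | apply: above_hs (Hf _) _].
Qed.

Definition vac_coord x := sval (cid (vac_coord_ex x)).

Lemma vac_coordP x : above (x - vac_coord x *: v).
Proof. exact: (svalP (cid (vac_coord_ex x))). Qed.

Lemma above_vac a : above (a *: v) -> a = 0.
Proof.
move=> av; have : [set 0] (a *: v).
  apply: (@lspan_min _ _ (fun e => (exists2 d : nat, (0 < d)%N & hs d e) /\ hs 0 e)).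
  - exact: subspace_set0.
  - by move=> e [[d d0 He] He0]; apply: (hs_uniq H Hv He He0); rewrite eqz_nat -lt0n.
  - apply: (lspan_hs M (d := 0) _ av) => [e [d _ He]|]; first by exists d.
    by apply: subsZ; [apply: hs_subspace | apply: hs_v].
by move=> /eqP; rewrite scaler_eq0 (negPf (hw_n0 M)) orbF => /eqP.
Qed.

Lemma vac_coordE x (a : K^o) : above (x - a *: v) -> vac_coord x = a.
Proof.
move=> xa; apply/eqP; rewrite eq_sym -subr_eq0; apply/eqP/above_vac; rewrite scalerBl.
have -> : a *: v - vac_coord x *: v = (x - vac_coord x *: v) - (x - a *: v).
  by rewrite opprB [RHS]addrC addrA subrK.
by apply: subsB (vac_coordP x) xa; apply: lspan_subspace.
Qed.

Lemma vac_coord_linear : linear vac_coord.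
Proof.
move=> a x y; apply: vac_coordE.
have -> : a *: x + y - (a *: vac_coord x + vac_coord y) *: v
    = a *: (x - vac_coord x *: v) + (y - vac_coord y *: v).
  rewrite scalerBr scalerDl opprD scalerA -!addrA; congr (_ + _).
  by rewrite addrCA.
have [_ D] := lspan_subspace (fun x => exists2 d : nat, (0 < d)%N & hs d x).
by apply: D; apply: vac_coordP.
Qed.

Lemma vac_coord_v : vac_coord v = 1.
Proof. by apply: vac_coordE; rewrite scale1r subrr; apply: lspan0. Qed.

Lemma vac_coord_hs (d : int) x : hs d x -> d != 0 -> vac_coord x = 0.
Proof. by move=> Hx d0; apply: vac_coordE; rewrite scale0r subr0; apply: above_hs Hx d0. Qed.

Lemma vac_coord_neg n x : n < 0 -> vac_coord (L n x) = 0 /\ vac_coord (I n x) = 0.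
Proof.
move=> n0; have [N [f [Hf ->]]] := dec M x.
pose g : {linear V -> K^o} := mklin vac_coord_linear.
have gE y : vac_coord y = g y by rewrite mklinE.
rewrite !gE !linear_sum /=; split; rewrite big1 // => i _; rewrite -gE.
  by apply: vac_coord_hs (hsL H Hv n (Hf i)) _; lia.
by apply: vac_coord_hs (hsI H Hv n (Hf i)) _; lia.
Qed.

Lemma vac_coord_L0 x : vac_coord (L 0 x) = h * vac_coord x.
Proof.
have [N [f [Hf ->]]] := dec M x.
pose g : {linear V -> K^o} := mklin vac_coord_linear.
have gE y : vac_coord y = g y by rewrite mklinE.
rewrite !gE !linear_sum mulr_sumr; apply: eq_bigr => i _.
rewrite (hs_L0 H Hv (Hf i)) linearZ -!gE /=.
have [->|i0] := eqVneq (i : nat) 0%N; first by rewrite addr0.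
by rewrite (vac_coord_hs (Hf i)) // ?scaler0 ?mulr0.
Qed.

End VacuumFunctional.

Section Dual.
Context (K : numFieldType) (V : lmodType K) (L I : int -> {linear V -> V}).
Context (cL c h hI : K) (v : V) (M : hwmod L I cL c h hI v).
Let H := hw_mod M.
Let Hv := hw_vec M.

(** The contragredient module inside the full linear dual, as what the vacuum functional generates
    under transposes; generation by the vacuum then holds by construction. *)
Inductive dual_set : set (V -> K^o) :=
| dual_v : dual_set (vac_coord M)
| dual_lin a f g : dual_set f -> dual_set g -> dual_set (a *: f + g)
| dual_L n f : dual_set f -> dual_set (fun x => f (L n x))
| dual_I n f : dual_set f -> dual_set (fun x => f (I n x)).

Lemma dual_subspace : subspace dual_set.
Proof.
split=> [|a f g]; last exact: dual_lin.
by rewrite -(addNr (vac_coord M)) -scaleN1r; apply: dual_lin; apply: dual_v.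
Qed.

Lemma dual_linear f : dual_set f -> linear f.
Proof.
elim=> [|a {}f g _ IHf _ IHg|n {}f _ IH|n {}f _ IH] t x y; first exact: vac_coord_linear.
- rewrite !fctE IHf IHg !scalerDr !scalerA [t * a]mulrC.
  by rewrite -!addrA; congr (_ + _); rewrite addrCA.
- by rewrite linearP IH.
- by rewrite linearP IH.
Qed.

Section DualModule.
Context (D : lmodType K) (Ld Id : int -> {linear D -> D}) (vD : D).
Context (b : D -> {linear V -> K^o}) (bL : forall x, linear (b^~ x : D -> K^o)).
Context (bLn : forall n d x, b (Ld n d) x = b d (L (- n) x)).
Context (bIn : forall n d x,
  b (Id n d) x = (n == 0)%:R * (2 * c) * b d x - b d (I (- n) x)).
Context (ndl : forall d, (forall x, b d x = 0) -> d = 0).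
Context (bvD : forall x, b vD x = vac_coord M x).
Context (Dgen : forall S, hstable Ld Id S -> S vD -> forall d, S d).

Let b0 x : b 0 x = 0.
Proof. by have := bL x (-1) 0 0; rewrite scaler0 addr0 scaleN1r addNr. Qed.
Let bD d d' x : b (d + d') x = b d x + b d' x.
Proof. by rewrite -[d]scale1r bL !scale1r. Qed.
Let bZ a d x : b (a *: d) x = a * b d x.
Proof. by rewrite -[_ *: d]addr0 bL b0 addr0. Qed.
Let bN d x : b (- d) x = - b d x.
Proof. by rewrite -scaleN1r bZ mulN1r. Qed.
Let bext d d' : (forall x, b d x = b d' x) -> d = d'.
Proof.
move=> E; apply/eqP; rewrite -subr_eq0; apply/eqP/ndl => x.
by rewrite bD bN E subrr.
Qed.
Let b_Z a d x : b d (a *: x) = a * b d x.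
Proof. exact: (linearZZ (b d)). Qed.

(** The sign of [I(-n)] and the shift [2 c] at [n = 0] compensate the asymmetry of the cocycle
    [n^2 + n] under [n -> - n]; they turn [hI] into [2 c - hI]. *)
Lemma dual_hmod : hmod Ld Id cL c (2 * c - hI).
Proof.
split=> [n m d|n m d|n m d|d]; apply: bext => x.
- rewrite !bD !bZ !bLn (LLE H) !linearD !b_Z.
  rewrite -[- m - n]opprD [m + n]addrC opprK (_ : (- m == n) = (n == - m)); last by apply/eqP/eqP; lia.
  rewrite [- m + n]addrC.
  case: eqP => [->|_]; last by rewrite !mul0r.
  by congr (_ + _ * _ * _ * _); rewrite opprK.
- rewrite !bD !bN !bZ !bLn !bIn !bLn.
  have -> : I (- m) (L (- n) x) = L (- n) (I (- m) x) - m%:~R *: I (- (n + m)) x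
      + ((n == - m)%:R * (n ^+ 2 - n)%:~R * c) *: x.
    rewrite (LIE H) opprK [- n == m]eqr_oppLR sqrrN -opprD mulrNz scaleNr opprK.
    by rewrite [RHS](ACl (1*(2*4)*(3*5))) /= subrr addr0 addNr addr0.
  rewrite !linearD linearN !b_Z.
  rewrite addr_eq0; case: (eqVneq n (- m)) => [->|_] /=; last by ring.
  by ring.
- rewrite !bIn (IIC H (- m)); ring.
- by rewrite bIn bZ oppr0 (I0E H) b_Z eqxx mul1r mulrBl.
Qed.

Lemma dual_hwvec : hwvec Ld Id h vD.
Proof.
split=> [n n0|n n0|]; apply: bext => x.
- by rewrite b0 bLn bvD; apply: (vac_coord_neg M x _).1; lia.
- rewrite b0 bIn gt_eqF // !mul0r sub0r bvD; apply/eqP; rewrite oppr_eq0; apply/eqP.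
  by apply: (vac_coord_neg M x _).2; lia.
- by rewrite bLn bZ oppr0 !bvD vac_coord_L0.
Qed.

Lemma dual_vv : b vD v = 1.
Proof. by rewrite bvD vac_coord_v. Qed.

Lemma dual_ndr x : (forall d, b d x = 0) -> x = 0.
Proof.
move=> bx; apply/eqP; apply: contrapT => /negP x0.
suff /(_ vD) : forall d, b d v = 0 by rewrite dual_vv => /eqP; rewrite oner_eq0.
apply: (hw_irr M (S := fun x => forall d, b d x = 0) _ bx x0).
split=> [|n y yS d|n y yS d].
- by split=> [d|a y z yS zS d]; rewrite ?linear0 // linearP yS zS scaler0 addr0.
- by rewrite -[n]opprK -bLn.
- by have := bIn (- n) d y; rewrite opprK !yS mulr0 sub0r => /esym/eqP; rewrite oppr_eq0 => /eqP.
Qed.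

(** If all of [S] vanished on [v], its annihilator in [V] would be a submodule containing the
    vacuum. So some [d1] in [S] does not, and its component of degree 0 is a nonzero multiple of
    [vD]. *)
Lemma dual_irr S : hstable Ld Id S -> forall d, S d -> d != 0 -> S vD.
Proof.
move=> [sS SL SI] d Sd d0.
have [d1 Sd1 d1v] : exists2 d1, S d1 & b d1 v != 0.
  apply: contrapT => NE; move/eqP: d0; apply; apply: ndl => x; move: Sd; move: d.
  apply: (hw_gen M (S := fun x => forall d, S d -> b d x = 0)) => [|d Sd]; last first.
    by apply/eqP; apply: contrapT => dv; apply: NE; exists d => //; apply/negP.
  split=> [|n y yS d Sd|n y yS d Sd].
  - by split=> [d Sd|a y z yS zS d Sd]; rewrite ?linear0 // linearP yS ?zS // scaler0 addr0.
  - by rewrite -[n]opprK -bLn; apply/yS/SL.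
  - have := bIn (- n) d y; rewrite opprK (yS d) // (yS (Id _ _)); last exact: SI.
    by rewrite mulr0 sub0r => /esym/eqP; rewrite oppr_eq0 => /eqP.
have Hm := dual_hmod; have Hw := dual_hwvec.
have [N [f [Hf dE]]] : hsum Ld Id vD d1.
  by apply: (Dgen (hsum_stable Hm Hw)); apply/hsum_hs/hs_v.
have fv i : (0 < i)%N -> b (f i) v = 0.
  move=> i0; have := bLn 0 (f i) v.
  rewrite (hs_L0 Hm Hw (Hf i)) oppr0 (L0v Hv) bZ b_Z => /eqP.
  rewrite -subr_eq0 -mulrBl mulf_eq0 => /orP[|/eqP//].
  by rewrite addrAC subrr add0r -pmulrn pnatr_eq0 eqn0Ngt i0.
case: N dE => [|N] dE; first by rewrite dE big_ord0 b0 eqxx in d1v.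
have S0 : S (f 0%N) by apply: (hs_comp Hm Hw sS (SL 0) Hf (i := 0%N) _ (ltn0Sn N)); rewrite -dE.
have [a fa] := hs_0E (Hf 0%N).
rewrite fa in S0; apply: (subsZV sS _ S0); apply/eqP => a0; move/eqP: d1v; apply.
rewrite dE big_ord_recl /= fa a0 scale0r add0r.
elim/big_ind: _ => [|x y bx by0|i _]; [exact: b0 | by rewrite bD bx by0 addr0 | exact: fv].
Qed.

Lemma dual_hwmod : hwmod Ld Id cL c h (2 * c - hI) vD.
Proof.
split; [exact: dual_hmod | exact: dual_hwvec | | exact: Dgen | exact: dual_irr].
by apply/eqP => v0; have := dual_vv; rewrite v0 b0 => /esym/eqP; rewrite oner_eq0.
Qed.

(** Transposition matches the quadratic sums after a shift by [n]; the extra [2 c] at the terms with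
    a factor [Id 0], [i = 0] and [i = - n], turns the linear coefficient of W(n) into that of
    W(-n). *)
Lemma Wop_dual n d x : b (Wop Id c n d) x = b d (Wop I c (- n) x).
Proof.
have MD := dual_hwmod.
pose bx : {linear D -> K^o} := mklin (bL x).
have bxE y : b y x = bx y by rewrite mklinE.
pose G i : K^o := b d (I (- i) (I (- n + i) x)).
have finG : finz G by have [C FC] := finzII0 M (- n) x; exists C => i /FC E; rewrite /G E linear0.
have E i : bx (Id (- i) (Id (n + i) d)) = G (i + n)
    + ((i == - n)%:R *: (- (2 * c) * b d (I (- n) x) : K^o)
    + (i == 0)%:R *: (2 * c * ((n == 0)%:R * (2 * c) * b d x - b d (I (- n) x)) : K^o)).
  rewrite -bxE !bIn opprK oppr_eq0 [n + i]addrC addr_eq0 /G [i + n in RHS]addrC addKr.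
  rewrite [n + i]addrC /GRing.scale /=.
  have [i0|i0] := eqVneq i 0.
    rewrite i0 ?addr0 ?add0r [0 == _]eq_sym oppr_eq0 /=.
    by case: (eqVneq n 0) => [->|_] /=; rewrite ?oppr0 ?mulr0n ?mul0r; ring.
  by have [->|_] := eqVneq i (- n); rewrite /= ?addNr ?oppr0; ring.
rewrite /Wop bD bZ [b (\sum_(i \in _) _) x]bxE (zsum_map bx); last exact: (finzII0 MD).
rewrite (eq_fsbigr _ _ (fun i _ => E i)).
rewrite zsumD; [|exact: (finz_shift n finG)|by apply: finzD; [exact: (finz_delta _ (fun=> _)) | exact: (finz_delta _ (fun=> _))]].
rewrite zsumD; [|exact: (finz_delta _ (fun=> _))|exact: (finz_delta _ (fun=> _))].
rewrite (zsum_delta (- n) (fun=> _)) (zsum_delta 0 (fun=> _)) -(zsum_shift n G).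
rewrite linearD b_Z (zsum_map (b d)); last exact: (finzII0 M).
rewrite -[X in _ = _ + X]/(\sum_(i \in [set: int]) G i) bIn.
move: (\sum_(i \in [set: int]) G i) => A; rewrite /GRing.scale /=.
by case: (eqVneq n 0) => [->|_] /=; rewrite ?oppr0; ring.
Qed.

End DualModule.
End Dual.

Section DualExistence.
Context (K : numFieldType) (V : lmodType K) (L I : int -> {linear V -> V}).
Context (cL c h hI : K) (v : V) (M : hwmod L I cL c h hI v).

Lemma dual_ex : exists (D : lmodType K) (Ld Id : int -> {linear D -> D}) (vD : D)
    (b : D -> {linear V -> K^o}),
  [/\ forall x, linear (b^~ x : D -> K^o),
      forall n d x, b (Ld n d) x = b d (L (- n) x),
      forall n d x, b (Id n d) x = (n == 0)%:R * (2 * c) * b d x - b d (I (- n) x),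
      forall d, (forall x, b d x = 0) -> d = 0 &
      (forall x, b vD x = vac_coord M x) /\
      forall S, hstable Ld Id S -> S vD -> forall d, S d].
Proof.
have [D [i [i_inj iP]]] := sub_lmod (dual_subspace M).
have iS d : dual_set M (i d) by apply/iP; exists d.
have lift (T : (V -> K^o) -> V -> K^o) :
    (forall a f g, T (a *: f + g) = a *: T f + T g) ->
    (forall f, dual_set M f -> dual_set M (T f)) ->
    {g : {linear D -> D} | forall d, i (g d) = T (i d)}.
  move=> TL TS; have ex d : exists d', i d' = T (i d) by apply/iP/TS.
  pose g d := sval (cid (ex d)).
  have gE d : i (g d) = T (i d) by apply: (svalP (cid (ex d))).
  have gL : linear g by move=> a d d'; apply: i_inj; rewrite linearP !gE linearP TL.
  by exists (mklin gL) => d; rewrite mklinE.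
have liftL n : {g : {linear D -> D} | forall d, i (g d) = fun x => i d (L (- n) x)}.
  by apply: (lift (fun f x => f (L (- n) x))) => // f; apply: dual_L.
pose TI n (f : V -> K^o) : V -> K^o := ((n == 0)%:R * (2 * c)) *: f - (fun x => f (I (- n) x)).
have liftI n : {g : {linear D -> D} | forall d, i (g d) = TI n (i d)}.
  apply: (lift (TI n)) => [a f g|f Sf].
    apply/funext => x; rewrite /TI !fctE !scalerBr !scalerDr !scalerA opprD.
    by rewrite [a * _]mulrC [LHS]addrACA.
  by apply: subsB; [apply: dual_subspace | apply: subsZ => //; apply: dual_subspace | apply: dual_I].
have [vD vDE] : exists vD, i vD = vac_coord M by apply/iP/dual_v.
pose b d : {linear V -> K^o} := mklin (dual_linear (iS d)).
have bE d x : b d x = i d x by apply: mklinE.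
exists D, (fun n => sval (liftL n)), (fun n => sval (liftI n)), vD, b; split.
- by move=> x a d d'; rewrite !bE linearP.
- by move=> n d x; rewrite !bE (svalP (liftL n)).
- by move=> n d x; rewrite !bE (svalP (liftI n)).
- move=> d d0; apply: i_inj; rewrite linear0; apply/funext => x; rewrite -bE; exact: d0.
split=> [x|S [sS SL SI] Sv d]; first by rewrite bE vDE.
suff gen f : dual_set M f -> forall d, i d = f -> S d by apply: (gen _ (iS d)).
elim=> {d f} [d|a f g Sf IHf Sg IHg d|n f Sf IH d|n f Sf IH d] dE.
- by have -> : d = vD by apply: i_inj; rewrite dE.
- have /iP[df dfE] := Sf; have /iP[dg dgE] := Sg.
  have -> : d = a *: df + dg by apply: i_inj; rewrite dE linearP dfE dgE.
  by case: sS => _; apply; [apply: IHf | apply: IHg].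
- have /iP[df dfE] := Sf.
  have -> : d = sval (liftL (- n)) df.
    by apply: i_inj; rewrite dE (svalP (liftL (- n))) dfE opprK.
  by apply/SL/IH.
have /iP[df dfE] := Sf.
(* [dual_I] is the plain transpose, which differs from [Id] by the sign and a multiple of the
   identity. *)
have -> : d = ((- n == 0)%:R * (2 * c)) *: df - sval (liftI (- n)) df.
  apply: i_inj; rewrite linearB (linearZZ i) dE (svalP (liftI (- n))) dfE.
  by rewrite /TI opprK opprB addrC subrK.
by apply: subsB => //; [apply: subsZ => //; apply: IH | apply/SI/IH].
Qed.

End DualExistence.

(** * The cases of hI / c - 1 *)

Section Trichotomy.
Context (K : numFieldType) (V : lmodType K) (L I W : int -> {linear V -> V}).
Context (cL c h hI : K) (v : V) (M : hwmod L I cL c h hI v).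
Context (WE : forall n x, W n x = Wop I c n x) (c0 : c != 0).

Theorem w_irr_typical : ~ atypical cL c (h, hI) -> w_irr L W.
Proof.
move=> Nat.
have Nm p j : (0 < p)%N -> hI = (1 - p%:R) * c -> h != h_pr cL p j.+1.
  by move=> p0 hIE; apply/eqP => hE; apply: Nat; right; exists p, j.+1; rewrite hE hIE.
have Np p j : (0 < p)%N -> hI = (1 + p%:R) * c -> h != h_pr cL p j.+1.
  by move=> p0 hIE; apply/eqP => hE; apply: Nat; left; exists p, j.+1; rewrite hE hIE.
have [[p p0 hIE]|Am] := pselect (exists2 p, (0 < p)%N & hI = (1 - p%:R) * c).
  by apply: (core_irr M WE p0 c0 hIE) => j; apply: Nm.
have [D [Ld [Id [vD [b [bL bLn bIn ndl [bvD Dgen]]]]]]] := dual_ex M.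
have MD := dual_hwmod bL bLn bIn ndl bvD Dgen.
pose Wd n : {linear D -> D} := mklin (Wop_linear MD n).
have WdE n d : Wd n d = Wop Id c n d by apply: mklinE.
have ndr := dual_ndr bLn bIn bvD.
have bW n d x : b (Wd n d) x = b d (W (- n) x).
  by rewrite WdE WE; apply: (Wop_dual bL bLn bIn ndl bvD Dgen).
have [[p p0 hIE]|Ap] := pselect (exists2 p, (0 < p)%N & hI = (1 + p%:R) * c).
  apply: (w_irr_dual M MD bL bLn bW ndr).
  by apply: (core_irr MD WdE p0 c0) => [|j]; [rewrite hIE; ring | apply: Np].
apply: (w_irr_generic M MD bL bLn bW ndr WE WdE (dual_vv bvD)) => p p0.
  by apply/eqP => /eqP; rewrite subr_eq0 => /eqP E; apply: Ap; exists p => //; rewrite E; ring.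
apply/eqP => /eqP; rewrite subr_eq0 => /eqP E; apply: Am; exists p => //.
by rewrite -[hI](subKr (2 * c)) E; ring.
Qed.

Theorem w_chain_atypical : atypical cL c (h, hI) -> w_chain L W.
Proof.
(* The second family of [atypical] is the direct case; the first goes through the dual, where
   [2 c - hI = (1 - p) c]. *)
case=> -[p [r [p0 + [+ hIE]]]]; case: r => // r _ hE; last exact: (core_chain M WE p0 c0 hIE hE).
have [D [Ld [Id [vD [b [bL bLn bIn ndl [bvD Dgen]]]]]]] := dual_ex M.
have MD := dual_hwmod bL bLn bIn ndl bvD Dgen.
pose Wd n : {linear D -> D} := mklin (Wop_linear MD n).
have WdE n d : Wd n d = Wop Id c n d by apply: mklinE.
have bW n d x : b (Wd n d) x = b d (W (- n) x).
  by rewrite WdE WE; apply: (Wop_dual bL bLn bIn ndl bvD Dgen).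
apply: (w_chain_dual M MD bL bLn bW ndl (dual_ndr bLn bIn bvD)).
have hIdE : 2 * c - hI = (1 - p%:R) * c by rewrite hIE; ring.
exact: (core_chain MD WdE p0 c0 hIdE hE).
Qed.

End Trichotomy.

(** * Modules over W(2,2) *)

Section LieModules.
Context (K : fieldType) (g : lieAlgebra K) (V : lmodType K) (act : g -> V -> V).
Context (lm : lie_module act).

Let act_lin x : linear (act x). Proof. by case: lm. Qed.
Let act_linl y : linear (act^~ y). Proof. by case: lm. Qed.

Lemma act_Pl a x x' y : act (a *: x + x') y = a *: act x y + act x' y.
Proof. exact: act_linl. Qed.

Lemma act_0l y : act 0 y = 0.
Proof. by have := act_Pl (-1) 0 0 y; rewrite scaler0 addr0 scaleN1r addNr. Qed.

Lemma act_Zl a x y : act (a *: x) y = a *: act x y.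
Proof. by rewrite -[_ *: x]addr0 act_Pl act_0l addr0. Qed.

Lemma act_Nl x y : act (- x) y = - act x y.
Proof. by rewrite -scaleN1r act_Zl scaleN1r. Qed.

Lemma act_Dl x x' y : act (x + x') y = act x y + act x' y.
Proof. by rewrite -[x]scale1r act_Pl !scale1r. Qed.

Lemma submodule_subspace S : submodule act S -> subspace S.
Proof. by case. Qed.

Lemma sub_module S : submodule act S ->
  exists (V1 : lmodType K) (act1 : g -> V1 -> V1) (i : V1 -> V),
  [/\ lie_module act1, module_hom act1 act i, injective i & forall x, S x <-> range i x].
Proof.
move=> mS; have [V1 [i [i_inj iP]]] := sub_lmod (submodule_subspace mS).
have ex x y : exists y', i y' = act x (i y).
  by apply/iP; case: mS => _ _; apply; apply/iP; exists y.
pose act1 x y := sval (cid (ex x y)).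
have iact1 x y : i (act1 x y) = act x (i y) by apply: (svalP (cid (ex x y))).
exists V1, act1, i; split=> //.
- split=> [y a x x'|x a y y'|x x' y]; apply: i_inj; rewrite ?linearP ?linearB !iact1.
  + exact: act_Pl.
  + by rewrite linearP act_lin.
  + by case: lm => _ _ ->.
- by split=> // a x y; apply: linearP.
- by move=> x; rewrite iP; split=> [[y <-]|[y _ <-]]; exists y.
Qed.

Lemma quot_module S : submodule act S ->
  exists (V2 : lmodType K) (act2 : g -> V2 -> V2) (q : V -> V2),
  [/\ lie_module act2, module_hom act act2 q, forall w, exists x, q x = w &
      forall x, q x = 0 <-> S x].
Proof.
move=> mS; have [V2 [q [q_surj qP]]] := quot_lmod (submodule_subspace mS).
pose r w := sval (cid (q_surj w)); pose act2 x w := q (act x (r w)).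
have qr w : q (r w) = w by apply: (svalP (cid (q_surj w))).
have q_eq x y : S (x - y) -> q x = q y.
  by move=> /qP; rewrite linearB => /eqP; rewrite subr_eq0 => /eqP.
have qact x y : q (act x y) = act2 x (q y).
  apply: q_eq; have -> : act x y - act x (r (q y)) = act x (y - r (q y)).
    by rewrite addrC -scaleN1r -act_lin scaleN1r addrC.
  by case: mS => _ _; apply; apply/qP; rewrite linearB qr subrr.
exists V2, act2, q; split=> //.
- split=> [w a x x'|x a w w'|x x' w].
  + by rewrite /act2 act_Pl linearP.
  + by rewrite -[w]qr -[w']qr -linearP -!qact -linearP act_lin.
  + by rewrite -[w]qr -!qact -linearB; case: lm => _ _ ->.
- by split=> // a x y; apply: linearP.
Qed.

Lemma simple_generates : irreducible_module act -> forall y, y != 0 -> generates act y.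
Proof.
move=> [_ _ irr] y y0 S mS Sy; case: (irr S mS) => // S0.
by move: Sy y0; rewrite S0 => /= ->; rewrite eqxx.
Qed.

Definition chain_sub (N : set V) := [/\ submodule act N,
  exists2 x, N x & x != 0, exists x, ~ N x & forall S : set V, submodule act S ->
      [\/ forall x, S x -> x = 0, forall x, S x <-> N x | forall x, S x]].

Section Chain.
Context (N : set V) (chN : chain_sub N).

Lemma chain_sub_irr (V1 : lmodType K) (act1 : g -> V1 -> V1) (i : V1 -> V) :
  lie_module act1 -> module_hom act1 act i -> injective i ->
  (forall x, N x <-> range i x) -> irreducible_module act1.
Proof.
move=> lm1 [iL iact] i_inj iP; case: chN => mN [x Nx x0] [z Nz] ch.
have i0 : i 0 = 0 by have := iL (-1) 0 0; rewrite scaler0 addr0 scaleN1r addNr.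
split=> //.
  have [y _ yx] := (iP x).1 Nx; exists y; apply: contra x0 => /eqP y0.
  by rewrite -yx y0 i0.
move=> S [S0 SD SA]; case: (ch (i @` S)).
- split; first by exists 0.
    by move=> a _ _ [y Sy <-] [y' Sy' <-]; exists (a *: y + y'); [apply: SD | rewrite iL].
  by move=> u _ [y Sy <-]; exists (act1 u y); [apply: SA | rewrite iact].
- move=> iS0; left; apply/seteqP; split=> [y Sy|y -> //] /=.
  by apply: i_inj; rewrite i0; apply: iS0; exists y.
- move=> iSN; right; apply/seteqP; split=> // y _.
  have /iSN[y' Sy' /i_inj<- //] : N (i y) by apply/iP; exists y.
- move=> iST; case: Nz; have [y Sy <-] := iST z; by apply/iP; exists y.
Qed.

Lemma chain_quot_irr (V2 : lmodType K) (act2 : g -> V2 -> V2) (q : V -> V2) :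
  lie_module act2 -> module_hom act act2 q -> (forall w, exists x, q x = w) ->
  (forall x, q x = 0 <-> N x) -> irreducible_module act2.
Proof.
move=> lm2 [qL qact] q_surj qP; case: chN => mN [x Nx x0] [z Nz] ch.
have q0 : q 0 = 0 by apply/qP; case: mN.
split=> //; first by exists (q z); apply/eqP => /qP.
move=> S [S0 SD SA]; case: (ch (q @^-1` S)).
- split=> [|a u v Su Sv|u v Sv]; first by rewrite /preimage /= q0.
    by rewrite /preimage /= qL; apply: SD.
  by rewrite /preimage /= qact; apply: SA.
- by move=> qS0; case/eqP: x0; apply: qS0; rewrite /preimage /= (qP x).2.
- move=> qSN; left; apply/seteqP; split=> [w Sw|w -> //] /=.
  by have [y yw] := q_surj w; rewrite -yw; apply/qP/qSN; rewrite /preimage /= yw.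
- move=> qST; right; apply/seteqP; split=> // w _.
  by have [y <-] := q_surj w; apply: qST.
Qed.

(** The image of a section is a submodule. If it is 0 or [N], then [q] vanishes on it and hence
    everywhere; if it is all of [V], then [q] is injective although [N] is nonzero. *)
Lemma chain_nonsplit (V2 : lmodType K) (act2 : g -> V2 -> V2) (q : V -> V2) :
  module_hom act act2 q -> (forall x, q x = 0 <-> N x) -> ~ splits act act2 q.
Proof.
move=> [qL qact] qP [s [sL sact] qs]; case: chN => mN [x Nx x0] [z Nz] ch.
have s0 : s 0 = 0 by have := sL (-1) 0 0; rewrite scaler0 addr0 scaleN1r addNr.
have q0 : q 0 = 0 by apply/qP; case: mN.
case: (ch (range s)).
- split; first by exists 0.
    by move=> a _ _ [y _ <-] [y' _ <-]; exists (a *: y + y') => //; rewrite sL.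
  by move=> u _ [y _ <-]; exists (act2 u y) => //; rewrite sact.
- by move=> sS0; apply/Nz/qP; rewrite -[q z]qs (sS0 (s (q z))) ?q0 //; exists (q z).
- by move=> sSN; apply/Nz/qP; rewrite -[q z]qs; apply/qP/sSN; exists (q z).
- move=> sST; case/eqP: x0; have [w _ wx] := sST x.
  by have /qP := Nx; rewrite -wx qs => ->.
Qed.

End Chain.
End LieModules.

(** * From Lie algebra actions to families of operators *)

Section HeisenbergVirasoro.
Context (K : numFieldType) (V : lmodType K) (act : hvir K -> V -> V).
Context (cL cLI h hI : K).
Context (irr : irreducible_module act)
  (hw : hvir_highest_weight_module act cL 0 cLI h hI).
Let lm : lie_module act. Proof. by case: hw. Qed.
Let act_lin x : linear (act x). Proof. by case: lm. Qed.

Definition hvir_L (n : int) : {linear V -> V} := mklin (act_lin << HL n >>).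
Definition hvir_I (n : int) : {linear V -> V} := mklin (act_lin << HI n >>).
Local Notation L := hvir_L.
Local Notation I := hvir_I.

Let LE n y : L n y = act << HL n >> y. Proof. exact: mklinE. Qed.
Let IE n y : I n y = act << HI n >> y. Proof. exact: mklinE. Qed.

Lemma act_brU a b y : act << a >> (act << b >> y)
  = act << b >> (act << a >> y) + act (hvir_table K a b) y.
Proof.
have -> : hvir_table K a b = lie_br (<< a >> : hvir K) (<< b >> : hvir K).
  by rewrite [RHS]table_brU.
by case: lm => _ _ ->; rewrite addrC subrK.
Qed.

Lemma central_scalar b k (v : V) : generates act v ->
  (forall b', hvir_table K b b' = 0) -> act << b >> v = k *: v ->
  forall y, act << b >> y = k *: y.
Proof.
move=> gen tb bv y; pose Z := [set y | act << b >> y = k *: y].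
suff ZT : Z = setT by have : Z y by rewrite ZT.
apply: gen => //; split=> [|a u w Zu Zw|x w Zw] /=.
- by rewrite /Z /= -(mklinE (act_lin << b >>)) linear0 scaler0.
- by rewrite /Z /= act_lin Zu Zw scalerDr !scalerA mulrC.
rewrite /Z /=; elim/freeg_ind: x => [|a b' x IH].
  by rewrite (act_0l lm) -(mklinE (act_lin << b >>)) linear0 scaler0.
rewrite (act_Pl lm) act_lin IH act_brU tb (act_0l lm) addr0 Zw.
rewrite -[act << b' >> (_ *: _)](mklinE (act_lin << b' >>)) linearZ mklinE /=.
by rewrite scalerDr !scalerA mulrC.
Qed.

Lemma hstable_submodule S : (forall y, act << HCL >> y = cL *: y) ->
  (forall y, act << HCLI >> y = cLI *: y) -> (forall y, act << HCI >> y = 0 *: y) ->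
  hstable L I S -> submodule act S.
Proof.
move=> aL aLI aI [sS SL SI]; have [S0 SD] := sS; split=> // x y Sy.
elim/freeg_ind: x => [|a b x IH]; first by rewrite (act_0l lm).
rewrite (act_Pl lm); apply: SD => //.
case: b => [n|n|||]; [rewrite -LE; exact: SL | rewrite -IE; exact: SI |..].
- by rewrite aL; apply: subsZ.
- by rewrite aLI; apply: subsZ.
- by rewrite aI; apply: subsZ.
Qed.

Lemma hvir_hwmod : exists v, hwmod L I cL cLI h hI v.
Proof.
have [_ [v [[v0 gen] vpos [vL vI] [vCL vCI vCLI]]]] := hw.
have aL := central_scalar gen (b := HCL) (fun=> erefl) vCL.
have aLI := central_scalar gen (b := HCLI) (fun=> erefl) vCLI.
have aI := central_scalar gen (b := HCI) (fun=> erefl) vCI.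
(* [I(0)] is central in the Lie algebra as well: its brackets and their cocycles vanish. *)
have I0 y : I 0 y = hI *: y.
  rewrite IE; apply: (central_scalar gen (b := HI 0) _ vI) => -[m|m|||] //=.
    rewrite /hvir_LI addr0 oppr0 scale0r sub0r opprK.
    have [->|m0] := eqVneq m (- 0); last by rewrite mul0r scale0r.
    by rewrite oppr0 expr0n addr0 mulr0 scale0r.
  by rewrite /hvir_II mul0r scale0r.
have HS S := hstable_submodule (S := S) aL aLI aI.
exists v; split=> //.
- split=> [n m y|n m y|n m y|//].
  + rewrite !LE act_brU -addrA; congr (_ + _).
    by rewrite /= /hvir_LL (act_Dl lm) !(act_Zl lm) aL scalerA.
  + rewrite !LE !IE act_brU -addrA; congr (_ + _).
    rewrite /= /hvir_LI (act_Dl lm) (act_Nl lm) !(act_Zl lm) aLI scalerA.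
    by rewrite mulrNz scaleNr.
  + by rewrite !IE act_brU /= /hvir_II (act_Zl lm) aI scale0r scaler0 addr0.
- split=> [n n0|n n0|]; rewrite ?LE ?IE //.
    by case: (vpos n n0).
  by case: (vpos n n0).
- by move=> S sS Sv y; rewrite (gen S (HS S sS) Sv).
- move=> S sS y Sy y0; case: irr => _ _ irrS; case: (irrS S (HS S sS)) => [S0|->//].
  by move: Sy y0; rewrite S0 => /= ->; rewrite eqxx.
Qed.

Section W22.
Context (v : V) (M : hwmod L I cL cLI h hI v).

Definition w22_W (n : int) : {linear V -> V} := mklin (Wop_linear M n).
Local Notation W := w22_W.
Local Notation wact := (w22_action act cL cLI).

Lemma w22_WE n y : W n y = Wop I cLI n y. Proof. exact: mklinE. Qed.

Lemma wactU b y : wact << b >> y = w22_op act cL cLI b y.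
Proof. by rewrite /w22_action liftU scale1r. Qed.

Lemma wactL n y : wact << WL n >> y = L n y.
Proof. by rewrite wactU LE. Qed.

Lemma wactW n y : wact << WW n >> y = W n y.
Proof.
rewrite wactU w22_WE /Wop /= IE; congr (_ + _); apply: eq_fsbigr => i _.
by rewrite !IE.
Qed.

Lemma wactCL y : wact << WCL >> y = cL *: y. Proof. exact: wactU. Qed.
Lemma wactCW y : wact << WCW >> y = (- 24 * cLI ^+ 2) *: y. Proof. exact: wactU. Qed.

(** By bilinearity only basis elements matter, where the content is [LLE], [LWE] and the commutation
    of the operators W(n). *)
Lemma wact_lie : lie_module wact.
Proof.
have lin1 y : linear (wact^~ y) by apply: fglift_linear.
have P a x x' y : wact (a *: x + x') y = a *: wact x y + wact x' y by apply: lin1.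
have z y : wact 0 y = 0.
  by have := P (-1) 0 0 y; rewrite scaler0 addr0 scaleN1r addNr.
have D x x' y : wact (x + x') y = wact x y + wact x' y by rewrite -[x]scale1r P !scale1r.
have Z a x y : wact (a *: x) y = a *: wact x y by rewrite -[_ *: x]addr0 P z addr0.
have N x y : wact (- x) y = - wact x y by rewrite -scaleN1r Z scaleN1r.
have lin2U b : linear (wact << b >>).
  move=> a y y'; case: b => [n|n||].
  - by rewrite !wactL linearP.
  - by rewrite !wactW linearP.
  - by rewrite !wactCL scalerDr !scalerA mulrC.
  - by rewrite !wactCW scalerDr !scalerA mulrC.
have lin2 x : linear (wact x).
  move=> a y y'; elim/freeg_ind: x => [|k b x IH]; first by rewrite !z scaler0 addr0.
  rewrite !P IH lin2U !scalerDr !scalerA [a * k]mulrC -!addrA; congr (_ + _).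
  by rewrite addrCA.
split=> // x x' y.
have S3 (A t k : V) : t + k = A + t + k - A by rewrite [RHS]addrC !addrA addNr add0r.
have U a b : wact (w22_table K a b) y
    = wact << a >> (wact << b >> y) - wact << b >> (wact << a >> y).
  case: a b => [n|n||] [m|m||] /=.
  - by rewrite /w22_LL D !Z wactCL !wactL (LLE (hw_mod M)) scalerA -S3.
  - by rewrite /w22_LW D !Z wactCW !(wactL, wactW) (LWE M w22_WE) scalerA -S3.
  - by rewrite z wactCL !wactL wactCL linearZ subrr.
  - by rewrite z wactCW !wactL wactCW linearZ subrr.
  - rewrite /w22_LW N D !Z wactCW !(wactL, wactW) (LWE M w22_WE) scalerA.
    by rewrite [X in - X](S3 (W n (L m y))) opprB.
  - by rewrite z !wactW (WWC M w22_WE) subrr.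
  - by rewrite z wactCL !wactW wactCL linearZ subrr.
  - by rewrite z wactCW !wactW wactCW linearZ subrr.
  - by rewrite z !wactCL !wactL linearZ subrr.
  - by rewrite z !wactCL !wactW linearZ subrr.
  - by rewrite z subrr.
  - by rewrite z !wactCL !wactCW !scalerA mulrC subrr.
  - by rewrite z !wactCW !wactL linearZ subrr.
  - by rewrite z !wactCW !wactW linearZ subrr.
  - by rewrite z !wactCL !wactCW !scalerA mulrC subrr.
  - by rewrite z subrr.
have br0l (w : w22 K) : lie_br (0 : w22 K) w = 0 by apply: table_br0l.
have br0r (w : w22 K) : lie_br w (0 : w22 K) = 0 by apply: table_br0r.
have br a b : lie_br (<< a >> : w22 K) (<< b >> : w22 K) = w22_table K a b by apply: table_brU.
have C6 (A B C E : V) k : k *: (A - B) + (C - E) = k *: A + C - (k *: B + E).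
  by rewrite scalerBr opprD addrACA.
elim/freeg_ind: x => [|k a x IH].
  by rewrite br0l !z -[wact x' 0](mklinE (lin2 x')) linear0 subrr.
rewrite lie_brPl !P IH.
rewrite lin2 -C6; congr (_ *: _ + _).
elim/freeg_ind: x' {IH} => [|l b x' IH].
  by rewrite br0r !z -[wact _ 0](mklinE (lin2 << a >>)) linear0 subrr.
by rewrite lie_brPr !P IH lin2 -C6 br U.
Qed.

Lemma wstable_submodule S : submodule wact S <-> wstable L W S.
Proof.
split=> [[S0 SD SA]|[[S0 SD] SL SW]].
  by split=> // n x Sx; [rewrite -wactL | rewrite -wactW]; apply: SA.
have sS : subspace S by [].
split=> // x y Sy.
elim/freeg_ind: x => [|a b x IH]; first by rewrite (act_0l wact_lie).
rewrite (act_Pl wact_lie); apply: SD => //.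
case: b => [n|n||].
- by rewrite wactL; apply: SL.
- by rewrite wactW; apply: SW.
- by rewrite wactCL; apply: subsZ.
- by rewrite wactCW; apply: subsZ.
Qed.

Lemma w_irr_module : w_irr L W -> irreducible_module wact.
Proof.
move=> wi; split; [exact: wact_lie | by exists v; apply: hw_n0 M |].
move=> S /[dup] mS /wstable_submodule/wi[S0|ST]; [left | right]; apply/seteqP; split=> // x.
by move=> ->; case: mS.
Qed.

Lemma w_chain_module : w_chain L W -> exists N, chain_sub wact N.
Proof.
move=> [N [sN ex nex ch]]; exists N; split=> //; first exact/wstable_submodule.
by move=> S /wstable_submodule/ch.
Qed.

(* Lowest degree in [S] modulo [T] is killed by the positive operators, and
   [W 0] acts on it unipotently up to the scalar [hW], so some iterate of
   [W 0 - hW] is a common eigenvector modulo [T]. *)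
Lemma subquotient_hwvec (S T : set V) : submodule wact S -> submodule wact T ->
  forall x, S x -> ~ T x -> exists h' hW y, [/\ S y, ~ T y,
    forall n : int, 0 < n -> T (wact << WL n >> y) /\ T (wact << WW n >> y),
    T (wact << WL 0 >> y - h' *: y) & T (wact << WW 0 >> y - hW *: y)].
Proof.
move=> mS mT x Sx NTx.
have /wstable_submodule[sS SL SW] := mS; have /wstable_submodule[sT TL TW] := mT.
have [d [y [Hy Sy NTy ymin]]] := hs_minimal M sS (SL 0) sT Sx NTx.
pose hW := hI ^+ 2 - 2 * cLI * hI; pose f := fun y => W 0 y - hW *: y.
have [N fN] : exists N, iter N f y = 0 by apply: (W0_nilp M w22_WE Hy).
have Hf z : hs L I v d z /\ S z -> hs L I v d (f z) /\ S (f z).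
  move=> [Hz Sz]; split; last by apply: subsB; [|exact: SW|exact: subsZ].
  apply: subsB (hs_subspace _ _ _ _) _ _; last by apply: subsZ => //; apply: hs_subspace.
  by rewrite -[d%:Z]subr0; apply: (hsW M w22_WE).
have [z [[Hz Sz] NTz Tfz]] : exists z, [/\ hs L I v d z /\ S z, ~ T z & T (f z)].
  have : T (iter N f y) by rewrite fN; case: sT.
  elim: N y Hy Sy NTy {ymin fN} => [|N IH] z Hz Sz NTz; first by [].
  rewrite iterSr => Tf'; case: (pselect (T (f z))) => [Tfz|NTf]; first by exists z.
  have [Hfz Sfz] := Hf z (conj Hz Sz); exact: IH Hfz Sfz NTf Tf'.
exists (h + d%:R), hW, z; split=> //.
- move=> n n0; rewrite wactL wactW; split; apply: (ymin (d%:Z - n)); try lia.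
  + exact: (hsL (hw_mod M) (hw_vec M)).
  + exact: SL.
  + exact: (hsW M w22_WE).
  + exact: SW.
- by rewrite wactL (hs_L0 (hw_mod M) (hw_vec M) Hz) subrr; case: sT.
- by rewrite wactW.
Qed.

Lemma wact_C y :
  wact << WCL >> y = cL *: y /\ wact << WCW >> y = (- 24 * cLI ^+ 2) *: y.
Proof. by rewrite wactCL wactCW. Qed.

(** [subquotient_hwvec], applied to [N] over 0 and to [V] over [N], yields the highest weight
    vectors; they generate because both pieces are irreducible. *)
Lemma chain_extension N : chain_sub wact N ->
  w22_nonsplit_extension wact cL (- 24 * cLI ^+ 2).
Proof.
move=> chN; have [mN [x Nx x0] [z Nz] ch] := chN; have lmw := wact_lie.
have [V1 [act1 [i [lm1 hom1 i_inj iP]]]] := sub_module lmw mN.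
have [V2 [act2 [q [lm2 hom2 q_surj qP]]]] := quot_module lmw mN.
have irr1 := chain_sub_irr chN lm1 hom1 i_inj iP.
have irr2 := chain_quot_irr chN lm2 hom2 q_surj qP.
split=> //; exists V1, V2, act1, act2, i, q; split.
- split=> //; have [iL iact] := hom1; pose i' := mklin iL.
  have i'E y : i y = i' y by rewrite mklinE.
  have m0 : submodule wact [set 0].
    by apply/wstable_submodule; split=> [|n y ->|n y ->]; rewrite ?linear0.
  have [|h' [hW [y [Ny y0 ypos yL yW]]]] := subquotient_hwvec mN m0 Nx; first exact/eqP.
  have [y1 _ y1E] := (iP y).1 Ny; exists h', hW; split=> //; exists y1; split.
  + have y1n0 : y1 != 0.
      by apply/eqP => y10; apply: y0; rewrite -y1E y10 i'E linear0.
    by split=> //; apply: simple_generates.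
  + by move=> n /ypos[/= Ly Wy]; split; apply: i_inj; rewrite iact y1E [RHS]i'E linear0.
  + move/eqP: yL; move/eqP: yW; rewrite !subr_eq0 => /eqP yW /eqP yL.
    by split; apply: i_inj; rewrite iact y1E ?yL ?yW [RHS]i'E linearZ -i'E y1E.
  + have [yCL yCW] := wact_C y.
    by split; apply: i_inj; rewrite iact y1E ?yCL ?yCW [RHS]i'E linearZ -i'E y1E.
- split=> //; have [qL qact] := hom2; pose q' := mklin qL.
  have q'E y : q y = q' y by rewrite mklinE.
  have mT : submodule wact setT by [].
  have [//|h' [hW [y [_ Ny ypos yL yW]]]] := subquotient_hwvec (x := z) mT mN _ Nz.
  exists h', hW; split=> //; exists (q y); split.
  + have y1n0 : q y != 0 by apply/eqP => /qP.
    by split=> //; apply: simple_generates.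
  + by move=> n /ypos[Ly Wy]; split; rewrite -qact; apply/qP.
  + have qeq a b : N (a - b) -> q a = q b.
      by move=> /qP; rewrite !q'E linearB => /eqP; rewrite subr_eq0 => /eqP.
    by split; rewrite -qact ?(qeq _ _ yL) ?(qeq _ _ yW) q'E linearZ -q'E.
  + have [yCL yCW] := wact_C y.
    by split; rewrite -qact ?yCL ?yCW q'E linearZ -q'E.
- split=> // y; exact: iff_trans (qP y) (iP y).
- exact: (chain_nonsplit chN hom2 qP).
Qed.

Lemma chain_reducible N : chain_sub wact N -> ~ irreducible_module wact.
Proof.
move=> [mN [x Nx x0] [z Nz] _] [_ _ irrw]; case: (irrw N mN) => NE.
  by move: Nx x0; rewrite NE => /= ->; rewrite eqxx.
by apply: Nz; rewrite NE.
Qed.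

End W22.
End HeisenbergVirasoro.

Theorem theorem1p1 (R : realType) (cL cLI h hI : R[i])
    (V : lmodType R[i]) (act : hvir R[i] -> V -> V) :
  cLI != 0 ->
  irreducible_module act ->
  hvir_highest_weight_module act cL 0 cLI h hI ->
  (irreducible_module (w22_action act cL cLI) <->
     ~ atypical cL cLI (h, hI)) /\
  (atypical cL cLI (h, hI) ->
     w22_nonsplit_extension (w22_action act cL cLI) cL (- 24 * cLI ^+ 2)).
Proof.
move=> c0 irr hw; have [v M] := hvir_hwmod irr hw.
have WE n x : w22_W M n x = Wop (hvir_I hw) cLI n x by apply: w22_WE.
have chain : atypical cL cLI (h, hI) -> exists N, chain_sub (w22_action act cL cLI) N.
  by move=> /(w_chain_atypical M WE c0)/w_chain_module.
split; last by move=> /chain[N chN]; apply: (chain_extension M chN).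
split=> [irrW /chain[N chN]|nat]; first exact: (chain_reducible chN irrW).
by apply: (w_irr_module (w_irr_typical M WE c0 nat)).
Qed.
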